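(* Let $\varphi\colon R\to S$ be a module-finite homomorphism of nonzero commutative Noetherian rings with $\operatorname{fd}_R(S)$ finite, and let $C$ be a homologically degreewise finite $R$-complex. If $C$ is $R$-semidualizing, then $\mathbf R\mathrm{Hom}_R(S,C)$ is $S$-semidualizing and $$\inf(C)-\operatorname{pd}_R(S)\leq\inf(\mathbf R\mathrm{Hom}_R(S,C))\leq\sup(C)$$ with equality on the left if $R$ is local or $\operatorname{amp}(C)=0$. Conversely, if $\mathbf R\mathrm{Hom}_R(S,C)$ is $S$-semidualizing and $\mathrm{m\text{-}Spec}(R)\subseteq\operatorname{Im}(\varphi^* )$, then $C$ is $R$-semidualizing and $$\inf(\mathbf R\mathrm{Hom}_R(S,C))\leq\inf(C)+\sup(\mathbf R\mathrm{Hom}_R(S,R))$$ with equality if $\operatorname{amp}(\mathbf R\mathrm{Hom}_R(S,R))=0$.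
   Context: Complexes are indexed homologically; $\mathsf D(R)$ is the derived category. $\inf(X)$ and $\sup(X)$ are the infimum and supremum of $\{i\mid\operatorname{H}_i(X)\neq0\}$, and $\operatorname{amp}(X)=\sup(X)-\inf(X)$. A complex is homologically finite (respectively, homologically degreewise finite) if its total homology (respectively, each homology module) is finitely generated. An $R$-complex $C$ is semidualizing if it is homologically finite and the homothety morphism $R\to\mathbf R\mathrm{Hom}_R(C,C)$ is an isomorphism in $\mathsf D(R)$. $\varphi$ is module-finite if $S$ is a finitely generated $R$-module; $\mathbf R\mathrm{Hom}_R(S,C)$ is viewed as an $S$-complex. $\varphi^*\colon\operatorname{Spec}(S)\to\operatorname{Spec}(R)$ is the induced map, $\mathrm{m\text{-}Spec}(R)$ the set of maximal ideals of $R$. $\operatorname{fd}_R$, $\operatorname{pd}_R$ denote flat and projective dimension. *)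

(* Defs.v *)
From HB Require Import structures.
From mathcomp Require Import all_boot all_order all_algebra ring_quotient.
From mathcomp Require Import boolp classical_sets functions cardinality.
From mathcomp Require Import constructive_ereal zify.

Set Implicit Arguments.
Unset Strict Implicit.
Unset Printing Implicit Defensive.

Import Order.TTheory GRing.Theory Num.Theory.
Local Open Scope classical_set_scope.
Local Open Scope ring_scope.

(* [idealr_closed I] includes [1 \notin I]; the unit ideal is generated by 1. *)
Definition noetherian (R : comNzRingType) : Prop :=
  forall I : {pred R}, idealr_closed I ->
  exists (k : nat) (g : 'I_k -> R),
  forall x, x \in I <-> exists a : 'I_k -> R, x = \sum_l a l * g l.

Definition prime_ideal (R : comNzRingType) (I : {pred R}) : Prop :=
  idealr_closed I /\ prime_idealr_closed I.

Definition maximal_ideal (R : comNzRingType) (I : {pred R}) : Prop :=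
  idealr_closed I /\
  forall J : {pred R}, idealr_closed J -> {subset I <= J} -> I =i J.

Definition local_ring (R : comNzRingType) : Prop :=
  exists2 m : {pred R}, maximal_ideal m &
    forall m' : {pred R}, maximal_ideal m' -> m' =i m.

Definition mSpec_sub_image (R S : comNzRingType) (phi : {rmorphism R -> S}) :=
  forall m : {pred R}, maximal_ideal m ->
  exists2 q : {pred S}, prime_ideal q & m =i [preim phi of q].

Definition fin_gen (R : comNzRingType) (M : lmodType R) : Prop :=
  exists (k : nat) (g : 'I_k -> M),
  forall x, exists a : 'I_k -> R, x = \sum_l a l *: g l.

Definition restrict (R S : comNzRingType) (phi : {rmorphism R -> S})
  (M : lmodType S) : Type := M.

Section Restrict.
Context (R S : comNzRingType) (phi : {rmorphism R -> S}) (M : lmodType S).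
HB.instance Definition _ := GRing.Zmodule.on (restrict phi M).

Let act (r : R) (x : restrict phi M) : restrict phi M := phi r *: (x : M).

Fact restrict_scalerA r1 r2 x : act r1 (act r2 x) = act (r1 * r2) x.
Proof. by rewrite /act rmorphM scalerA. Qed.
Fact restrict_scale1r : left_id 1 act.
Proof. by move=> x; rewrite /act rmorph1 scale1r. Qed.
Fact restrict_scalerDr : right_distributive act +%R.
Proof. by move=> r x y; rewrite /act scalerDr. Qed.
Fact restrict_scalerDl x : {morph act^~ x : r1 r2 / r1 + r2}.
Proof. by move=> r1 r2; rewrite /act rmorphD scalerDl. Qed.

HB.instance Definition _ := GRing.Zmodule_isLmodule.Build R (restrict phi M)
  restrict_scalerA restrict_scale1r restrict_scalerDr restrict_scalerDl.
End Restrict.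

Definition is_tensor (R : comNzRingType) (M N T : lmodType R)
  (t : {bilinear M -> N -> T}) : Prop :=
  forall (U : lmodType R) (b : {bilinear M -> N -> U}),
  exists2 f : {linear T -> U}, (forall m n, f (t m n) = b m n) &
    forall g : {linear T -> U}, (forall m n, g (t m n) = b m n) -> g =1 f.

(* [g] is the map [M (x) f], for any choice of the two tensor products. *)
Definition flat (R : comNzRingType) (M : lmodType R) : Prop :=
  forall (N N' : lmodType R) (f : {linear N -> N'}), injective f ->
  forall (T T' : lmodType R)
    (t : {bilinear M -> N -> T}) (t' : {bilinear M -> N' -> T'}),
  is_tensor t -> is_tensor t' ->
  forall g : {linear T -> T'}, (forall m n, g (t m n) = t' m (f n)) ->
  injective g.

Definition projective (R : comNzRingType) (P : lmodType R) : Prop :=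
  forall (M N : lmodType R) (f : {linear M -> N}) (g : {linear P -> N}),
  (forall y, exists x, f x = y) ->
  exists h : {linear P -> M}, forall p, f (h p) = g p.

(* The differential is given by all its components [diff i j : X_i -> X_j],
   which vanish unless j = i - 1; this avoids transporting along equalities
   between degrees. *)
Record complex (R : comNzRingType) := Complex {
  term :> int -> lmodType R;
  diff : forall i j, {linear term i -> term j};
  diff_shape : forall i j x, j != i - 1 -> diff i j x = 0;
  diff_diff : forall i j k x, diff j k (diff i j x) = 0 }.
Arguments diff {R} c i j.

Section Homology.
Context (R : comNzRingType) (X : complex R).

Definition cycle n (x : X n) : Prop := diff X n (n - 1) x = 0.
Definition boundary n (x : X n) : Prop := exists y, diff X (n + 1) n y = x.

Definition homology_nonzero n : Prop :=
  exists2 x : X n, cycle x & ~ boundary x.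

Definition homology_fin_gen n : Prop :=
  exists (k : nat) (g : 'I_k -> X n), (forall l, cycle (g l)) /\
  forall z : X n, cycle z ->
  exists a : 'I_k -> R, boundary (z - \sum_l a l *: g l).

Definition degreewise_homologically_finite : Prop :=
  forall n, homology_fin_gen n.

(* Families representing the elements of the direct sum of the H_n(X). *)
Definition total_cycle (z : forall n, X n) : Prop :=
  (forall n, cycle (z n)) /\ finite_set [set n | z n != 0].

Definition homologically_finite : Prop :=
  exists (k : nat) (g : 'I_k -> forall n, X n), (forall l, total_cycle (g l)) /\
  forall z, total_cycle z ->
  exists a : 'I_k -> R, forall n, boundary (z n - \sum_l a l *: g l n).

Definition acyclic : Prop := forall n, ~ homology_nonzero n.

Definition hinf : \bar int := infimum +oo%E [set n%:E | n in homology_nonzero].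
Definition hsup : \bar int := supremum -oo%E [set n%:E | n in homology_nonzero].
Definition amp : \bar int := (hsup - hinf)%E.
End Homology.

Definition sphere_term (R : comNzRingType) (M : lmodType R) (i : int)
  : lmodType R := if i is Posz 0 then M else 'rV[R]_0.

Program Definition sphere (R : comNzRingType) (M : lmodType R) : complex R :=
  @Complex R (sphere_term M) (fun i j => \0) _ _.

(* Degree-n families of phi-semilinear maps, again with all components
   X_i -> Y_j, zero unless j = i + n.  For phi : R -> S this is the degree-n
   part of Hom_R(X, Y), where X is a graded S-module regarded as an R-module
   along phi; it is an S-module through X. *)
Record hmap (R S : comNzRingType) (phi : {rmorphism R -> S})
  (X : int -> lmodType S) (Y : int -> lmodType R) (n : int) := Hmap {
  hmap_fun :> forall i j, X i -> Y j;
  hmap_semilinear : forall i j r x y,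
    @hmap_fun i j (phi r *: x + y) = r *: @hmap_fun i j x + @hmap_fun i j y;
  hmap_shape : forall i j x, j != i + n -> @hmap_fun i j x = 0 }.
Arguments hmap_fun {R S phi X Y n} h i j x.
Arguments hmap_semilinear {R S phi X Y n} h i j r x y.
Arguments hmap_shape {R S phi X Y n} h [i j] x _.

Section HmapModule.
Context (R S : comNzRingType) (phi : {rmorphism R -> S})
  (X : int -> lmodType S) (Y : int -> lmodType R) (n : int).
Notation hmap := (hmap phi X Y n).
Implicit Types f g : hmap.

Fact hmap_eq f g : (forall i j x, f i j x = g i j x) -> f = g.
Proof.
case: f g => [f fl fs] [g gl gs] /= fg.
have E : f = g by apply: functional_extensionality_dep => i;
  apply: functional_extensionality_dep => j; apply/funext => x; exact: fg.
by case: g / E gl gs {fg} => gl gs; congr Hmap; exact: Prop_irrelevance.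
Qed.

Program Definition hmap0 : hmap := @Hmap _ _ _ _ _ _ (fun _ _ _ => 0) _ _.
Next Obligation. by rewrite scaler0 addr0. Qed.
Program Definition hmap_opp f : hmap :=
  @Hmap _ _ _ _ _ _ (fun i j x => - f i j x) _ _.
Next Obligation. by rewrite hmap_semilinear opprD scalerN. Qed.
Next Obligation. by rewrite hmap_shape ?oppr0. Qed.
Program Definition hmap_add f g : hmap :=
  @Hmap _ _ _ _ _ _ (fun i j x => f i j x + g i j x) _ _.
Next Obligation. by rewrite !hmap_semilinear scalerDr addrACA. Qed.
Next Obligation. by rewrite !hmap_shape ?addr0. Qed.
Program Definition hmap_scale (s : S) f : hmap :=
  @Hmap _ _ _ _ _ _ (fun i j x => f i j (s *: x)) _ _.
Next Obligation.
by rewrite -hmap_semilinear scalerDr !scalerA (mulrC s).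
Qed.
Next Obligation. by rewrite hmap_shape. Qed.

HB.instance Definition _ := gen_eqMixin hmap.
HB.instance Definition _ := gen_choiceMixin hmap.

Fact hmap_addA : associative hmap_add.
Proof. by move=> f g h; apply: hmap_eq => i j x /=; rewrite addrA. Qed.
Fact hmap_addC : commutative hmap_add.
Proof. by move=> f g; apply: hmap_eq => i j x /=; rewrite addrC. Qed.
Fact hmap_add0 : left_id hmap0 hmap_add.
Proof. by move=> f; apply: hmap_eq => i j x /=; rewrite add0r. Qed.
Fact hmap_addN : left_inverse hmap0 hmap_opp hmap_add.
Proof. by move=> f; apply: hmap_eq => i j x /=; rewrite addNr. Qed.
HB.instance Definition _ :=
  GRing.isZmodule.Build hmap hmap_addA hmap_addC hmap_add0 hmap_addN.

Fact hmapD f i j : {morph f i j : x y / x + y}.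
Proof.
by move=> x y; have := hmap_semilinear f i j 1 x y; rewrite rmorph1 !scale1r.
Qed.
Fact hmap_x0 f i j : f i j 0 = 0.
Proof. by apply: (addrI (f i j 0)); rewrite -hmapD !addr0. Qed.
Fact hmapZ f i j r x : f i j (phi r *: x) = r *: f i j x.
Proof. by rewrite -[_ *: x]addr0 hmap_semilinear hmap_x0 addr0. Qed.
Fact hmapN f i j x : f i j (- x) = - f i j x.
Proof. by rewrite -scaleN1r -(rmorph1 phi) -rmorphN hmapZ scaleN1r. Qed.

Fact hmap_scaleA s t f : hmap_scale s (hmap_scale t f) = hmap_scale (s * t) f.
Proof. by apply: hmap_eq => i j x /=; rewrite scalerA mulrC. Qed.
Fact hmap_scale1 : left_id 1 hmap_scale.
Proof. by move=> f; apply: hmap_eq => i j x /=; rewrite scale1r. Qed.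
Fact hmap_scaleDr : right_distributive hmap_scale +%R.
Proof. by move=> s f g; apply: hmap_eq. Qed.
Fact hmap_scaleDl f : {morph hmap_scale^~ f : s t / s + t}.
Proof. by move=> s t; apply: hmap_eq => i j x /=; rewrite scalerDl hmapD. Qed.
HB.instance Definition _ := GRing.Zmodule_isLmodule.Build S hmap
  hmap_scaleA hmap_scale1 hmap_scaleDr hmap_scaleDl.
End HmapModule.

Section HomComplex.
Context (R S : comNzRingType) (phi : {rmorphism R -> S})
  (X : complex S) (Y : complex R).

(* D f = d f - (-1)^n f d on a map f of degree n. *)
Program Definition hom_diff_fun n m (f : hmap phi X Y n) : hmap phi X Y m :=
  @Hmap _ _ _ _ _ _ (fun i j x =>
    if m == n - 1 then
      diff Y (j + 1) j (f i (j + 1) x)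
        - (-1) ^+ `|n|%N *: f (i - 1) j (diff X i (i - 1) x)
    else 0) _ _.
Next Obligation.
case: eqP => _; last by rewrite scaler0 addr0.
rewrite linearP !hmap_semilinear linearP.
by rewrite !scalerDr scalerN opprD !scalerA (mulrC r) addrACA.
Qed.
Next Obligation.
case: eqP => // mn; rewrite !hmap_shape ?linear0 ?scaler0 ?oppr0 ?addr0 //;
  by apply/eqP => E; case/eqP: H; lia.
Qed.

Fact hom_diff_linear n m : linear (@hom_diff_fun n m).
Proof.
move=> s f g; apply: hmap_eq => i j x /=.
case: eqP => _; last by rewrite addr0.
rewrite linearD scalerDr opprD addrACA.
by rewrite [diff X i (i - 1) (s *: x)]linearZ.
Qed.
HB.instance Definition _ n m := GRing.isLinear.Build S (hmap phi X Y n)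
  (hmap phi X Y m) *:%R (@hom_diff_fun n m) (@hom_diff_linear n m).

Fact hom_diff_shape n m (f : hmap phi X Y n) :
  m != n - 1 -> hom_diff_fun m f = 0.
Proof. by move=> mn; apply: hmap_eq => i j x /=; rewrite (negPf mn). Qed.

Fact hom_diff_diff n m p (f : hmap phi X Y n) :
  hom_diff_fun p (hom_diff_fun m f) = 0.
Proof.
apply: hmap_eq => i j x /=; case: eqP => // _; case: eqP => [->|_]; last first.
  by rewrite linear0 scaler0 subr0.
have sg : (-1) ^+ `|n - 1|%N = - (-1) ^+ `|n|%N :> R.
  rewrite -signr_odd -[in RHS]signr_odd.
  have -> : odd `|(n - 1)%R|%N = ~~ odd `|n|%N by lia.
  by case: odd; rewrite /= ?expr0 ?expr1 ?opprK.
rewrite linearB /= linearZ /= !diff_diff hmap_x0 scaler0 subr0 sub0r sg.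
by rewrite scaleNr opprK addNr.
Qed.

(* The complex Hom_R(X, Y), as a complex of S-modules. *)
Definition hom_complex : complex S :=
  @Complex S (hmap phi X Y) (fun n m => @hom_diff_fun n m)
    hom_diff_shape hom_diff_diff.
End HomComplex.

Record chain_map (R : comNzRingType) (X Y : complex R) := ChainMap {
  chain_hmap :> hmap idfun X Y 0;
  chain_mapP : forall i j x,
    diff Y i j (chain_hmap i i x) = chain_hmap j j (diff X i j x) }.

(* Bijectivity of H_n(f) for all n. *)
Definition quasi_iso (R : comNzRingType) (X Y : complex R)
  (f : chain_map X Y) : Prop :=
  forall n,
    (forall x : X n, cycle x -> boundary (f n n x) -> boundary x) /\
    (forall y : Y n, cycle y ->
       exists2 x : X n, cycle x & boundary (y - f n n x)).

Definition K_injective (R : comNzRingType) (I : complex R) : Prop :=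
  forall A : complex R, acyclic A -> acyclic (hom_complex idfun A I).

(* For such an iota : Y -> I and any complex X of S-modules,
   [hom_complex phi X I] represents RHom_R(X, Y) in D(S). *)
Definition injective_resolution (R : comNzRingType) (Y I : complex R)
  (iota : chain_map Y I) : Prop := K_injective I /\ quasi_iso iota.

(* Given a resolution iota : X -> I, the homothety morphism
   R -> RHom_R(X, X) is represented by R -> Hom_R(X, I), r |-> r iota. *)
Section Homothety.
Context (R : comNzRingType) (X I : complex R) (iota : chain_map X I).

Definition homothety_fun (i j : int) :
  sphere R^o i -> hom_complex idfun X I j :=
  match i, j return sphere R^o i -> hom_complex idfun X I j with
  | Posz 0, Posz 0 => fun r : R => r *: (iota : hmap idfun X I 0)
  | _, _ => fun _ => 0
  end.

Program Definition homothety_hmap :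
  hmap idfun (sphere R^o) (hom_complex idfun X I) 0 :=
  @Hmap _ _ _ _ _ _ homothety_fun _ _.
Next Obligation.
move: x y; case: i => [[|i]|i] x y; case: j => [[|j]|j] /=;
  rewrite ?scaler0 ?addr0 //.
by rewrite scalerDl scalerA.
Qed.
Next Obligation.
by move: x H; case: i => [[|i]|i] x; case: j => [[|j]|j].
Qed.

Program Definition homothety : chain_map (sphere R^o) (hom_complex idfun X I) :=
  @ChainMap _ _ _ homothety_hmap _.
Next Obligation.
have -> : homothety_fun j (0 : sphere R^o j) = 0.
  exact: (hmap_x0 homothety_hmap j j).
case: i x => [[|i]|i] x; rewrite ?[homothety_fun _ _]/= ?linear0 //.
rewrite linearZ /=; apply: hmap_eq => k l y /=; case: eqP => // _.
rewrite expr0 scale1r; have [kl|kl] := eqVneq k (l + 1); last first.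
  rewrite !hmap_shape ?linear0 ?oppr0 ?addr0 //; apply/eqP => E;
    by case/eqP: kl; lia.
subst k; rewrite chain_mapP; move: (l + 1 - 1) (addrK 1 l) => p ->.
by rewrite subrr.
Qed.
End Homothety.

Definition semidualizing (R : comNzRingType) (C : complex R) : Prop :=
  homologically_finite C /\
  exists (I : complex R) (iota : chain_map C I),
    injective_resolution iota /\ quasi_iso (homothety iota).

(* A resolution F -> M with P-terms, concentrated in degrees 0, ..., n.  The
   length n is an integer, so that the zero module has dimension -oo. *)
Definition has_resolution (R : comNzRingType) (P : lmodType R -> Prop)
  (M : lmodType R) (n : int) : Prop :=
  exists (F : complex R) (e : chain_map F (sphere M)),
    [/\ forall i, P (F i),
        forall i : int, (i < 0) || (n < i) -> forall x : F i, x = 0 &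
        quasi_iso e].

Definition flat_dim (R : comNzRingType) (M : lmodType R) : \bar int :=
  infimum +oo%E [set n%:E | n in has_resolution (@flat R) M].

Definition proj_dim (R : comNzRingType) (M : lmodType R) : \bar int :=
  infimum +oo%E [set n%:E | n in has_resolution (@projective R) M].

(* Main.v *)
(* Since [fd S] is finite, [S] has a resolution [P -> S] of finite length by
   finitely generated projectives; put [B = RHom (S, C)] and [P* = Hom (P, R)].
   Tensor evaluation identifies [S -> RHom_S (B, B) = RHom (B, C)] with
   [P* ] applied to the homothety [R -> RHom (C, C)]: the former is an
   isomorphism iff [Hom (P*, X)] is acyclic, where [X] is the cone of the latter.
   If [C] is semidualizing then [X] is acyclic, which settles one direction.

   For the converse one needs that [P*] detects the vanishing of complexes with
   finitely generated homology.  With [Q = Hom (P, P)] and [1 : R -> Q], let [E]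
   be the endofunctor sending [Y] to the cofibre of [Hom (Q, Y) -> Y].  By
   Noetherian induction over the ideals containing [ker phi] (at a prime, lying
   over provides a functional on [Q] splitting [1] generically) the canonical
   map from [Y] to some [E^r Y] vanishes as soon as [ker phi] annihilates [Y] up
   to a filtration.  This applies to the endomorphisms of the Koszul complex [K]
   on generators of [ker phi], so acyclicity of [Hom (Q, X)] in a window forces
   that of [Hom (K, X)]; as [ker phi] lies in the Jacobson radical, Nakayama's
   lemma then gives that of [X].

   The bounds on [inf B] come from deforming the identity of [P], one degree at a
   time from the top, to a map that vanishes: in each degree the cocycles of [P*]
   are coboundaries modulo a maximal ideal [m] whenever [Hom (P, C)] has no
   homology in the corresponding degree and [m] does not absorb the bottom
   homology of [C], and Nakayama's lemma upgrades this to a coboundary after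
   multiplication by an element of [1 + m]. *)
Require Import Defs.
From HB Require Import structures.
From mathcomp Require Import all_boot all_order all_algebra.
From mathcomp Require Import boolp classical_sets functions cardinality.
From mathcomp Require Import perm constructive_ereal zify ring.
Import Defs.

Set Implicit Arguments.
Unset Strict Implicit.
Unset Printing Implicit Defensive.

Import Order.TTheory GRing.Theory Num.Theory.
Local Open Scope ring_scope.

(** * Chain complexes and homology bijections *)

(** In the converse [C] is only degreewise finite, so at the start it has no bounded below free
    resolution, and the homology of its derived endomorphisms is not known to be finitely generated.
    This is why detection is proved with a window: a number [w], independent of [X] and [n], such
    that acyclicity of [Hom (Hom P P) X] in the degrees within [w] of [n] gives that of [X] in
    degree [n]. It is used twice: for [X = C], which bounds the homology of [C], and only then for
    the cone of the homothety, whose homology has become finitely generated. It is also why cofibres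
    are counted: each of them widens the range of degrees that matters.

    Neither localizations nor tensor products of complexes are formed. A functional over a residue
    field becomes a function that is linear modulo a prime, a subquotient becomes a pair of
    subcomplexes [(V, U)], and tensoring with the dual of [P] becomes a bilinear map into [Hom P Y].
    A minimal resolution over a local ring becomes a resolution of least length, whose top
    differential cannot split. *)

Notation Hom := (hom_complex idfun).

Section Linear.
Context (R : comNzRingType).

Definition mklin (M N : lmodType R) (f : M -> N) (fl : linear f) :
  {linear M -> N} := HB.pack f (GRing.isLinear.Build R M N *:%R f fl).

(** A total transport, zero when the degrees differ. Being linear in [x], it lets equalities such as
    [n + 1 - 1 = n] be handled by substitution, without casts in the statements. *)
Definition tr (X : int -> lmodType R) (i j : int) (x : X i) : X j :=
  if @eqP _ i j is ReflectT e then ecast k (X k) e x else 0.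

Lemma trE (X : int -> lmodType R) i (x : X i) : tr i x = x.
Proof.
by rewrite /tr; case: eqP => // e; rewrite (eq_irrelevance e erefl).
Qed.

Lemma tr0 (X : int -> lmodType R) i j (x : X i) : j != i -> tr j x = 0.
Proof. by rewrite /tr eq_sym; case: eqP. Qed.

Fact tr_linear (X : int -> lmodType R) i j : linear (@tr X i j).
Proof.
move=> a x y; have [->|ji] := eqVneq j i; first by rewrite !trE.
by rewrite !tr0 // scaler0 addr0.
Qed.
HB.instance Definition _ (X : int -> lmodType R) i j :=
  GRing.isLinear.Build R (X i) (X j) *:%R (@tr X i j) (@tr_linear X i j).

Definition sg (n : int) : R := (-1) ^+ `|n|%N.

Lemma sgE n : sg n = if odd `|n|%N then -1 else 1.
Proof. by rewrite /sg -signr_odd; case: odd. Qed.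
Lemma sgD (m n : int) : sg (m + n) = sg m * sg n.
Proof.
rewrite !sgE; have -> : odd `|(m + n)%R|%N = odd `|m|%N (+) odd `|n|%N by lia.
by do 2!case: odd; rewrite /= ?mulr1 ?mul1r ?mulN1r ?opprK.
Qed.
Lemma sgN (n : int) : sg (- n) = sg n.
Proof. by rewrite /sg abszN. Qed.
Lemma sgS (n : int) : sg (n + 1) = - sg n.
Proof. by rewrite sgD [sg 1]sgE mulrN1. Qed.
Lemma sgB1 (n : int) : sg (n - 1) = - sg n.
Proof. by rewrite sgD sgN [sg 1]sgE mulrN1. Qed.
Lemma sgK n : sg n * sg n = 1.
Proof. by rewrite sgE; case: odd; rewrite ?mulrNN mulr1. Qed.
Lemma sg0 : sg 0 = 1.
Proof. by rewrite /sg expr0. Qed.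
End Linear.
Arguments tr {R X i} j x.
Arguments sg {R} n.

Section ComplexTheory.
Context (R : comNzRingType).
Implicit Types X Y Z A : complex R.

Lemma cycleE X n m (x : X n) : cycle x -> diff X n m x = 0.
Proof.
move=> cx; have [->//|mn] := eqVneq m (n - 1).
exact: diff_shape.
Qed.

Lemma boundaryI X m n (y : X m) : boundary (diff X m n y).
Proof.
have [e|e] := eqVneq n (m - 1).
  by have E : m = n + 1 by [lia]; subst m; exists y.
by exists 0; rewrite linear0 diff_shape.
Qed.

Lemma boundary_cycle X n (x : X n) : boundary x -> cycle x.
Proof. by case=> y <-; rewrite /cycle diff_diff. Qed.

Lemma boundary0 X n : boundary (0 : X n).
Proof. by exists 0; rewrite linear0. Qed.
Lemma boundaryD X n (x y : X n) : boundary x -> boundary y -> boundary (x + y).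
Proof. by case=> u <- [v <-]; exists (u + v); rewrite linearD. Qed.
Lemma boundaryN X n (x : X n) : boundary x -> boundary (- x).
Proof. by case=> u <-; exists (- u); rewrite linearN. Qed.
Lemma boundaryB X n (x y : X n) : boundary x -> boundary y -> boundary (x - y).
Proof. by move=> bx /boundaryN; exact: boundaryD. Qed.
Lemma boundaryZ X n a (x : X n) : boundary x -> boundary (a *: x).
Proof. by case=> u <-; exists (a *: u); rewrite linearZ. Qed.
Lemma boundary_sum X n (T : Type) (s : seq T) (P : pred T) (x : T -> X n) :
  (forall t, boundary (x t)) -> boundary (\sum_(t <- s | P t) x t).
Proof. by move=> bx; elim/big_ind: _ => //; [exact: boundary0|exact: boundaryD]. Qed.
Lemma boundary_trans X n (x y z : X n) :
  boundary (x - y) -> boundary (y - z) -> boundary (x - z).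
Proof. by move=> b1 b2; rewrite -(subrKA y); exact: boundaryD. Qed.
Lemma boundary_sym X n (x y : X n) : boundary (x - y) -> boundary (y - x).
Proof. by move/boundaryN; rewrite opprB. Qed.

Lemma cycleD X n (x y : X n) : cycle x -> cycle y -> cycle (x + y).
Proof. by rewrite /cycle => cx cy; rewrite linearD /= cx cy addr0. Qed.
Lemma cycleN X n (x : X n) : cycle x -> cycle (- x).
Proof. by rewrite /cycle => cx; rewrite linearN /= cx oppr0. Qed.
Lemma cycleB X n (x y : X n) : cycle x -> cycle y -> cycle (x - y).
Proof. by move=> cx /cycleN; exact: cycleD. Qed.
Lemma cycleZ X n a (x : X n) : cycle x -> cycle (a *: x).
Proof. by rewrite /cycle => cx; rewrite linearZ /= cx scaler0. Qed.
Lemma cycle_sum X n (T : Type) (s : seq T) (P : pred T) (x : T -> X n) :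
  (forall t, cycle (x t)) -> cycle (\sum_(t <- s | P t) x t).
Proof.
by move=> cx; elim/big_ind: _ => //; [rewrite /cycle linear0|exact: cycleD].
Qed.

Definition acyc X (n : int) : Prop := forall x : X n, cycle x -> boundary x.

Lemma acycP X n : acyc X n <-> ~ homology_nonzero X n.
Proof.
split=> [aX [x cx nb]|h x cx]; first by apply: nb; exact: aX.
by apply: contrapT => nb; apply: h; exists x.
Qed.
Lemma acyclicE X : acyclic X <-> forall n, acyc X n.
Proof. by split=> h n; apply/acycP; exact: h. Qed.

Lemma cycle_tr X n m (x : X n) : cycle x -> cycle (tr m x).
Proof.
by have [->|e] := eqVneq m n; rewrite ?trE // tr0 // /cycle linear0.
Qed.
Lemma boundary_tr X n m (x : X n) : boundary x -> boundary (tr m x).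
Proof.
by have [->|e] := eqVneq m n; rewrite ?trE // tr0 //; exists 0; rewrite linear0.
Qed.
End ComplexTheory.

Section HomologyBijection.

(** Only additivity is asked for, because some comparisons ([gam], [swp]) run between a complex over
    [R] and one over [S]; [hbij] is the notion of quasi-isomorphism for such maps. *)
Definition hmor (R S : comNzRingType) (X : complex R) (Y : complex S)
    (f : forall n, X n -> Y n) : Prop :=
  (forall n, {morph f n : x y / x - y}) /\
  (forall i j x, diff Y i j (f i x) = f j (diff X i j x)).

Definition hbij (R S : comNzRingType) (X : complex R) (Y : complex S)
    (f : forall n, X n -> Y n) : Prop :=
  forall n, (forall x : X n, cycle x -> boundary (f n x) -> boundary x) /\
    (forall y : Y n, cycle y -> exists2 x : X n, cycle x & boundary (y - f n x)).

Context (R1 R2 R3 : comNzRingType).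
Context (X : complex R1) (Y : complex R2) (Z : complex R3).
Context (f : forall n, X n -> Y n) (g : forall n, Y n -> Z n).
Arguments f : clear implicits.
Arguments g : clear implicits.

Lemma hmor0 : hmor f -> forall n, f n 0 = 0.
Proof. by case=> fB _ n; rewrite -(subrr 0) fB subrr. Qed.
Lemma hmor_cycle n (x : X n) : hmor f -> cycle x -> cycle (f n x).
Proof. by move=> fm cx; rewrite /cycle fm.2 cx hmor0. Qed.
Lemma hmor_boundary n (x : X n) : hmor f -> boundary x -> boundary (f n x).
Proof. by move=> fm [y <-]; exists (f (n + 1) y); rewrite fm.2. Qed.
Lemma hmor_comp : hmor f -> hmor g -> hmor (fun n x => g n (f n x)).
Proof.
by move=> [fB fd] [gB gd]; split=> [n x y|i j x]; rewrite ?fB ?gB ?gd ?fd.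
Qed.

Lemma hbij_bij : hmor f -> (forall n, bijective (f n)) -> hbij f.
Proof.
move=> fm fb n; have inj k := bij_inj (fb k); split=> [x cx [y yx]|y cy].
  have [h _ hK] := fb (n + 1); exists (h y); apply: inj.
  by rewrite -fm.2 hK.
have [h _ hK] := fb n; exists (h y); last first.
  by rewrite hK subrr; exact: boundary0.
by apply: inj; rewrite -fm.2 hK cy hmor0.
Qed.

Lemma hbij_comp : hmor f -> hmor g -> hbij f -> hbij g ->
  hbij (fun n x => g n (f n x)).
Proof.
move=> fm gm fb gb n; split=> [x cx bx|z cz].
  by apply: (fb n).1 => //; apply: (gb n).1 => //; exact: hmor_cycle.
have [y cy zy] := (gb n).2 z cz; have [x cx yx] := (fb n).2 y cy.
exists x => //; apply: (boundary_trans zy); rewrite -gm.1.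
by case: yx => w <-; rewrite -gm.2; exact: boundaryI.
Qed.
End HomologyBijection.

Section HomologyBijectionCancel.
Context (R1 R2 R3 : comNzRingType).
Context (X : complex R1) (Y : complex R2) (Z : complex R3).
Context (f : forall n, X n -> Y n) (g : forall n, Y n -> Z n)
  (h : forall n, X n -> Z n).
Arguments f : clear implicits.
Arguments g : clear implicits.
Arguments h : clear implicits.
Hypothesis fgh : forall n x, cycle x -> boundary (h n x - g n (f n x)).

(** Two out of three in homology. The triangle commutes only up to boundaries on cycles ([fgh]),
    which is what a homotopy provides. *)
Lemma hbij_cancel_l : hmor f -> hmor g -> hbij g -> hbij h -> hbij f.
Proof.
move=> fm gm gb hb n; split=> [x cx bx|y cy].
  apply: (hb n).1 => //; have := fgh cx; move=> /boundaryD; move/(_ (g n (f n x))).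
  by rewrite subrK; apply; exact: hmor_boundary.
have [x cx] := (hb n).2 _ (hmor_cycle gm cy) => bx.
exists x => //; apply: (gb n).1; last first.
  by rewrite gm.1; apply: (boundary_trans bx); exact: fgh.
by apply: cycleB => //; exact: hmor_cycle.
Qed.

Lemma hbij_cancel_r : hmor f -> hmor g -> hbij f -> hbij h -> hbij g.
Proof.
move=> fm gm fb hb n; split=> [y cy bgy|z cz].
  have [x cx yx] := (fb n).2 y cy.
  have bx : boundary x.
    apply: (hb n).1 => //; have := fgh cx.
    move=> /boundaryD; move/(_ (g n (f n x))); rewrite subrK; apply.
    have -> : g n (f n x) = g n y - g n (y - f n x).
      by rewrite gm.1 opprB addrC subrK.
    by apply: boundaryB => //; exact: hmor_boundary.
  rewrite -(subrK (f n x) y); apply: boundaryD => //; exact: hmor_boundary.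
have [x cx zx] := (hb n).2 z cz; exists (f n x); first exact: hmor_cycle.
by apply: (boundary_trans zx); exact: fgh.
Qed.

Lemma hbij_homotopic_comp : hmor f -> hmor g -> hbij f -> hbij g -> hbij h.
Proof.
move=> fm gm fb gb; have gfb := hbij_comp fm gm fb gb.
have gfm := hmor_comp fm gm.
move=> n; split=> [x cx bx|z cz].
  apply: (gfb n).1 => //.
  have := boundaryB bx (fgh cx); by rewrite opprB addrC subrK.
have [x cx zx] := (gfb n).2 z cz; exists x => //.
by apply: (boundary_trans zx); apply: boundary_sym; exact: fgh.
Qed.
End HomologyBijectionCancel.

(** * Hom complexes and mapping cones *)

Section HmapTheory.
Context (R : comNzRingType).
Implicit Types X Y Z W : complex R.

Lemma hmap_eqP (X Y : int -> lmodType R) n (f g : hmap idfun X Y n) :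
  (forall i j x, j = i + n -> f i j x = g i j x) -> f = g.
Proof.
move=> fg; apply: hmap_eq => i j x; have [e|e] := eqVneq j (i + n).
  exact: fg.
by rewrite !hmap_shape.
Qed.

Definition mkhmap (X Y : int -> lmodType R) n (f : forall i j, X i -> Y j)
    (lin : forall i j, linear (f i j))
    (sh : forall i j x, j != i + n -> f i j x = 0) : hmap idfun X Y n :=
  @Hmap R R idfun X Y n f lin sh.

Lemma hmapDE (X Y : int -> lmodType R) n (f g : hmap idfun X Y n) i j x :
  (f + g) i j x = f i j x + g i j x.
Proof. by []. Qed.
Lemma hmapNE (X Y : int -> lmodType R) n (f : hmap idfun X Y n) i j x :
  (- f) i j x = - f i j x.
Proof. by []. Qed.
Lemma hmapBE (X Y : int -> lmodType R) n (f g : hmap idfun X Y n) i j x :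
  (f - g) i j x = f i j x - g i j x.
Proof. by []. Qed.
Lemma hmap0E (X Y : int -> lmodType R) n i j x :
  (0 : hmap idfun X Y n) i j x = 0.
Proof. by []. Qed.
Lemma hmapZE (X Y : int -> lmodType R) n a (f : hmap idfun X Y n) i j x :
  (a *: f) i j x = a *: f i j x.
Proof. by rewrite -[RHS]hmapZ. Qed.
Lemma hmap_sumE (X Y : int -> lmodType R) n (T : Type) (s : seq T) (P : pred T)
    (f : T -> hmap idfun X Y n) i j x :
  (\sum_(t <- s | P t) f t) i j x = \sum_(t <- s | P t) f t i j x.
Proof. by elim/big_rec2: _ => // t y1 y2 _ <-. Qed.
Definition hmapE :=
  (hmapDE, hmapNE, hmap0E, hmapZE, hmap_sumE).

Lemma hmap_sum (X Y : int -> lmodType R) n (f : hmap idfun X Y n) i j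
    (T : Type) (s : seq T) (P : pred T) (x : T -> X i) :
  f i j (\sum_(t <- s | P t) x t) = \sum_(t <- s | P t) f i j (x t).
Proof.
by elim/big_rec2: _ => [|t y1 y2 _ <-]; rewrite ?hmap_x0 ?hmapD.
Qed.
Lemma hmapB (X Y : int -> lmodType R) n (f : hmap idfun X Y n) i j x y :
  f i j (x - y) = f i j x - f i j y.
Proof. by rewrite hmapD hmapN. Qed.
Lemma hmapZr (X Y : int -> lmodType R) n (f : hmap idfun X Y n) i j a x :
  f i j (a *: x) = a *: f i j x.
Proof. exact: hmapZ. Qed.
Lemma hmapP (X Y : int -> lmodType R) n (f : hmap idfun X Y n) i j :
  linear (f i j).
Proof. by move=> a x y; rewrite hmapD hmapZr. Qed.

Lemma hdE X Y n m i j j1 i1 (f : Hom X Y n) x :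
  m = n - 1 -> j1 = j + 1 -> i1 = i - 1 ->
  diff (Hom X Y) n m f i j x =
    diff Y j1 j (f i j1 x) - sg n *: f i1 j (diff X i i1 x).
Proof. by move=> -> -> -> /=; rewrite eqxx. Qed.

Lemma hd_cycle X Y n (f : Hom X Y n) : cycle f <->
  forall i j k l x, j = i + n -> k = j - 1 -> l = i - 1 ->
    diff Y j k (f i j x) = sg n *: f l k (diff X i l x).
Proof.
split=> [cf i j k l x ji kj li|h].
  have : diff (Hom X Y) n (n - 1) f i k x = 0 by rewrite cf.
  rewrite (@hdE _ _ _ _ _ _ j l) //; last by rewrite kj subrK.
  by move/eqP; rewrite subr_eq0 => /eqP.
apply: hmap_eqP => i j x ji; rewrite (@hdE _ _ _ _ _ _ (j + 1) (i - 1)) //.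
by rewrite (h _ _ _ (i - 1)) ?subrr //; lia.
Qed.

Lemma boundary_at X m k (x : X m) : k = m + 1 -> boundary x ->
  exists y, diff X k m y = x.
Proof. by move=> -> [y <-]; exists y. Qed.
Lemma tr_tr (X : int -> lmodType R) i j k (x : X i) : i = j ->
  tr k (tr j x) = tr k x.
Proof. by move=> e; subst j; rewrite trE. Qed.
Lemma diff_tr X i j k (x : X i) : i = j ->
  diff X j k (tr j x) = diff X i k x.
Proof. by move=> e; subst j; rewrite trE. Qed.
Lemma tr_diff X i j k (x : X i) : j = k ->
  tr k (diff X i j x) = diff X i k x.
Proof. by move=> e; subst j; rewrite trE. Qed.
Lemma hmap_tr (X Y : int -> lmodType R) n (f : hmap idfun X Y n) i j k (x : X i) :
  i = j -> f j k (tr j x) = f i k x.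
Proof. by move=> e; subst j; rewrite trE. Qed.
Lemma tr_hmap (X Y : int -> lmodType R) n (f : hmap idfun X Y n) i j k (x : X i) :
  j = k -> tr k (f i j x) = f i k x.
Proof. by move=> e; subst j; rewrite trE. Qed.

Lemma chain_cycle X Y (f : chain_map X Y) : cycle (f : Hom X Y 0).
Proof.
apply/hd_cycle => i j k l x; rewrite addr0 => -> -> ->.
by rewrite chain_mapP sg0 scale1r.
Qed.

Fact mkchain_subproof X Y (f : Hom X Y 0) : cycle f ->
  forall i j x, diff Y i j (f i i x) = f j j (diff X i j x).
Proof.
move=> /hd_cycle cf i j x; have [->|e] := eqVneq j (i - 1).
  by rewrite (cf _ _ _ (i - 1)) ?addr0 // sg0 scale1r.
by rewrite !diff_shape // hmap_x0.
Qed.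
Definition mkchain X Y (f : Hom X Y 0) (cf : cycle f) : chain_map X Y :=
  @ChainMap _ _ _ f (mkchain_subproof cf).

Lemma chain_hmor X Y (f : chain_map X Y) : hmor (fun n => f n n).
Proof.
by split=> [n x y|i j x]; [rewrite hmapB | rewrite chain_mapP].
Qed.

Program Definition hcomp X Y Z n m k (g : Hom Y Z m) (f : Hom X Y n) :
    Hom X Z k :=
  @Hmap _ _ _ _ _ _ (fun i j x =>
    if k == n + m then g (i + n) j (f i (i + n) x) else 0) _ _.
Next Obligation.
by case: eqP => _; rewrite ?hmapP // scaler0 addr0.
Qed.
Next Obligation.
by have [E|//] := eqVneq k (n + m); rewrite hmap_shape // -addrA -E.
Qed.

Lemma hcompE X Y Z n m (k : int) (g : Hom Y Z m) (f : Hom X Y n) (i j l : int) x :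
  k = n + m -> l = i + n -> hcomp k g f i j x = g l j (f i l x).
Proof. by move=> -> -> /=; rewrite eqxx. Qed.

Lemma hcomp0 X Y Z n m k (g : Hom Y Z m) (f : Hom X Y n) :
  k != n + m -> hcomp k g f = 0.
Proof. by move=> e; apply: hmap_eq => i j x /=; rewrite (negPf e). Qed.

Lemma hcompDl X Y Z n m k (g g' : Hom Y Z m) (f : Hom X Y n) :
  hcomp k (g + g') f = hcomp k g f + hcomp k g' f.
Proof. by apply: hmap_eq => i j x /=; case: eqP; rewrite ?addr0. Qed.
Lemma hcompNl X Y Z n m k (g : Hom Y Z m) (f : Hom X Y n) :
  hcomp k (- g) f = - hcomp k g f.
Proof. by apply: hmap_eq => i j x /=; case: eqP; rewrite ?oppr0. Qed.
Lemma hcompDr X Y Z n m k (g : Hom Y Z m) (f f' : Hom X Y n) :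
  hcomp k g (f + f') = hcomp k g f + hcomp k g f'.
Proof. by apply: hmap_eq => i j x /=; case: eqP; rewrite ?addr0 // hmapD. Qed.
Lemma hcompNr X Y Z n m k (g : Hom Y Z m) (f : Hom X Y n) :
  hcomp k g (- f) = - hcomp k g f.
Proof. by apply: hmap_eq => i j x /=; case: eqP; rewrite ?oppr0 // hmapN. Qed.
Lemma hcompZl X Y Z n m k a (g : Hom Y Z m) (f : Hom X Y n) :
  hcomp k (a *: g) f = a *: hcomp k g f.
Proof.
by apply: hmap_eq => i j x; rewrite hmapZE /=; case: eqP; rewrite ?hmapZr ?scaler0.
Qed.
Lemma hcompZr X Y Z n m k a (g : Hom Y Z m) (f : Hom X Y n) :
  hcomp k g (a *: f) = a *: hcomp k g f.
Proof.
by apply: hmap_eq => i j x; rewrite hmapZE /=; case: eqP; rewrite ?hmapZr ?scaler0.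
Qed.
Lemma hcomp0l X Y Z n m k (f : Hom X Y n) : hcomp k (0 : Hom Y Z m) f = 0.
Proof. by apply: hmap_eq => i j x /=; case: eqP. Qed.
Lemma hcomp0r X Y Z n m k (g : Hom Y Z m) : hcomp k g (0 : Hom X Y n) = 0.
Proof. by apply: hmap_eq => i j x /=; case: eqP; rewrite ?hmap_x0. Qed.

Lemma hcomp_diff X Y Z n m (k k1 m1 n1 : int) (g : Hom Y Z m) (f : Hom X Y n) :
  k = n + m -> k1 = k - 1 -> m1 = m - 1 -> n1 = n - 1 ->
  diff (Hom X Z) k k1 (hcomp k g f) =
    hcomp k1 (diff (Hom Y Z) m m1 g) f
      + sg m *: hcomp k1 g (diff (Hom X Y) n n1 f).
Proof.
move=> kE k1E m1E n1E; apply: hmap_eqP => i j x jE.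
rewrite hmapE (@hdE _ _ _ _ _ _ (j + 1) (i - 1)) //.
rewrite (@hcompE _ _ _ _ _ _ _ _ i _ (i + n)) //.
rewrite (@hcompE _ _ _ _ _ _ _ _ (i - 1) _ (i - 1 + n)) //.
rewrite (@hcompE _ _ _ _ m1 _ _ _ _ _ (i + n)); [|lia|done].
rewrite hmapZE (@hcompE _ _ _ n1 _ _ _ _ _ _ (i - 1 + n)); [|lia|lia].
rewrite (@hdE _ _ _ _ _ _ (j + 1) (i - 1 + n)) //; last by lia.
rewrite (@hdE _ _ _ _ _ _ (i + n) (i - 1)) //; last by lia.
rewrite hmapB hmapZr scalerBr scalerA -sgD [m + n]addrC -kE.
by rewrite addrA subrK.
Qed.

Definition hid_fun X i j (x : X i) : X j := tr j x.
Program Definition hid X : Hom X X 0 :=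
  @Hmap _ _ _ _ _ _ (@hid_fun X) _ _.
Next Obligation. by rewrite /hid_fun linearP. Qed.
Next Obligation. by rewrite /hid_fun tr0 // -[i]addr0. Qed.

Lemma hidE X i x : hid X i i x = x.
Proof. exact: trE. Qed.
Lemma hid_cycle X : cycle (hid X).
Proof.
apply/hd_cycle => i j k l x; rewrite addr0 => -> -> ->.
by rewrite !hidE sg0 scale1r.
Qed.
Lemma hcomp1 X Y n (f : Hom X Y n) : hcomp n f (hid X) = f.
Proof.
by apply: hmap_eqP => i j x _; rewrite (hcompE _ _ _ _ (l := i)) ?hidE ?add0r ?addr0.
Qed.
Lemma hcomp1l X Y n (f : Hom X Y n) : hcomp n (hid Y) f = f.
Proof.
apply: hmap_eqP => i j x ->.
by rewrite (hcompE _ _ _ _ (l := i + n)) ?hidE ?add0r ?addr0.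
Qed.

Lemma hcomp_cycle X Y Z n m k (g : Hom Y Z m) (f : Hom X Y n) :
  cycle g -> cycle f -> cycle (hcomp k g f).
Proof.
move=> cg cf; have [e|e] := eqVneq k (n + m); last first.
  by rewrite /cycle hcomp0 // linear0.
by rewrite /cycle (hcomp_diff _ _ e (m1 := m - 1) (n1 := n - 1)) // cg cf
  hcomp0l hcomp0r scaler0 addr0.
Qed.

Program Definition hpost X Y Z (g : Hom Y Z 0) : Hom (Hom X Y) (Hom X Z) 0 :=
  @Hmap _ _ _ _ _ _ (fun i j u => hcomp j g u) _ _.
Next Obligation. by rewrite hcompDr hcompZr. Qed.
Next Obligation. by rewrite hcomp0. Qed.
Program Definition hpre X Y Z (f : Hom X Y 0) : Hom (Hom Y Z) (Hom X Z) 0 :=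
  @Hmap _ _ _ _ _ _ (fun i j u => hcomp j u f) _ _.
Next Obligation. by rewrite hcompDl hcompZl. Qed.
Next Obligation. by rewrite hcomp0 // add0r -[i]addr0. Qed.

Lemma hpost_cycle X Y Z (g : Hom Y Z 0) : cycle g -> cycle (hpost X g).
Proof.
move=> cg; apply/hd_cycle => i j k l u; rewrite addr0 => -> -> -> /=.
rewrite -/(diff (Hom X Z) i (i - 1) _) -/(diff (Hom X Y) i (i - 1) _).
rewrite (@hcomp_diff _ _ _ _ _ _ _ (-1) (i - 1)) ?addr0 ?add0r //.
have -> : diff (Hom Y Z) 0 (-1) g = 0 by exact: cg.
by rewrite hcomp0l add0r.
Qed.
Lemma hpre_cycle X Y Z (f : Hom X Y 0) : cycle f -> cycle (hpre Z f).
Proof.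
move=> cf; apply/hd_cycle => i j k l u; rewrite addr0 => -> -> -> /=.
rewrite -/(diff (Hom X Z) i (i - 1) _) -/(diff (Hom Y Z) i (i - 1) _).
rewrite (@hcomp_diff _ _ _ _ _ _ _ (i - 1) (-1)) ?addr0 ?add0r //.
have -> : diff (Hom X Y) 0 (-1) f = 0 by exact: cf.
by rewrite hcomp0r scaler0 addr0 sg0 scale1r.
Qed.

Definition post X Y Z (g : chain_map Y Z) : chain_map (Hom X Y) (Hom X Z) :=
  mkchain (hpost_cycle X (chain_cycle g)).
Definition pre X Y Z (f : chain_map X Y) : chain_map (Hom Y Z) (Hom X Z) :=
  mkchain (hpre_cycle Z (chain_cycle f)).

Lemma postE X Y Z (g : chain_map Y Z) n u i j l x : l = i + n ->
  post X g n n u i j x = g l j (u i l x).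
Proof. exact: (hcompE g u j x (esym (addr0 n))). Qed.
Lemma preE X Y Z (f : chain_map X Y) n u i j x :
  pre Z f n n u i j x = u i j (f i i x).
Proof. exact: (hcompE u f j x (esym (add0r n)) (esym (addr0 i))). Qed.

Lemma acyc_bij (R1 R2 : comNzRingType) (X : complex R1)
    (Y : complex R2) (f : forall n, X n -> Y n) : hmor f ->
  (forall n, bijective (f n)) -> forall n, acyc X n <-> acyc Y n.
Proof.
move=> fm fb n; split=> aX x cx.
  have [h _ hK] := fb n; rewrite -(hK x); apply: hmor_boundary => //.
  apply: aX; have inj := bij_inj (fb (n - 1)).
  by apply: inj; rewrite -fm.2 hK cx hmor0.
have := aX _ (hmor_cycle fm cx).
by apply: (hbij_bij fm fb n).1.
Qed.

Lemma hbij_acyc (R1 R2 : comNzRingType) (X : complex R1) (Y : complex R2)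
    (f : forall n, X n -> Y n) : hmor f -> hbij f ->
  forall n, acyc X n <-> acyc Y n.
Proof.
move=> fm fb n; split=> aX x cx.
  have [y cy] := (fb n).2 x cx => /boundaryD; move/(_ (f n y)).
  by rewrite subrK; apply; apply: hmor_boundary => //; exact: aX.
by apply: (fb n).1 => //; apply: aX; exact: hmor_cycle.
Qed.
End HmapTheory.
Arguments hid {R} X.

Section Cone.
Context (R : comNzRingType) (X Y : complex R) (f : chain_map X Y).

Definition cone_term (n : int) : lmodType R := (Y n * X (n - 1))%type.
Definition cone_fun i j (v : cone_term i) : cone_term j :=
  (diff Y i j v.1 + f (i - 1) j v.2, - diff X (i - 1) (j - 1) v.2).
Fact cone_linear i j : linear (@cone_fun i j).
Proof.
move=> a [y x] [y' x']; rewrite /cone_fun /=; congr pair => /=.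
  by rewrite !linearP hmapP scalerDr addrACA.
by rewrite linearP opprD scalerN.
Qed.
Program Definition cone : complex R :=
  @Complex R cone_term (fun i j => mklin (@cone_linear i j)) _ _.
Next Obligation.
rewrite /= /cone_fun !diff_shape ?hmap_shape ?addr0 ?oppr0 //.
by apply/eqP => E; case/eqP: H; lia.
Qed.
Next Obligation.
rewrite /= /cone_fun /=; congr pair; last by rewrite linearN /= diff_diff !oppr0.
rewrite linearD /= diff_diff add0r hmapN.
have [e|e] := eqVneq j (i - 1); last first.
  rewrite hmap_shape ?addr0 // linear0 diff_shape ?hmap_x0 ?subr0 //.
  by apply/eqP => E; case/eqP: e; lia.
subst j; have [e|e] := eqVneq k (i - 1 - 1).
  by subst k; rewrite chain_mapP subrr.
by rewrite diff_shape // hmap_shape ?subrr // addr0.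
Qed.

Lemma coneE i j (y : Y i) (x : X (i - 1)) : diff cone i j (y, x) =
  (diff Y i j y + f (i - 1) j x, - diff X (i - 1) (j - 1) x).
Proof. by []. Qed.

Lemma cone_qi : quasi_iso f <-> acyclic cone.
Proof.
rewrite acyclicE; split=> [qf n [y x]|aC n].
  rewrite /cycle coneE => -[c1 /eqP]; rewrite oppr_eq0 => /eqP cx.
  have fxE : f (n - 1) (n - 1) x = - diff Y n (n - 1) y.
    by apply/eqP; rewrite -addr_eq0 [eqbLHS]addrC c1.
  have bfx : boundary (f (n - 1) (n - 1) x).
    by rewrite fxE; apply: boundaryN; exact: boundaryI.
  have [x' x'E] := (qf (n - 1)).1 x cx bfx.
  have dx' k : diff X n k (tr n x') = diff X (n - 1 + 1) k x'.
    by rewrite diff_tr // subrK.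
  have cz : cycle (y + f n n (tr n x')).
    by rewrite /cycle linearD /= chain_mapP dx' x'E fxE subrr.
  have [u cu [w wE]] := (qf n).2 _ cz.
  exists (w, tr (n + 1 - 1) (u - tr n x')); rewrite coneE; congr pair.
    rewrite [f (n + 1 - 1) _ _]hmap_tr ?addrK // hmapB wE.
    by rewrite subrKA addrK.
  by rewrite diff_tr ?addrK // linearB /= cu dx' x'E sub0r opprK.
split=> [x cx [w wE]|y cy].
  have : cycle ((- w, tr (n + 1 - 1) x) : cone (n + 1)).
    rewrite /cycle coneE; move: (n + 1 - 1) (addrK 1 n) => k e; subst k.
    by rewrite trE (cycleE _ cx) oppr0 linearN /= wE addNr.
  case/aC => -[w' v]; rewrite coneE => -[_ e].
  rewrite -[x](trE); have -> : tr n x = tr n (tr (n + 1 - 1) x).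
    by rewrite tr_tr // addrK.
  rewrite -e; apply: boundary_tr; apply: boundaryN; exact: boundaryI.
have : cycle ((y, 0) : cone n).
  by rewrite /cycle coneE cy linear0 hmap_x0 oppr0 addr0.
case/aC => -[w v]; rewrite coneE => -[e1 e2]; exists (tr n v).
  rewrite /cycle diff_tr ?addrK //; move/eqP: e2; rewrite oppr_eq0 => /eqP; exact.
rewrite -e1 hmap_tr ?addrK //; exact: boundaryI.
Qed.
End Cone.

Lemma hmorI (R S : comNzRingType) (X : complex R) (Y : complex S)
    (f : forall n, X n -> Y n) :
  (forall n, {morph f n : x y / x - y}) ->
  (forall i j x, j = i - 1 -> diff Y i j (f i x) = f j (diff X i j x)) ->
  hmor f.
Proof.
move=> fB fd; split=> // i j x; have [e|e] := eqVneq j (i - 1); first exact: fd.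
have f0 n : f n 0 = 0 by rewrite -[in LHS](subrr 0) fB subrr.
by rewrite !diff_shape // f0.
Qed.

Section HomCone.
Context (R : comNzRingType) (A X Y : complex R) (f : chain_map X Y).

Program Definition hpair n (v : cone (post A f) n) : Hom A (cone f) n :=
  @Hmap _ _ _ _ _ _ (fun i j x => (v.1 i j x, v.2 i (j - 1) x)) _ _.
Next Obligation. by rewrite !hmapP. Qed.
Next Obligation.
rewrite !hmap_shape //; apply/eqP => E; case/eqP: H; lia.
Qed.

Fact hpair_hmor : hmor hpair.
Proof.
apply: hmorI => [n x y|n m [u w] x]; first by apply: hmap_eq.
subst m; apply: hmap_eqP => i j x jE.
rewrite (@hdE _ _ _ _ _ _ _ (j + 1) (i - 1)) // !coneE.
have E1 : diff Y (j + 1) j (u i (j + 1) x) + f (j + 1 - 1) j (w i (j + 1 - 1) x)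
    - sg n *: u (i - 1) j (diff A i (i - 1) x) =
  (diff (Hom A Y) n (n - 1) u + post A f (n - 1) (n - 1) w) i j x.
  rewrite hmapDE (@hdE _ _ _ _ _ _ _ (j + 1) (i - 1)) //.
  by rewrite (@postE _ _ _ _ _ _ _ _ _ (j + 1 - 1)) 1?addrAC //; lia.
have E2 : - diff X (j + 1 - 1) (j - 1) (w i (j + 1 - 1) x)
    - sg n *: w (i - 1) (j - 1) (diff A i (i - 1) x) =
  (- diff (Hom A X) (n - 1) (n - 1 - 1) w) i (j - 1) x.
  rewrite hmapNE (@hdE _ _ _ _ _ _ _ (j + 1 - 1) (i - 1)) //; last by lia.
  by rewrite sgB1 opprB scaleNr [LHS]addrC.
exact: congr2 E1 E2.
Qed.

Fact hpair_bij n : bijective (@hpair n).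
Proof.
unshelve eexists.
  move=> v; split.
    unshelve refine (@Hmap _ _ _ _ _ _ (fun i j x => (v i j x).1) _ _).
      by move=> i j a x y; rewrite hmapD hmapZr.
    by move=> i j x e; rewrite hmap_shape.
  unshelve refine (@Hmap _ _ _ _ _ _ (fun i j x => tr j (v i (j + 1) x).2) _ _).
    by move=> i j a x y; rewrite hmapD hmapZr linearP.
  move=> i j x e; rewrite hmap_shape ?linear0 //.
  by apply/eqP => E; case/eqP: e; lia.
  move=> [u w]; congr pair; apply: hmap_eq => i j x //=.
  by rewrite tr_hmap ?addrK.
move=> v; apply: hmap_eq => i j x /=.
apply/esym; rewrite [LHS]surjective_pairing; congr pair.
by move: (j - 1 + 1) (subrK 1 j) => k e; subst k; rewrite trE.
Qed.

Lemma acyc_hom_cone n : acyc (cone (post A f)) n <-> acyc (Hom A (cone f)) n.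
Proof. exact: acyc_bij hpair_hmor hpair_bij n. Qed.
Lemma post_qi : quasi_iso (post A f) <-> acyclic (Hom A (cone f)).
Proof.
rewrite cone_qi !acyclicE.
by split=> h n; apply/acyc_hom_cone; exact: h.
Qed.
End HomCone.

Section ConeHom.
Context (R : comNzRingType) (X Y I : complex R) (f : chain_map X Y).

Program Definition hcopair n (u : Hom Y I n) (w : Hom X I (n + 1)) :
    Hom (cone f) I n :=
  @Hmap _ _ _ _ _ _ (fun i j v => u i j v.1 + w (i - 1) j v.2) _ _.
Next Obligation. by rewrite !hmapP scalerDr addrACA. Qed.
Next Obligation.
rewrite !hmap_shape ?addr0 //; apply/eqP => E; case/eqP: H; lia.
Qed.

Program Definition hinl n (V : Hom (cone f) I n) : Hom Y I n :=
  @Hmap _ _ _ _ _ _ (fun i j y => V i j (y, 0)) _ _.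
Next Obligation.
by rewrite -hmapZr -hmapD; congr (V _ _ _); congr pair; rewrite /= scaler0 addr0.
Qed.
Next Obligation. by rewrite hmap_shape. Qed.

Program Definition hinr n (V : Hom (cone f) I n) : Hom X I (n + 1) :=
  @Hmap _ _ _ _ _ _ (fun i j x => V (i + 1) j (0, tr (i + 1 - 1) x)) _ _.
Next Obligation.
by rewrite -hmapZr -hmapD linearP; congr (V _ _ _); congr pair; rewrite /= scaler0 addr0.
Qed.
Next Obligation.
by rewrite hmap_shape //; apply/eqP => E; case/eqP: H; lia.
Qed.

Lemma hcopair_diff n (u : Hom Y I n) (w : Hom X I (n + 1)) i j y x :
  j = i + (n - 1) ->
  diff (Hom (cone f) I) n (n - 1) (hcopair u w) i j (y, x) =
  diff (Hom Y I) n (n - 1) u i j y +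
    (diff (Hom X I) (n + 1) n w (i - 1) j x
      - sg n *: u (i - 1) j (f (i - 1) (i - 1) x)).
Proof.
move=> jE; do 2!rewrite (@hdE _ _ _ _ _ _ _ (j + 1) (i - 1)) //.
rewrite (@hdE _ _ _ _ _ _ _ (j + 1) (i - 1 - 1)) //; last by lia.
rewrite coneE.
have hcE k l (v : cone f k) : hcopair u w k l v = u k l v.1 + w (k - 1) l v.2 by [].
rewrite !hcE !linearD /= sgS scaleNr opprK hmapN hmapD.
rewrite scalerDr scalerN opprD opprK.
by rewrite [LHS](AC (2 * (2 * 1)) ((1 * 3) * (2 * 5 * 4))).
Qed.

Lemma hcopairK n (V : Hom (cone f) I n) : hcopair (hinl V) (hinr V) = V.
Proof.
apply: hmap_eq => i j [y x] /=.
move: (i - 1 + 1) (subrK 1 i) => k e; subst k.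
by rewrite trE -hmapD; congr (V _ _ _); congr pair; rewrite /= ?addr0 ?add0r.
Qed.

Lemma pre_qi : acyclic (Hom (cone f) I) -> quasi_iso (pre I f).
Proof.
rewrite cone_qi !acyclicE => aH n [w u] c.
have e1 : diff (Hom X I) n (n - 1) w + pre I f (n - 1) (n - 1) u = 0.
  exact: (congr1 fst c).
have cu : diff (Hom Y I) (n - 1) (n - 1 - 1) u = 0.
  by apply/eqP; rewrite -oppr_eq0; apply/eqP; exact: (congr1 snd c).
have e1' i j x : j = i + (n - 1) ->
    diff (Hom X I) n (n - 1) w i j x = - u i j (f i i x).
  move=> jE; have /(congr1 (fun h : hmap idfun X I (n - 1) => h i j x)) := e1.
  by rewrite hmapDE preE => /eqP; rewrite addr_eq0 => /eqP.
(* On a cone the second component sits one degree higher and carries a sign: [u] and [sg n *: w]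
   together form a cycle of [Hom (cone f) I], and a primitive of it yields one of [(w, u)]. *)
pose w' : Hom X I (n - 1 + 1) := tr (n - 1 + 1) (sg n *: w).
have dw' : diff (Hom X I) (n - 1 + 1) (n - 1) w' =
    sg n *: diff (Hom X I) n (n - 1) w.
  by rewrite diff_tr ?subrK // linearZ.
have cU : cycle (hcopair u w').
  apply: hmap_eqP => i j [y x] jE.
  rewrite hcopair_diff // cu dw' hmapZE e1'; last by lia.
  by rewrite !hmap0E add0r sgB1 scaleNr opprK scalerN addNr.
have [V VE] := boundary_at (esym (subrK 1 n)) (aH _ _ cU).
rewrite -(hcopairK V) in VE; move: (hinl V) (hinr V) VE => u1 w1 VE.
have VE' i j y x : j = i + (n - 1) -> diff (Hom Y I) n (n - 1) u1 i j y +
    (diff (Hom X I) (n + 1) n w1 (i - 1) j x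
      - sg n *: u1 (i - 1) j (f (i - 1) (i - 1) x)) =
    u i j y + w' (i - 1) j x.
  by move=> jE; rewrite -hcopair_diff // VE.
have u1E : diff (Hom Y I) n (n - 1) u1 = u.
  apply: hmap_eqP => i j y jE; have := VE' i j y 0 jE.
  by rewrite !hmap_x0 scaler0 subr0 !addr0.
have w1E : diff (Hom X I) (n + 1) n w1 = sg n *: (w + pre I f n n u1).
  apply: hmap_eqP => i j x jE.
  have := VE' (i + 1) j 0 (tr (i + 1 - 1) x).
  rewrite /w'; move: (n - 1 + 1) (subrK 1 n) => k e; subst k; rewrite trE.
  move: (i + 1 - 1) (addrK 1 i) => k e; subst k; rewrite trE.
  rewrite !hmap_x0 !add0r !hmapZE hmapDE preE scalerDr => <-; last by lia.
  by rewrite subrK.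
exists (sg n *: w1, tr (n + 1 - 1) (- u1)); rewrite coneE; congr pair.
  move: (n + 1 - 1) (addrK 1 n) => k e; subst k; rewrite trE.
  rewrite linearZ /= w1E scalerA sgK scale1r.
  by rewrite hcompNl addrK.
by rewrite diff_tr ?addrK // linearN opprK.
Qed.
End ConeHom.

(** * Submodules, quotients and relative lifting *)

Record submodule (R : comNzRingType) (V : lmodType R) := Submodule {
  in_sub :> V -> Prop;
  in_sub0 : in_sub 0;
  in_subD : forall x y, in_sub x -> in_sub y -> in_sub (x + y);
  in_subZ : forall a x, in_sub x -> in_sub (a *: x) }.

Section SubmoduleTheory.
Context (R : comNzRingType) (V : lmodType R) (U : submodule V).

Lemma in_subN x : U x -> U (- x).
Proof. by rewrite -scaleN1r; exact: in_subZ. Qed.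
Lemma in_subB x y : U x -> U y -> U (x - y).
Proof. by move=> Ux /in_subN; exact: in_subD. Qed.
Lemma in_sub_sum (T : Type) (s : seq T) (P : pred T) (x : T -> V) :
  (forall t, U (x t)) -> U (\sum_(t <- s | P t) x t).
Proof. by move=> Ux; elim/big_ind: _ => //; [exact: in_sub0|exact: in_subD]. Qed.
Lemma in_subDr x y : U y -> U (x + y) -> U x.
Proof. by move=> Uy Uxy; rewrite -(addrK y x); exact: in_subB. Qed.

Record sub_type := SubElt { sub_val : V; sub_valP : U sub_val }.

Lemma sub_val_inj x y : sub_val x = sub_val y -> x = y.
Proof.
case: x y => [x xP] [y yP] /= e; case: y / e yP => yP.
by congr SubElt; exact: Prop_irrelevance.
Qed.

HB.instance Definition _ := gen_eqMixin sub_type.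
HB.instance Definition _ := gen_choiceMixin sub_type.
Let zero := SubElt (in_sub0 U).
Let opp x := SubElt (in_subN (sub_valP x)).
Let add x y := SubElt (in_subD (sub_valP x) (sub_valP y)).
Let scale a x := SubElt (in_subZ a (sub_valP x)).
Fact sub_addA : associative add.
Proof. by move=> x y z; apply: sub_val_inj; rewrite /= addrA. Qed.
Fact sub_addC : commutative add.
Proof. by move=> x y; apply: sub_val_inj; rewrite /= addrC. Qed.
Fact sub_add0 : left_id zero add.
Proof. by move=> x; apply: sub_val_inj; rewrite /= add0r. Qed.
Fact sub_addN : left_inverse zero opp add.
Proof. by move=> x; apply: sub_val_inj; rewrite /= addNr. Qed.
HB.instance Definition _ :=
  GRing.isZmodule.Build sub_type sub_addA sub_addC sub_add0 sub_addN.
Fact sub_scaleA a b x : scale a (scale b x) = scale (a * b) x.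
Proof. by apply: sub_val_inj; rewrite /= scalerA. Qed.
Fact sub_scale1 : left_id 1 scale.
Proof. by move=> x; apply: sub_val_inj; rewrite /= scale1r. Qed.
Fact sub_scaleDr : right_distributive scale +%R.
Proof. by move=> a x y; apply: sub_val_inj; rewrite /= scalerDr. Qed.
Fact sub_scaleDl x : {morph scale^~ x : a b / a + b}.
Proof. by move=> a b; apply: sub_val_inj; rewrite /= scalerDl. Qed.
HB.instance Definition _ := GRing.Zmodule_isLmodule.Build R sub_type
  sub_scaleA sub_scale1 sub_scaleDr sub_scaleDl.

Fact sub_val_linear : linear sub_val.
Proof. by []. Qed.
HB.instance Definition _ :=
  GRing.isLinear.Build R sub_type V *:%R sub_val sub_val_linear.

Record quo_type := Quo {
  quo_set : set V; _ : exists x, quo_set = fun y => U (y - x) }.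

HB.instance Definition _ := gen_eqMixin quo_type.
HB.instance Definition _ := gen_choiceMixin quo_type.

Definition cls (x : V) : quo_type := Quo (ex_intro _ x erefl).

Lemma clsP x y : cls x = cls y <-> U (x - y).
Proof.
split=> [/(congr1 (fun q => quo_set q x)) /= <-|Uxy].
  by rewrite subrr; exact: in_sub0.
have e : (fun z => U (z - x)) = (fun z => U (z - y)).
  apply/funext => z; apply/propext; split=> Uz.
    by rewrite -(subrKA x); exact: in_subD.
  by rewrite -(subrKA y); apply: in_subD => //; rewrite -opprB; exact: in_subN.
rewrite /cls; move: (ex_intro _ x _) (ex_intro _ y _) => /=.
by rewrite e => p q; congr Quo; exact: Prop_irrelevance.
Qed.

Lemma cls_surj q : exists x, q = cls x.
Proof.
case: q => A p; have [x e] := p; exists x; rewrite /cls.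
by case: _ / (esym e) p => p; congr Quo; exact: Prop_irrelevance.
Qed.

Definition repr_cls q : V := projT1 (cid (cls_surj q)).
Lemma repr_clsK q : cls (repr_cls q) = q.
Proof. by rewrite /repr_cls; case: cid. Qed.
Lemma repr_clsP x : U (repr_cls (cls x) - x).
Proof. by apply/clsP; rewrite repr_clsK. Qed.

Let qzero := cls 0.
Let qopp p := cls (- repr_cls p).
Let qadd p q := cls (repr_cls p + repr_cls q).
Let qscale a p := cls (a *: repr_cls p).
Let qaddE x y : qadd (cls x) (cls y) = cls (x + y).
Proof.
apply/clsP; rewrite opprD addrACA.
by apply: in_subD; exact: repr_clsP.
Qed.
Let qoppE x : qopp (cls x) = cls (- x).
Proof. by apply/clsP; rewrite -opprD; apply: in_subN; exact: repr_clsP. Qed.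
Let qscaleE a x : qscale a (cls x) = cls (a *: x).
Proof. by apply/clsP; rewrite -scalerBr; apply: in_subZ; exact: repr_clsP. Qed.

Fact quo_addA : associative qadd.
Proof.
move=> p q r; have [[[x ->] [y ->]] [z ->]] := (cls_surj p, cls_surj q, cls_surj r).
by rewrite !qaddE addrA.
Qed.
Fact quo_addC : commutative qadd.
Proof.
move=> p q; have [[x ->] [y ->]] := (cls_surj p, cls_surj q).
by rewrite !qaddE addrC.
Qed.
Fact quo_add0 : left_id qzero qadd.
Proof. by move=> p; have [x ->] := cls_surj p; rewrite qaddE add0r. Qed.
Fact quo_addN : left_inverse qzero qopp qadd.
Proof.
by move=> p; have [x ->] := cls_surj p; rewrite qoppE qaddE addNr.
Qed.
HB.instance Definition _ :=
  GRing.isZmodule.Build quo_type quo_addA quo_addC quo_add0 quo_addN.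
Fact quo_scaleA a b p : qscale a (qscale b p) = qscale (a * b) p.
Proof. by have [x ->] := cls_surj p; rewrite !qscaleE scalerA. Qed.
Fact quo_scale1 : left_id 1 qscale.
Proof. by move=> p; have [x ->] := cls_surj p; rewrite qscaleE scale1r. Qed.
Fact quo_scaleDr : right_distributive qscale +%R.
Proof.
move=> a p q; have [[x ->] [y ->]] := (cls_surj p, cls_surj q).
by rewrite [_ + _ in LHS]qaddE !qscaleE [RHS]qaddE scalerDr.
Qed.
Fact quo_scaleDl p : {morph qscale^~ p : a b / a + b}.
Proof.
move=> a b; have [x ->] := cls_surj p.
by rewrite !qscaleE [RHS]qaddE scalerDl.
Qed.
HB.instance Definition _ := GRing.Zmodule_isLmodule.Build R quo_type
  quo_scaleA quo_scale1 quo_scaleDr quo_scaleDl.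

Fact cls_linear : linear cls.
Proof. by move=> a x y; rewrite -qaddE -qscaleE. Qed.
HB.instance Definition _ :=
  GRing.isLinear.Build R V quo_type *:%R cls cls_linear.
End SubmoduleTheory.
Arguments in_subN {R V} U [x].
Arguments in_subB {R V} U [x y].
Arguments in_subDr {R V} U [x] y.
Arguments cls {R V} U x.

Section Projective.
Context (R : comNzRingType).

(** A total relation is a module that projects onto [P], so the projection splits. Lifting along a
    relation imposes several conditions on the lift at once, such as lying in one submodule and
    having a prescribed differential modulo another. *)
Lemma projective_rel (P X : lmodType R) (Rel : submodule (X * P)%type) :
  projective P -> (forall p, exists x, Rel (x, p)) ->
  exists h : {linear P -> X}, forall p, Rel (h p, p).
Proof.
move=> pP tot; pose f : {linear sub_type Rel -> P} := snd \o @sub_val _ _ Rel.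
have fs y : exists z, f z = y.
  by have [x xP] := tot y; exists (SubElt xP).
have [h hE] := pP _ _ f idfun fs.
exists (fst \o (@sub_val _ _ Rel \o h)) => p /=.
have := hE p; rewrite /f /= => {2}<-.
by case: (h p) => -[].
Qed.

(** The dual basis form of finitely generated projective modules, chosen because many later maps are
    built from the coordinate functionals. *)
Definition fgproj (M : lmodType R) : Prop :=
  exists (T : finType) (x : T -> M) (xi : T -> {linear M -> R^o}),
    forall v, v = \sum_t xi t v *: x t.

Lemma fgproj_projective M : fgproj M -> projective M.
Proof.
move=> [T [x [xi xiE]]] A B f g fs.
have /choice[a aE] : forall t, exists a, f a = g (x t) by move=> t; exact: fs.
have lin : linear (fun v => \sum_t xi t v *: a t).
  move=> c u v; rewrite scaler_sumr -big_split; apply: eq_bigr => t _ /=.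
  by rewrite linearP scalerDl scalerA.
exists (mklin lin) => p; rewrite /= linear_sum [in RHS](xiE p) linear_sum.
by apply: eq_bigr => t _; rewrite !linearZ /= aE.
Qed.

Lemma fgproj_row k : fgproj 'rV[R]_k.
Proof.
have lin (t : 'I_k) : linear (fun v : 'rV[R]_k => v 0 t : R^o).
  by move=> a u v; rewrite !mxE.
exists 'I_k, (fun t => delta_mx 0 t), (fun t => mklin (lin t)) => v /=.
exact: row_sum_delta.
Qed.
End Projective.

Record subcomplex (R : comNzRingType) (X : complex R) := Subcomplex {
  in_cx :> forall n, submodule (X n);
  in_cx_diff : forall i j x, in_cx i x -> in_cx j (diff X i j x) }.

Program Definition full_submodule (R : comNzRingType) (V : lmodType R) :=
  @Submodule R V (fun _ => True) _ _ _.
Program Definition zero_submodule (R : comNzRingType) (V : lmodType R) :=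
  @Submodule R V (fun x => x = 0) _ _ _.
Next Obligation. by rewrite addr0. Qed.
Next Obligation. by rewrite scaler0. Qed.
Program Definition full_cx (R : comNzRingType) (X : complex R) :=
  @Subcomplex R X (fun n => full_submodule (X n)) _.
Program Definition zero_cx (R : comNzRingType) (X : complex R) :=
  @Subcomplex R X (fun n => zero_submodule (X n)) _.
Next Obligation. by rewrite linear0. Qed.

Section Range.
Context (R : comNzRingType).

Program Definition hsingle (F X : complex R) n l m (e : m = l + n)
    (h : {linear F l -> X m}) : Hom F X n :=
  @Hmap _ _ _ _ _ _ (fun i j x => tr j (h (tr l x))) _ _.
Next Obligation. by rewrite !linearP. Qed.
Next Obligation.
have [li|li] := eqVneq l i; last by rewrite [tr l x]tr0 // !linear0.
by rewrite tr0 // li.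
Qed.

Definition hin (F X : complex R) (U : subcomplex X) n (g : Hom F X n) : Prop :=
  forall i j x, U j (g i j x).

(** Lifting from projectives, relative to the pair [(V, U)] so that no quotient complex is formed:
    where [V / U] is exact, a map into [V] that is a cycle modulo [U] is a boundary modulo [U]. The
    homotopy is built degree by degree from the bottom [a] of [F]. *)
Lemma range (F X : complex R) (a : int) (V U : subcomplex X) n (g : Hom F X n) :
  (forall l (x : F l), l < a -> x = 0) -> (forall l, projective (F l)) ->
  (forall l x, U l x -> V l x) -> hin V g ->
  hin U (diff (Hom F X) n (n - 1) g) ->
  (forall l, (forall x : F l, x = 0) \/ forall v : X (l + n),
     V _ v -> U _ (diff X (l + n) (l + n - 1) v) ->
     exists2 w : X (l + n + 1), V _ w & U _ (v - diff X (l + n + 1) (l + n) w)) ->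
  exists2 w : Hom F X (n + 1), hin V w & hin U (g - diff (Hom F X) (n + 1) n w).
Proof.
move=> F0 Fp UV gV gU ac.
pose th w : Hom F X n := g - diff (Hom F X) (n + 1) n w.
pose Pk (k : nat) (w : Hom F X (n + 1)) := hin V w /\
  forall i j x, i < a + k%:Z -> U j (th w i j x).
have step k w : Pk k w -> exists2 w', Pk k.+1 w' &
    forall i j x, i < a + k%:Z -> w' i j x = w i j x.
  move=> [wV wU]; pose l := a + k%:Z.
  have thV i j x : V j (th w i j x).
    rewrite /th hmapBE; apply: in_subB => //.
    have [e|e] := eqVneq j (i + n); last by rewrite hmap_shape //; exact: in_sub0.
    rewrite (@hdE _ _ _ _ _ _ _ (j + 1) (i - 1)) ?addrK //.
    by apply: in_subB; [exact: in_cx_diff | apply: in_subZ; exact: wV].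
  have dthU x : U _ (diff X (l + n) (l + n - 1) (th w l (l + n) x)).
    have -> : diff X (l + n) (l + n - 1) (th w l (l + n) x) =
      diff (Hom F X) n (n - 1) g l (l + n - 1) x +
      sg n *: th w (l - 1) (l + n - 1) (diff F l (l - 1) x).
      have -> : diff (Hom F X) n (n - 1) g = diff (Hom F X) n (n - 1) (th w).
        by rewrite /th linearB diff_diff subr0.
      by rewrite (@hdE _ _ _ _ _ _ _ (l + n) (l - 1)) ?subrK.
    apply: in_subD => //; apply: in_subZ; apply: wU; rewrite /l; lia.
  have [h hV hU] : exists2 h : {linear F l -> X (l + n + 1)},
      forall x, V _ (h x) & forall x, U _ (th w l (l + n) x - diff X _ (l + n) (h x)).
    case: (ac l) => [F0l|acl].
      exists \0 => x; first exact: (in_sub0 (V _)).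
      by rewrite (F0l x) hmap_x0 !linear0 ?addr0; exact: in_sub0.
    have rel0 : (fun p : X (l + n + 1) * F l => V _ p.1 /\
        U _ (th w l (l + n) p.2 - diff X _ (l + n) p.1)) 0.
      split; first exact: in_sub0.
      rewrite hmap_x0 [X in _ - X](_ : _ = 0); last exact: linear0.
      by rewrite subr0; exact: in_sub0.
    have relD p q : (fun p : X (l + n + 1) * F l => V _ p.1 /\
        U _ (th w l (l + n) p.2 - diff X _ (l + n) p.1)) p ->
      (fun p : X (l + n + 1) * F l => V _ p.1 /\
        U _ (th w l (l + n) p.2 - diff X _ (l + n) p.1)) q ->
      (fun p : X (l + n + 1) * F l => V _ p.1 /\
        U _ (th w l (l + n) p.2 - diff X _ (l + n) p.1)) (p + q).
      move=> [p1 p2] [q1 q2]; split; first exact: in_subD.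
      rewrite [th _ _ _ _](@hmapD _ _ _ _ _ _ (th w) l (l + n) p.2 q.2).
      rewrite [X in _ - X](linearD (diff X _ _) p.1 q.1) opprD addrACA.
      exact: in_subD.
    have relZ c p : (fun p : X (l + n + 1) * F l => V _ p.1 /\
        U _ (th w l (l + n) p.2 - diff X _ (l + n) p.1)) p ->
      (fun p : X (l + n + 1) * F l => V _ p.1 /\
        U _ (th w l (l + n) p.2 - diff X _ (l + n) p.1)) (c *: p).
      move=> [p1 p2]; split; first exact: in_subZ.
      rewrite [th _ _ _ _](@hmapZr _ _ _ _ (th w) l (l + n) c p.2).
      rewrite [X in _ - X](_ : _ = c *: diff X _ _ p.1); last exact: linearZ.
      by rewrite -scalerBr; exact: in_subZ.
    have [|h hE] := projective_rel (Rel := Submodule rel0 relD relZ) (Fp l).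
      by move=> x; have [w' w'V w'U] := acl _ (thV l (l + n) x) (dthU x); exists w'.
    by exists h => x; have [] := hE x.
  pose s : Hom F X (n + 1) := hsingle (esym (addrA l n 1)) h.
  exists (w + s) => [|i j x il]; last first.
    by rewrite hmapDE /s /= [tr l x]tr0 ?linear0 ?addr0 // gt_eqF.
  split=> [i j x|i j x il].
    rewrite hmapDE; apply: in_subD => //; rewrite /s /=.
    have [->|e] := eqVneq j (l + n + 1); first by rewrite trE.
    by rewrite tr0 //; exact: in_sub0.
  have -> : th (w + s) = th w - diff (Hom F X) (n + 1) n s.
    by rewrite /th linearD opprD addrA.
  rewrite hmapBE; have [e|e] := eqVneq j (i + n); last first.
    by rewrite !hmap_shape // subr0; exact: in_sub0.
  rewrite (@hdE _ _ _ _ _ _ _ (j + 1) (i - 1)) ?addrK //.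
  have -> : s (i - 1) j (diff F i (i - 1) x) = 0.
    by rewrite /s /= [tr l _]tr0 ?linear0 // /l; lia.
  rewrite scaler0 subr0; have [il'|il'] := eqVneq l i.
    by subst i; subst j; rewrite /s /= !trE; exact: hU.
  rewrite /s /= [tr l _]tr0 // !linear0 ?addr0; apply: wU.
  by rewrite -/l; move: il' il; rewrite /l; lia.
have P0 : Pk 0%N 0.
  split=> [i j x|i j x]; first by rewrite hmap0E; exact: in_sub0.
  by rewrite addr0 => ia; rewrite (F0 _ x ia) hmap_x0; exact: in_sub0.
have nxt k (w : {w | Pk k w}) : {w' : {w' | Pk k.+1 w'} |
    forall i j x, i < a + k%:Z -> sval w' i j x = sval w i j x}.
  apply: cid; case: w => w /= wP; have [w' w'P agr] := step k w wP.
  by exists (exist _ w' w'P).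
(* Stage [k + 1] changes the homotopy only in degree [a + k], so the stages stabilize in every
   degree. *)
pose sq := nat_rect (fun k => {w | Pk k w}) (exist _ 0 P0)
  (fun k w => sval (nxt k w)).
have agr k d i j x : i < a + k%:Z ->
    sval (sq (d + k)%N) i j x = sval (sq k) i j x.
  move=> ik; elim: d => [//|d IH]; rewrite addSn /= (svalP (nxt _ _)) //.
  by apply: lt_le_trans ik _; lia.
have agr2 k k' i j x : (k <= k')%N -> i < a + k%:Z ->
    sval (sq k') i j x = sval (sq k) i j x.
  by move=> /subnK <-; exact: agr.
pose K (i : int) := `|(i - a)%R|%N.+1.
have iK i : i < a + (K i)%:Z by rewrite /K; lia.
have lin i j : linear (fun x => sval (sq (K i)) i j x) by exact: hmapP.
have sh i j x : j != i + (n + 1) -> sval (sq (K i)) i j x = 0 by exact: hmap_shape.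
pose W : Hom F X (n + 1) := mkhmap lin sh.
have Wi k j' y : W k j' y = sval (sq (K k)) k j' y by [].
exists W => [i j x|i j x]; first by rewrite Wi; exact: (svalP (sq (K i))).1.
have [e|e] := eqVneq j (i + n); last by rewrite hmap_shape //; exact: in_sub0.
(* The differential at [i] involves the homotopy in degrees [i] and [i - 1]; [M] is a stage at which
   both are final. *)
pose M := (K (i - 1)%R + K i)%N.
have := (svalP (sq M)).2 i j x; rewrite /th !hmapBE.
rewrite !(@hdE _ _ _ _ _ _ _ (j + 1) (i - 1)) ?addrK // !Wi.
rewrite (agr2 (K i) M) ?leq_addl ?iK // (agr2 (K (i - 1)%R) M) ?leq_addr ?iK //.
apply.
by apply: lt_le_trans (iK i) _; rewrite /M; lia.
Qed.
End Range.

Section RangeCorollaries.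
Context (R : comNzRingType).
Implicit Types X Y F I : complex R.

Definition bounded_below_projective F : Prop :=
  (exists a : int, forall l (x : F l), l < a -> x = 0) /\
  forall l, projective (F l).

(** Only the degrees [l + n] with [F l] nonzero matter. This degreewise form is what makes the
    window estimates possible. *)
Lemma acyc_hom F X n : bounded_below_projective F ->
  (forall l, (forall x : F l, x = 0) \/ acyc X (l + n)) -> acyc (Hom F X) n.
Proof.
move=> [[a Fa] Fp] FX g cg.
have [w _ wg] : exists2 w : Hom F X (n + 1), hin (full_cx X) w &
    hin (zero_cx X) (g - diff (Hom F X) (n + 1) n w).
  apply: (@range R F X a) => // [i j x|l]; first by rewrite cg.
  case: (FX l) => [|aX]; [by left|right] => v _ /= dv.
  have [w wv] := aX v dv; exists w => //=; by rewrite wv subrr.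
exists w; apply/eqP; rewrite eq_sym -subr_eq0; apply/eqP.
by apply: hmap_eq => i j x; exact: wg.
Qed.

Lemma post_projective_qi F X Y (g : chain_map X Y) :
  bounded_below_projective F -> quasi_iso g -> quasi_iso (post F g).
Proof.
move=> Fb /cone_qi /acyclicE aC; apply/post_qi/acyclicE => n.
by apply: acyc_hom => // l; right.
Qed.

Lemma pre_injective_qi I X Y (g : chain_map X Y) :
  K_injective I -> quasi_iso g -> quasi_iso (pre I g).
Proof. by move=> kI /cone_qi aC; apply: pre_qi; exact: kI. Qed.
End RangeCorollaries.

(** * Ideals and Noetherian modules *)

Section Ideals.
Context (R : comNzRingType).
Notation ideal := (submodule R^o).
Implicit Types J : ideal.

Lemma idealM J a x : J x -> J (a * x).
Proof. exact: (@in_subZ _ _ J a x). Qed.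
Lemma idealMr J a x : J x -> J (x * a).
Proof. by rewrite mulrC; exact: idealM. Qed.

Lemma ideal_idealr_closed J : ~ J 1 -> idealr_closed (fun x => `[< J x >]).
Proof.
move=> J1; split; first by apply/asboolP; exact: in_sub0.
  by apply/asboolP.
move=> a u v /asboolP Ju /asboolP Jv; apply/asboolP.
by apply: in_subD => //; exact: idealM.
Qed.

Section OfPred.
Context (I : {pred R}) (cI : idealr_closed I).
Program Definition ideal_of : ideal := @Submodule R R^o (fun x => x \in I) _ _ _.
Next Obligation. by case: cI. Qed.
Next Obligation.
by case: cI => _ _ h; have := h 1 x y; rewrite mul1r; apply.
Qed.
Next Obligation.
by case: cI => I0 _ h; have := h a x 0; rewrite addr0; apply.
Qed.
End OfPred.

Program Definition ideal_add J (a : R) : ideal :=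
  @Submodule R R^o (fun x => exists r, J (x - r * a)) _ _ _.
Next Obligation. by exists 0; rewrite mul0r subr0; exact: in_sub0. Qed.
Next Obligation.
exists (H + H0); rewrite mulrDl opprD addrACA; exact: in_subD.
Qed.
Next Obligation.
exists (a0 * H); rewrite -mulrA -mulrBr; exact: idealM.
Qed.

Lemma ideal_add_sub J a x : J x -> ideal_add J a x.
Proof. by move=> Jx; exists 0; rewrite mul0r subr0. Qed.
Lemma ideal_add_mem J a : ideal_add J a a.
Proof. by exists 1; rewrite mul1r subrr; exact: in_sub0. Qed.

Definition fg_ideal J := exists (k : nat) (g : 'I_k -> R),
  forall x, J x <-> exists a : 'I_k -> R, x = \sum_l a l * g l.

Context (nR : noetherian R).

Lemma noetherian_fg J : fg_ideal J.
Proof.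
have [J1|J1] := pselect (J 1).
  exists 1%N, (fun _ => 1) => x; split=> [_|_].
    by exists (fun _ => x); rewrite big_ord1 mulr1.
  by rewrite -[x]mulr1; exact: idealM.
have [k [g gE]] := nR (ideal_idealr_closed J1).
by exists k, g => x; rewrite -gE; split=> /asboolP.
Qed.

(** If [P] failed somewhere, each failing ideal would have a failing one strictly above it, and
    choice would give a strictly increasing chain. Its union is finitely generated, hence already
    reached at the stage [K]. *)
Lemma noetherian_ind (P : ideal -> Prop) :
  (forall J, (forall J', (forall x, J x -> J' x) -> (exists2 x, J' x & ~ J x) ->
    P J') -> P J) -> forall J, P J.
Proof.
move=> step J0; apply: contrapT => nP0.
have nxt (J : {J | ~ P J}) : {J' : {J | ~ P J} |
    (forall x, sval J x -> sval J' x) /\ exists2 x, sval J' x & ~ sval J x}.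
  apply: cid; case: J => J nPJ /=; apply: contrapT => nex; apply: nPJ.
  apply: step => J' sJ J'x; apply: contrapT => nPJ'; apply: nex.
  by exists (exist _ J' nPJ').
pose sq k := iter k (fun J : {J : ideal | ~ P J} => sval (nxt J)) (exist _ J0 nP0 : {J | ~ P J}).
have mono d k x : sval (sq k) x -> sval (sq (d + k)%N) x.
  by move=> h; elim: d => [//|d IH]; exact: (svalP (nxt _)).1.
have mono2 k k' x : (k <= k')%N -> sval (sq k) x -> sval (sq k') x.
  by move=> /subnK <-; exact: mono.
have U0 : exists k, sval (sq k) 0 by exists 0%N; exact: in_sub0.
have UD x y : (exists k, sval (sq k) x) -> (exists k, sval (sq k) y) ->
    exists k, sval (sq k) (x + y).
  move=> [k kx] [l ly]; exists (k + l)%N; apply: in_subD.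
    exact: mono2 (leq_addr _ _) kx.
  exact: mono2 (leq_addl _ _) ly.
have UZ (a : R) x : (exists k, sval (sq k) x) -> exists k, sval (sq k) (a *: x).
  by move=> [k kx]; exists k; exact: in_subZ.
have [m [g gE]] := noetherian_fg (@Submodule R R^o _ U0 UD UZ).
have /choice[k kE] : forall l, exists k, sval (sq k) (g l).
  move=> l; apply/gE; exists (fun j => (j == l)%:R).
  by rewrite (bigD1 l) //= eqxx mul1r big1 ?addr0 // => j /negPf->; rewrite mul0r.
pose K := (\max_l k l)%N.
have sK x : (exists k, sval (sq k) x) -> sval (sq K) x.
  move=> /gE[a ->]; apply: (in_sub_sum (U := sval (sq K))) => l.
  apply: (in_subZ (a l)); apply: mono2 (kE l); exact: leq_bigmax.
have [x x1 x2] := (svalP (nxt (sq K))).2.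
by apply: x2; apply: sK; exists K.+1.
Qed.

Lemma proper_sub_maximal J : ~ J 1 ->
  exists2 m : {pred R}, maximal_ideal m & forall x, J x -> x \in m.
Proof.
move: J; apply: noetherian_ind => J IH J1.
have [[J' [sJ J'x J'1]]|nex] := pselect (exists J' : ideal,
    [/\ forall x, J x -> J' x, exists2 x, J' x & ~ J x & ~ J' 1]).
  have [m mm sm] := IH J' sJ J'x J'1; exists m => // x Jx.
  by apply: sm; exact: sJ.
exists (fun x => `[< J x >]); last by move=> x Jx; apply/asboolP.
split=> [|I cI sI x]; first exact: ideal_idealr_closed.
apply/idP/idP => [|Ix]; first exact: sI.
apply/asboolP; apply: contrapT => nJx; apply: nex; exists (ideal_of cI); split.
- by move=> y Jy; apply: sI; apply/asboolP.
- by exists x.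
- by have [_ /negP] := cI.
Qed.

Lemma maximal_unit (m : {pred R}) a : maximal_ideal m -> a \notin m ->
  exists r, 1 - r * a \in m.
Proof.
move=> [cm mm] am; apply: contrapT => nex.
have h1 : ~ ideal_add (ideal_of cm) a 1 by [].
have := mm _ (ideal_idealr_closed h1) => h.
have sm : {subset m <= (fun x => `[< ideal_add (ideal_of cm) a x >])}.
  by move=> x xm; apply/asboolP; exact: ideal_add_sub.
have := h sm a; rewrite (negPf am) => /esym/negP; apply.
by apply/asboolP; exact: ideal_add_mem.
Qed.
End Ideals.
Notation ideal R := (submodule R^o).

Section NoetherianModules.
Context (R : comNzRingType) (nR : noetherian R).

(** Induction on the rank: the leading coordinates of elements of [U] form an ideal, and the
    elements with leading coordinate zero form a submodule in rank one less. *)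
Lemma noetherian_row k (U : submodule 'rV[R]_k) :
  exists (m : nat) (g : 'I_m -> 'rV[R]_k), (forall i, U (g i)) /\
    forall u, U u -> exists a : 'I_m -> R, u = \sum_l a l *: g l.
Proof.
elim: k U => [|k IH] U.
  exists 0%N, (fun _ => 0); split=> [i|u _]; first exact: in_sub0.
  by exists (fun _ => 0); rewrite big_ord0 thinmx0.
pose A (x : R^o) := exists2 u : 'rV[R]_(1 + k), U u & (u 0 0 = x).
have A0 : A 0 by exists 0; rewrite ?mxE //; exact: in_sub0.
have AD x y : A x -> A y -> A (x + y).
  by move=> [u Uu <-] [v Uv <-]; exists (u + v); rewrite ?mxE //; exact: in_subD.
have AZ (a : R) x : A x -> A (a *: x).
  by move=> [u Uu <-]; exists (a *: u); rewrite ?mxE //; exact: in_subZ.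
have [m [g gE]] := noetherian_fg nR (Submodule A0 AD AZ).
have /choice[u uE] : forall l, exists u : 'rV[R]_(1 + k), U u /\ u 0 0 = g l.
  move=> l; suff [v] : A (g l) by exists v.
  apply/gE; exists (fun j => (j == l)%:R).
  by rewrite (bigD1 l) //= eqxx mul1r big1 ?addr0 // => j /negPf->; rewrite mul0r.
pose B (w : 'rV[R]_k) := U (row_mx (0 : 'rV[R]_1) w : 'rV[R]_(1 + k)).
have B0 : B 0 by rewrite /B row_mx0; exact: in_sub0.
have BD x y : B x -> B y -> B (x + y).
  move=> Bx By; rewrite /B; have -> : row_mx 0 (x + y) =
    row_mx (0 : 'rV[R]_1) x + row_mx (0 : 'rV[R]_1) y by rewrite add_row_mx addr0.
  exact: in_subD Bx By.
have BZ (a : R) x : B x -> B (a *: x).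
  move=> Bx; rewrite /B; have -> : row_mx 0 (a *: x) =
    a *: row_mx (0 : 'rV[R]_1) x by rewrite scale_row_mx scaler0.
  exact: (@in_subZ _ _ U a _ Bx).
have [m' [g' [g'U g'E]]] := IH (Submodule B0 BD BZ).
pose G (i : 'I_(m + m')) : 'rV[R]_(1 + k) := match fintype.split i with
  | inl l => u l | inr l => row_mx 0 (g' l) end.
exists (m + m')%N, G; split=> [i|v Uv].
  by rewrite /G; case: (fintype.split i) => l; [exact: (uE l).1 | exact: g'U].
have [a aE] : exists a : 'I_m -> R, v 0 0 = \sum_l a l * g l by apply/gE; exists v.
pose w : 'rV[R]_(1 + k) := v - \sum_l a l *: u l.
have Uw : U w.
  apply: in_subB => //; apply: (in_sub_sum (U := U)) => l.
  by apply: in_subZ; exact: (uE l).1.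
have w0 : w = row_mx 0 (rsubmx w).
  rewrite -[LHS]hsubmxK; congr row_mx; apply/rowP => i; rewrite !mxE ord1.
  have -> : lshift k (0 : 'I_1) = 0 by apply/val_inj.
  rewrite aE summxE -sumrB big1 // => l _; by rewrite mxE (uE l).2 subrr.
have [b bE] : exists b : 'I_m' -> R, rsubmx w = \sum_l b l *: g' l.
  by apply: g'E; rewrite /= /B -w0.
exists (fun i => match fintype.split i with inl l => a l | inr l => b l end).
rewrite big_split_ord /=.
have -> : v = \sum_l a l *: u l + w by rewrite addrC subrK.
congr (_ + _); first by apply: eq_bigr => l _; rewrite /G (unsplitK (inl _ l)).
rewrite w0 bE; have -> : row_mx 0 (\sum_l b l *: g' l) =
    \sum_l b l *: row_mx (0 : 'rV[R]_1) (g' l) :> 'rV[R]_(1 + k).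
  elim/big_rec2: _ => [|l y1 y2 _ <-]; first by rewrite row_mx0.
  by rewrite scale_row_mx add_row_mx scaler0 addr0.
by apply: eq_bigr => l _; rewrite /G (unsplitK (inr _ l)).
Qed.

(** The coefficient vectors that represent elements of [U] modulo [B] form a submodule of a free
    module; generators of it are lifted back to [U]. *)
Lemma noetherian_rel (M : lmodType R) (U B : submodule M) k (g : 'I_k -> M) :
  (forall u, U u -> exists a : 'I_k -> R, B (u - \sum_l a l *: g l)) ->
  exists (m : nat) (h : 'I_m -> M), (forall i, U (h i)) /\
    forall u, U u -> exists a : 'I_m -> R, B (u - \sum_l a l *: h l).
Proof.
move=> gE; pose A (c : 'rV[R]_k) := exists2 u, U u & B (u - \sum_l c 0 l *: g l).
have A0 : A 0.
  exists 0; first exact: in_sub0.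
  by rewrite big1 ?subrr; [exact: in_sub0 | move=> l _; rewrite mxE scale0r].
have AD x y : A x -> A y -> A (x + y).
  move=> [u Uu uE] [v Uv vE]; exists (u + v); first exact: in_subD.
  rewrite (eq_bigr (fun l => x 0 l *: g l + y 0 l *: g l)); last first.
    by move=> l _; rewrite mxE scalerDl.
  by rewrite big_split opprD addrACA; exact: in_subD.
have AZ (a : R) x : A x -> A (a *: x).
  move=> [u Uu uE]; exists (a *: u); first exact: in_subZ.
  rewrite (eq_bigr (fun l => a *: (x 0 l *: g l))); last first.
    by move=> l _; rewrite mxE scalerA.
  by rewrite -scaler_sumr -scalerBr; exact: in_subZ.
have [m [c [cA cE]]] := noetherian_row (Submodule A0 AD AZ).
have /choice[h hE] : forall i, exists h, U h /\ B (h - \sum_l c i 0 l *: g l).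
  by move=> i; have [u] := cA i; exists u.
exists m, h; split=> [i|u Uu]; first exact: (hE i).1.
have [a aE] := gE u Uu.
have [b bE] : exists b : 'I_m -> R, \row_l a l = \sum_i b i *: c i.
  apply: cE; exists u => //; rewrite (eq_bigr (fun l => a l *: g l)) //.
  by move=> l _; rewrite mxE.
exists b.
have -> : u - \sum_l b l *: h l = (u - \sum_l a l *: g l)
    - \sum_i b i *: (h i - \sum_l c i 0 l *: g l).
  rewrite [X in _ = _ - X](eq_bigr (fun i => b i *: h i
    - \sum_l (b i * c i 0 l) *: g l)); last first.
    move=> i _; rewrite scalerBr scaler_sumr; congr (_ - _).
    by apply: eq_bigr => l _; rewrite scalerA.
  rewrite sumrB exchange_big /= opprB addrA; congr (_ - _).
  rewrite -[LHS](subrK (\sum_l a l *: g l)); congr (_ + _).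
  apply: eq_bigr => l _; rewrite -scaler_suml; congr (_ *: _).
  have /rowP/(_ l) := bE; rewrite mxE => ->; rewrite summxE.
  by apply: eq_bigr => i _; rewrite mxE.
apply: in_subB => //; apply: (in_sub_sum (U := B)) => i.
by apply: in_subZ; exact: (hE i).2.
Qed.
End NoetherianModules.

(** * Determinant trick, Nakayama's lemma and functionals modulo a prime *)

Section DeterminantTrick.
Context (R : comNzRingType).

Lemma det_cong (a : ideal R) k (A B : 'M[R]_k) :
  (forall i j, a (A i j - B i j)) -> a (\det A - \det B).
Proof.
move=> AB; rewrite /determinant -sumrB.
apply: (in_sub_sum (U := a)) => s; rewrite -mulrBr; apply: idealM.
elim/big_rec2: _ => [|i x y _ IH]; first by rewrite subrr; exact: in_sub0.
have -> : A i (s i) * y - B i (s i) * x =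
    A i (s i) * (y - x) + x * (A i (s i) - B i (s i)).
  by rewrite !mulrBr [x * A _ _]mulrC [x * B _ _]mulrC subrKA.
by apply: (in_subD (s := a)); exact: idealM.
Qed.

Lemma det_scalar_cong (a : ideal R) k (b : 'M[R]_k) s :
  (forall i j, a (b i j)) -> a (\det (s%:M - b) - s ^+ k).
Proof.
move=> ba; rewrite -det_scalar; apply: det_cong => i j.
by rewrite !mxE addrAC subrr sub0r; exact: (in_subN a).
Qed.

Lemma det_trick (M : lmodType R) (B : submodule M) k (g : 'I_k -> M)
    (b : 'M[R]_k) s :
  (forall l, B (s *: g l - \sum_j b l j *: g j)) ->
  forall l, B (\det (s%:M - b) *: g l).
Proof.
move=> h l; pose A := s%:M - b.
have hA i : B (\sum_j A i j *: g j).
  rewrite (eq_bigr (fun j => (i == j)%:R * s *: g j - b i j *: g j)); last first.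
    by move=> j _; rewrite !mxE scalerBl mulr_natl.
  rewrite sumrB (bigD1 i) //= eqxx mul1r big1 ?addr0 // => j ij.
  by rewrite eq_sym (negPf ij) mul0r scale0r.
have -> : \det A *: g l = \sum_i (\adj A) l i *: \sum_j A i j *: g j.
  rewrite (eq_bigr (fun i => \sum_j ((\adj A) l i * A i j) *: g j)); last first.
    by move=> i _; rewrite scaler_sumr; apply: eq_bigr => j _; rewrite scalerA.
  rewrite exchange_big /= (eq_bigr (fun j => (\det A *+ (l == j)) *: g j)); last first.
    move=> j _; rewrite -scaler_suml; have /matrixP/(_ l j) := mul_adj_mx A.
    by rewrite !mxE => ->.
  rewrite (bigD1 l) //= eqxx mulr1n big1 ?addr0 // => j jl.
  by rewrite eq_sym (negPf jl) mulr0n scale0r.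
by apply: (in_sub_sum (U := B)) => i; exact: in_subZ.
Qed.

(** The determinant of [1 - b] is congruent to 1 modulo [a] and annihilates every [g l] modulo [B].
    The result is a multiplier in [1 + a]; what it is good for depends on the maximal ideals that
    contain [a]. *)
Lemma nakayama (M : lmodType R) (a : ideal R) (B : submodule M) k (g : 'I_k -> M) :
  (forall l, exists2 c : 'I_k -> R, (forall j, a (c j)) &
    B (g l - \sum_j c j *: g j)) ->
  exists2 s, a (s - 1) & forall l, B (s *: g l).
Proof.
move=> h; have /choice[c cE] : forall l, exists c : 'I_k -> R,
    (forall j, a (c j)) /\ B (g l - \sum_j c j *: g j).
  by move=> l; have [c] := h l; exists c.
pose b := \matrix_(i, j) c i j.
exists (\det (1%:M - b)).
  rewrite -[X in _ - X](expr1n _ k); apply: det_scalar_cong => i j.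
  by rewrite mxE; exact: (cE i).1.
apply: det_trick => l; rewrite scale1r.
rewrite (eq_bigr (fun j => c l j *: g j)); first exact: (cE l).2.
by move=> j _; rewrite mxE.
Qed.
End DeterminantTrick.

Definition is_prime (R : comNzRingType) (p : ideal R) : Prop :=
  ~ p 1 /\ forall a b : R, p (a * b) -> p a \/ p b.

Lemma prime_exp (R : comNzRingType) (p : ideal R) (a : R) k :
  is_prime p -> p (a ^+ k) -> p a.
Proof.
move=> [p1 pM]; elim: k => [|k IH]; first by rewrite expr0.
by rewrite exprS => /pM[].
Qed.

Section LinearModPrime.
Context (R : comNzRingType) (M : lmodType R) (p : ideal R) (pp : is_prime p).

Program Definition sub_add_line (N : submodule M) (x : M) : submodule M :=
  @Submodule R M (fun y => exists r, N (y - r *: x)) _ _ _.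
Next Obligation. by exists 0; rewrite scale0r subr0; exact: in_sub0. Qed.
Next Obligation.
by exists (H + H0); rewrite scalerDl opprD addrACA; exact: in_subD.
Qed.
Next Obligation.
by exists (a * H); rewrite -scalerA -scalerBr; exact: in_subZ.
Qed.

(** A denominator-free functional on a vector space over the residue field of [p]. Enlarge [N0], one
    generator at a time, as long as no multiple of [y0] by an element outside [p] falls into it. In
    the end each generator is, up to a factor outside [p], a multiple of [y0] modulo [N]. With a
    common factor [t], [lam x] is a coefficient [r] such that [t *: x] equals [r *: y0] modulo [N].
    It is determined modulo [p] only, hence linearity modulo [p]. *)
Lemma linear_mod_prime (N0 : submodule M) k (g : 'I_k -> M) (y0 : M) :
  (forall a x, p a -> N0 (a *: x)) ->
  (forall x, exists a : 'I_k -> R, N0 (x - \sum_l a l *: g l)) ->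
  (forall t : R, ~ p t -> ~ N0 (t *: y0)) ->
  exists lam : M -> R,
    [/\ forall a x y, p (lam (a *: x + y) - (a * lam x + lam y)),
        forall x, N0 x -> p (lam x) & ~ p (lam y0)].
Proof.
move=> pN0 gN0 y0N0; have [p1 pM] := pp.
have [N [sN aN [t pt tN]]] : exists N : submodule M, [/\
    forall x, N0 x -> N x, forall t : R, ~ p t -> ~ N (t *: y0) &
    exists2 t : R, ~ p t & forall x, x \in codom g -> exists r, N (t *: x - r *: y0)].
  elim: (codom g) => [|x s [N [sN aN [t pt tN]]]].
    by exists N0; split=> //; exists 1.
  (* Either [x] can be killed without harm to [y0], or some [t0 *: y0] becomes a multiple of [x],
     and then [x] is commensurable with [y0]. *)
  have [av|nav] := pselect (forall t : R, ~ p t -> ~ sub_add_line N x (t *: y0)).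
    exists (sub_add_line N x); split=> //.
      by move=> y /sN Ny; exists 0; rewrite scale0r subr0.
    exists t => // y; rewrite inE => /orP[/eqP->|/tN[r Nr]].
      by exists 0, t; rewrite scale0r subr0 subrr; exact: in_sub0.
    by exists r, 0; rewrite scale0r subr0.
  have [t0 [pt0 [r Nr]]] : exists t0 : R, ~ p t0 /\ sub_add_line N x (t0 *: y0).
    apply: contrapT => h; apply: nav => t0 pt0 ht0; apply: h; by exists t0.
  (* Otherwise [r *: x] would lie in [N0], and [t0 *: y0] would lie in [N]. *)
  have pr : ~ p r.
    move=> pr; apply: (aN _ pt0); apply: (in_subDr _ (- (r *: x))) => //.
    by apply: in_subN; apply: sN; exact: pN0.
  exists N; split=> //; exists (t * r) => [/pM[]//|y].
  rewrite inE => /orP[/eqP->|/tN[r' Nr']].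
    exists (t * t0); rewrite -!scalerA -scalerBr; apply: in_subZ.
    by rewrite -opprB; exact: in_subN.
  exists (r * r'); rewrite [t * r]mulrC -!scalerA -scalerBr; exact: in_subZ.
have tN' x : exists r, N (t *: x - r *: y0).
  have [a aE] := gN0 x.
  have /choice[r rE] : forall l, exists r, N (t *: g l - r *: y0).
    by move=> l; apply: tN; exact: codom_f.
  exists (\sum_l a l * r l).
  have -> : t *: x - (\sum_l a l * r l) *: y0 =
      t *: (x - \sum_l a l *: g l) + \sum_l a l *: (t *: g l - r l *: y0).
    rewrite scalerBr -[RHS]addrA; congr (_ + _); rewrite scaler_suml scaler_sumr.
    rewrite -!sumrN -big_split; apply: eq_bigr => l _ /=.
    by rewrite scalerBr !scalerA [t * _]mulrC addrA addNr add0r.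
  apply: in_subD; first by apply: in_subZ; exact: sN.
  by apply: (in_sub_sum (U := N)) => l; exact: in_subZ.
have uni r r' x : N (t *: x - r *: y0) -> N (t *: x - r' *: y0) -> p (r - r').
  move=> h h'; apply: contrapT => np; apply: (aN _ np).
  have := in_subB N h' h; by rewrite opprB addrC subrKA -scalerBl.
have /choice[lam lamE] := tN'; exists lam; split.
- move=> a x y; apply: uni (lamE _) _.
  have := in_subD (in_subZ a (lamE x)) (lamE y).
  by rewrite scalerBr addrACA -opprD !scalerA [a * t]mulrC -(scalerA t a x) -scalerDr -scalerDl.
- move=> x N0x; rewrite -[lam x]subr0; apply: uni (lamE x) _.
  by rewrite scale0r subr0; apply: in_subZ; exact: sN.
- move=> pl; apply: pt; rewrite -[t](subrK (lam y0)); apply: in_subD => //.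
  apply: uni (lamE y0); by rewrite subrr; exact: in_sub0.
Qed.
End LinearModPrime.

Section LyingOver.
Context (R S : comNzRingType) (phi : {rmorphism R -> S})
  (phi_finite : fin_gen (restrict phi S^o)).
Local Notation SR := (restrict phi S^o).

(** [linear_mod_prime] for [S], the submodule [p S] and the element 1. If [t] times 1 lies in [p S],
    the determinant trick on generators of [S] yields an element killed by [phi] and congruent to a
    power of [t] modulo [p], so [t] lies in [p]. This is lying over without choosing a prime of
    [S]. *)
Lemma lying_over_functional (p : ideal R) : is_prime p ->
  (forall a : R, phi a = 0 -> p a) ->
  exists lam : SR -> R,
    [/\ forall a x y, p (lam (a *: x + y) - (a * lam x + lam y)) &
        ~ p (lam (1 : S))].
Proof.
move=> pp kp; have [k [g gE]] := phi_finite.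
pose N0 (x : SR) := exists2 c : 'I_k -> R, (forall l, p (c l)) & x = \sum_l c l *: g l.
have N00 : N0 0.
  exists (fun _ => 0) => [l|]; first exact: in_sub0.
  by rewrite big1 // => l _; rewrite scale0r.
have N0D x y : N0 x -> N0 y -> N0 (x + y).
  move=> [c pc ->] [d pd ->]; exists (fun l => c l + d l) => [l|].
    exact: in_subD.
  by rewrite -big_split; apply: eq_bigr => l _; rewrite scalerDl.
have N0Z (a : R) x : N0 x -> N0 (a *: x).
  move=> [c pc ->]; exists (fun l => a * c l) => [l|]; first exact: idealM.
  by rewrite scaler_sumr; apply: eq_bigr => l _; rewrite scalerA.
pose N := Submodule N00 N0D N0Z.
have pN (a : R) (x : SR) : p a -> N (a *: x).
  move=> pa; have [b ->] := gE x; exists (fun l => a * b l) => [l|].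
    exact: idealMr.
  by rewrite scaler_sumr; apply: eq_bigr => l _; rewrite scalerA.
have NS (s : S) (x : SR) : N x -> N (s * x : S).
  move=> [c pc ->]; rewrite [X in N X](_ : _ = \sum_l c l *: (s * g l : SR)).
    by apply: (in_sub_sum (U := N)) => l; exact: pN.
  by rewrite mulr_sumr; apply: eq_bigr => l _; rewrite mulrCA.
have avoid (t : R) : ~ p t -> ~ N (t *: (1 : SR)).
  move=> pt Nt; apply: pt.
  have /choice[c cE] : forall l, exists c : 'I_k -> R, (forall j, p (c j)) /\
      t *: g l = \sum_j c j *: g j.
    move=> l; have [c pc cE] := NS (g l) _ Nt; exists c; split => //.
    by rewrite -cE [in RHS]mulrC; congr (_ * _); rewrite [X in _ = X]mulr1.
  pose b := \matrix_(i, j) c i j.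
  have hb l : zero_submodule SR (\det (t%:M - b) *: g l).
    apply: det_trick => i; rewrite (cE i).2 /=; apply/eqP; rewrite subr_eq0.
    by apply/eqP; apply: eq_bigr => j _; rewrite mxE.
  have d0 : phi (\det (t%:M - b)) = 0.
    rewrite -[LHS]mulr1; have [a aE] := gE (1 : S).
    rewrite [X in _ * X]aE mulr_sumr big1 // => l _.
    have h : phi (\det (t%:M - b)) * (g l : S) = 0 := hb l.
    change (phi (\det (t%:M - b)) * (phi (a l) * (g l : S)) = 0).
    by rewrite mulrCA h mulr0.
  apply: (@prime_exp _ _ _ k pp); rewrite -[_ ^+ _](subKr (\det (t%:M - b))).
  apply: (in_subB p (kp _ d0)); apply: det_scalar_cong => i j.
  by rewrite mxE; exact: (cE i).1.
have [|lam [l1 _ l3]] := linear_mod_prime pp pN _ avoid (g := g).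
  by move=> x; have [a ->] := gE x; exists a; rewrite subrr; exact: in_sub0.
by exists lam.
Qed.
End LyingOver.

(** * Finitely generated homology of Hom complexes *)

Lemma hsingleE (R : comNzRingType) (F X : complex R) n l m (e : m = l + n)
    (h : {linear F l -> X m}) i j x :
  hsingle e h i j x = tr j (h (tr l x)).
Proof. by []. Qed.

Section FinitelyGenerated.
Context (R : comNzRingType) (nR : noetherian R).

Definition fg_mod (M : lmodType R) (U B : M -> Prop) : Prop :=
  exists (T : finType) (h : T -> M), (forall t, U (h t)) /\
    forall u, U u -> exists a : T -> R, B (u - \sum_t a t *: h t).

Lemma fg_mod_ord (M : lmodType R) (U B : M -> Prop) : fg_mod U B ->
  exists (k : nat) (h : 'I_k -> M), (forall t, U (h t)) /\
    forall u, U u -> exists a : 'I_k -> R, B (u - \sum_t a t *: h t).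
Proof.
move=> [T [h [hU hE]]]; exists #|T|, (fun i => h (enum_val i)); split=> // u.
move=> /hE[a aE]; exists (fun i => a (enum_val i)).
rewrite (reindex (@enum_val T predT)) // in aE.
by apply: onW_bij; exact: enum_val_bij.
Qed.

Lemma homology_fgP (X : complex R) n :
  homology_fin_gen X n <-> fg_mod (@cycle _ X n) (@boundary _ X n).
Proof.
split=> [[k [g [cg gE]]]|/fg_mod_ord]; last by [].
by exists 'I_k, g.
Qed.

Lemma noetherian_fg_mod (M : lmodType R) (U B : submodule M) (V : M -> Prop) :
  (forall u, U u -> V u) -> fg_mod V B -> fg_mod U B.
Proof.
move=> UV /fg_mod_ord[k [g [_ gE]]].
have [m [h hE]] := noetherian_rel nR (fun u Uu => gE u (UV u Uu)).
by exists 'I_m, h.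
Qed.

Program Definition cycle_sub (X : complex R) n : submodule (X n) :=
  @Submodule R (X n) (@cycle _ X n) _ _ _.
Next Obligation. by rewrite /cycle linear0. Qed.
Next Obligation. exact: cycleD. Qed.
Next Obligation. exact: cycleZ. Qed.
Program Definition boundary_sub (X : complex R) n : submodule (X n) :=
  @Submodule R (X n) (@boundary _ X n) _ _ _.
Next Obligation. exact: boundary0. Qed.
Next Obligation. exact: boundaryD. Qed.
Next Obligation. exact: boundaryZ. Qed.

(** With [tboundary] this gives a filtration by truncations: from [tcycle X t] to [tboundary X t]
    the quotient is the homology in degree [t], and from [tboundary X t] to [tcycle X (t + 1)] it is
    acyclic. *)
Program Definition tcycle_sub (X : complex R) t n : submodule (X n) :=
  @Submodule R (X n) (fun x => (n < t -> x = 0) /\ (n = t -> cycle x)) _ _ _.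
Next Obligation. by split=> // _; rewrite /cycle linear0. Qed.
Next Obligation.
split=> [nt|nt]; last by apply: cycleD; auto.
by rewrite H // H0 // addr0.
Qed.
Next Obligation.
split=> [nt|nt]; last by apply: cycleZ; auto.
by rewrite H // scaler0.
Qed.
Program Definition tcycle (X : complex R) t : subcomplex X :=
  @Subcomplex R X (tcycle_sub X t) _.
Next Obligation.
split=> [jt|_]; last by rewrite /cycle diff_diff.
have [e|e] := eqVneq j (i - 1); last by rewrite diff_shape.
have [it|it] := ltP i t; first by rewrite H // linear0.
have it' : i = t by lia.
by subst j; exact: H0.
Qed.

(** Dividing by it truncates [X] from above: degree [t] becomes the cokernel of the incoming
    differential, and all higher degrees vanish. *)
Program Definition tboundary_sub (X : complex R) t n : submodule (X n) :=
  @Submodule R (X n) (fun x => (n < t -> x = 0) /\ (n = t -> boundary x)) _ _ _.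
Next Obligation. by split=> // _; exact: boundary0. Qed.
Next Obligation.
split=> [nt|nt]; last by apply: boundaryD; auto.
by rewrite H // H0 // addr0.
Qed.
Next Obligation.
split=> [nt|nt]; last by apply: boundaryZ; auto.
by rewrite H // scaler0.
Qed.
Program Definition tboundary (X : complex R) t : subcomplex X :=
  @Subcomplex R X (tboundary_sub X t) _.
Next Obligation.
split=> [jt|_]; last exact: boundaryI.
have [e|e] := eqVneq j (i - 1); last by rewrite diff_shape.
have [it|it] := ltP i t; first by rewrite H // linear0.
have it' : i = t by lia.
by subst j; apply: boundary_cycle; exact: H0.
Qed.

Lemma hom_tail_boundary (P X : complex R) n t (g : Hom P X n) :
  bounded_below_projective P -> cycle g ->
  (forall i j x, i < t -> g i j x = 0) ->
  (forall l, t <= l -> (forall x : P l, x = 0) \/ acyc X (l + n)) -> boundary g.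
Proof.
move=> [[a Pa] Pp] cg g0 ac.
have [w _ wg] : exists2 w : Hom P X (n + 1), hin (tcycle X (t + n)) w &
    hin (zero_cx X) (g - diff (Hom P X) (n + 1) n w).
  apply: (@range R P X a) => //.
  - by move=> l x ->; exact: in_sub0.
  - move=> i j x; split=> [jt|jt].
      have [e|e] := eqVneq j (i + n); last by rewrite hmap_shape.
      by apply: g0; lia.
    have [e|e] := eqVneq j (i + n); last by rewrite hmap_shape // /cycle linear0.
    have /hd_cycle cg' := cg.
    by rewrite /cycle (cg' _ _ _ (i - 1)) // g0 ?scaler0 //; lia.
  - by move=> i j x; rewrite cg.
  move=> l; have [tl|lt] := leP t l; last first.
    right=> v [v0 _] _; exists 0; first exact: in_sub0.
    have -> : v = 0 by apply: v0; lia.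
    by rewrite sub0r; apply: in_subN; rewrite linear0; exact: in_sub0.
  case: (ac _ tl) => [|aX]; [by left|right] => v [v0 vc] /= dv.
  have [w wv] := aX v dv; exists w; last by rewrite /= wv subrr.
  by split=> h; exfalso; lia.
exists w; apply/eqP; rewrite eq_sym -subr_eq0; apply/eqP.
by apply: hmap_eq => i j x; exact: wg.
Qed.

(** Downward induction on [t] over the cycles that vanish below degree [t]. Such a cycle takes
    values in cycles on [P t]. Its values on a dual basis, modulo boundaries, range over a finitely
    generated module, and if they are all boundaries it is homotopic to a cycle that vanishes in
    degree [t] as well. Above [T] only boundaries are left; at the bottom of [P] the vanishing
    condition is void. *)
Lemma hom_fg (P X : complex R) n (T : int) :
  (exists a : int, forall l (x : P l), l < a -> x = 0) ->
  (forall l, fgproj (P l)) -> degreewise_homologically_finite X ->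
  (forall l, T < l -> (forall x : P l, x = 0) \/ acyc X (l + n)) ->
  homology_fin_gen (Hom P X) n.
Proof.
move=> Pa Pf fX ac; apply/homology_fgP.
have Pb : bounded_below_projective P by split=> // l; exact: fgproj_projective.
pose A t (g : Hom P X n) := cycle g /\ forall i j x, i < t -> g i j x = 0.
have A0 t : A t 0 by split=> //; rewrite /cycle linear0.
have AD t f g : A t f -> A t g -> A t (f + g).
  move=> [cf f0] [cg g0]; split=> [|i j x it]; first exact: cycleD.
  by rewrite hmapDE f0 // g0 // addr0.
have AZ t (a : R) f : A t f -> A t (a *: f).
  move=> [cf f0]; split=> [|i j x it]; first exact: cycleZ.
  by rewrite hmapZE f0 // scaler0.
have claim d : fg_mod (A (T + 1 - d%:Z)) (@boundary _ (Hom P X) n).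
  elim: d => [|d [T1 [h1 [h1A h1E]]]].
    exists 'I_0, (fun _ => 0); split=> [[]//|u [cu u0]].
    exists (fun _ => 0); rewrite big_ord0 subr0; apply: hom_tail_boundary cu u0 _ => //.
    by move=> l lT; apply: ac; lia.
  pose t := T + 1 - d.+1%:Z; rewrite -/t.
  have [K [x [xi xiE]]] := Pf t.
  pose ev (g : Hom P X n) : {ffun K -> X (t + n)} := [ffun u => g t (t + n) (x u)].
  have evP (a : R) f g : ev (a *: f + g) = a *: ev f + ev g.
    by apply/ffunP => u; rewrite !ffunE hmapDE hmapZE.
  pose U f := exists2 g, A t g & ev g = f.
  have U0 : U 0.
    by exists 0; [exact: A0 | apply/ffunP => u; rewrite !ffunE hmap0E].
  have UZ (a : R) f : U f -> U (a *: f).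
    move=> [g Ag <-]; exists (a *: g); first exact: AZ.
    by rewrite -[a *: g]addr0 evP; apply/ffunP => u; rewrite !ffunE hmap0E addr0.
  have UD f f' : U f -> U f' -> U (f + f').
    move=> [g Ag <-] [g' Ag' <-]; exists (g + g'); first exact: AD.
    by have := evP 1 g g'; rewrite !scale1r.
  pose B (f : {ffun K -> X (t + n)}) := forall u, boundary (f u).
  have B0 : B 0 by move=> u; rewrite ffunE; exact: boundary0.
  have BZ (a : R) f : B f -> B (a *: f).
    by move=> Bf u; rewrite ffunE; apply: boundaryZ; exact: Bf.
  have BD f f' : B f -> B f' -> B (f + f').
    by move=> Bf Bf' u; rewrite ffunE; apply: boundaryD.
  have fgU : fg_mod (Submodule U0 UD UZ) (Submodule B0 BD BZ).
    apply: (noetherian_fg_mod (V := fun f : {ffun K -> X (t + n)} =>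
      forall u, cycle (f u))) => /=.
      move=> f [g [cg g0] <-] u; rewrite ffunE; have /hd_cycle cg' := cg.
      by rewrite /cycle (cg' _ _ _ (t - 1)) // g0 ?scaler0 //; lia.
    have [m [z [cz zE]]] := fX (t + n).
    exists (K * 'I_m)%type, (fun p => [ffun u => if u == p.1 then z p.2 else 0]).
    split=> [[u v] w|f cf].
      by rewrite ffunE; case: eqP => _ //; rewrite /cycle linear0.
    have /choice[a aE] : forall u, exists a : 'I_m -> R,
        boundary (f u - \sum_l a l *: z l) by move=> u; exact: zE.
    exists (fun p => a p.1 p.2) => u.
    rewrite !ffunE sum_ffunE.
    rewrite (eq_bigr (fun p => if p.1 == u then a u p.2 *: z p.2 else 0)); last first.
      move=> [v l] _; rewrite !ffunE /= eq_sym.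
      by case: eqVneq => [->|_]; rewrite ?scaler0.
    rewrite -(pair_bigA _ (fun v l => if v == u then a u l *: z l else 0)) /=.
    rewrite (bigD1 u) //= eqxx (big1 (I := K)) ?addr0 // => v /negPf->.
    by rewrite big1.
  have [T2 [h2 [h2U h2E]]] := fgU.
  have /choice[h2' h2'E] : forall k, exists g, A t g /\ ev g = h2 k.
    by move=> k; have [g] := h2U k; exists g.
  exists (T1 + T2)%type, (fun k => match k with inl k => h1 k | inr k => h2' k end).
  split=> [[k|k]|u Au].
  - have [ch1 h10] := h1A k; split=> // i j y it; apply: h10.
    by move: it; rewrite /t; lia.
  - exact: (h2'E k).1.
  have [a2 a2E] : exists a : T2 -> R, B (ev u - \sum_k a k *: h2 k).
    by apply: h2E; exists u.
  pose r := u - \sum_k a2 k *: h2' k.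
  have evr : B (ev r).
    rewrite /r; have -> : ev (u - \sum_k a2 k *: h2' k) = ev u - \sum_k a2 k *: h2 k; last by [].
    have -> : u - \sum_k a2 k *: h2' k = (-1) *: (\sum_k a2 k *: h2' k) + u.
      by rewrite scaleN1r [RHS]addrC.
    rewrite evP scaleN1r [LHS]addrC; congr (_ - _).
    elim/big_rec2: _ => [|k y1 y2 _ <-].
      by apply/ffunP => v; rewrite !ffunE hmap0E.
    by rewrite evP (h2'E k).2.
  have Ar : A t r.
    rewrite /r -scaleN1r; apply: (AD) => //; apply: (AZ).
    by elim/big_ind: _ => [|f g|k _]; [exact: A0|exact: AD|apply: (AZ); exact: (h2'E k).1].
  have /choice[w wE] : forall k, exists w : X (t + n + 1),
      diff X (t + n + 1) (t + n) w = r t (t + n) (x k).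
    by move=> k; have := evr k; rewrite ffunE; exact: boundary_at.
  have lin : linear (fun v => \sum_k xi k v *: w k).
    move=> c v v'; rewrite scaler_sumr -big_split; apply: eq_bigr => k _ /=.
    by rewrite linearP scalerDl scalerA.
  pose s : Hom P X (n + 1) := hsingle (esym (addrA t n 1)) (mklin lin).
  have As : A (T + 1 - d%:Z) (r - diff (Hom P X) (n + 1) n s).
    split=> [|i j v it].
      by apply: cycleB; [exact: Ar.1 | rewrite /cycle diff_diff].
    rewrite hmapBE; have [e|e] := eqVneq j (i + n); last by rewrite !hmap_shape ?subr0.
    rewrite (@hdE _ _ _ _ _ _ _ (j + 1) (i - 1)) ?addrK //.
    have -> : s (i - 1) j (diff P i (i - 1) v) = 0.
      by rewrite hsingleE [tr t _]tr0 ?linear0 //; move: it; rewrite /t; lia.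
    rewrite scaler0 subr0; have [ti|ti] := eqVneq t i.
      subst i j; rewrite hsingleE !trE.
      have -> : mklin lin v = \sum_k xi k v *: w k by [].
      rewrite linear_sum [X in r _ _ X]xiE hmap_sum.
      by rewrite -sumrB big1 // => k _; rewrite hmapZr linearZ /= wE subrr.
    rewrite hsingleE [tr t _]tr0 // !linear0 Ar.2 ?addr0 //.
    by move: ti it; rewrite /t; lia.
  have [a1 a1E] := h1E _ As.
  exists (fun k => match k with inl k => a1 k | inr k => a2 k end).
  rewrite big_sumType /=.
  have -> : u - (\sum_k a1 k *: h1 k + \sum_k a2 k *: h2' k) =
    (r - diff (Hom P X) (n + 1) n s - \sum_k a1 k *: h1 k)
      + diff (Hom P X) (n + 1) n s.
    by rewrite addrAC subrK /r opprD addrA addrAC.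
  by apply: boundaryD => //; exact: boundaryI.
have [a Pa0] := Pa; have [T1 [h [hA hE]]] := claim `|(T + 1 - a)%R|%N.
exists T1, h; split=> [k|u cu]; first by have [] := hA k.
apply: hE; split=> // i j x it; rewrite (Pa0 _ x) ?hmap_x0 //; lia.
Qed.

Lemma unit_of_maximal (s : R) :
  (forall m : {pred R}, maximal_ideal m -> s \notin m) -> exists r, r * s = 1.
Proof.
move=> h; apply: contrapT => nex.
pose z : ideal R := zero_submodule R^o.
have h1 : ~ ideal_add z s 1.
  move=> [r /= /eqP]; rewrite subr_eq0 => /eqP e; apply: nex; by exists r.
have [m mm sm] := proper_sub_maximal nR h1.
by have /negP := h m mm; apply; apply: sm; exact: ideal_add_mem.
Qed.

Lemma homology_nakayama (X : complex R) n (a : ideal R) :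
  homology_fin_gen X n ->
  (forall z : X n, cycle z -> exists (x : R) z', [/\ a x, cycle z' & boundary (z - x *: z')]) ->
  exists2 s, a (s - 1) & forall z : X n, cycle z -> boundary (s *: z).
Proof.
move=> [k [g [cg gE]]] h.
have [l|s as1 sg] := @nakayama R (X n) a (boundary_sub X n) k g.
  have [x [z' [ax cz' bz]]] := h _ (cg l); have [c cE] := gE _ cz'.
  exists (fun j => x * c j) => [j|]; first exact: idealMr.
  apply: (boundary_trans bz); rewrite (eq_bigr (fun j => x *: (c j *: g j))); last first.
    by move=> j _; rewrite scalerA.
  by rewrite -scaler_sumr -scalerBr; exact: boundaryZ.
exists s => // z cz; have [c cE] := gE z cz.
rewrite -[z](subrK (\sum_l c l *: g l)) scalerDr; apply: boundaryD.
  exact: boundaryZ.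
rewrite scaler_sumr; apply: boundary_sum => l.
by rewrite scalerA mulrC -scalerA; apply: boundaryZ; exact: sg.
Qed.
End FinitelyGenerated.

(** * Shifts *)

Section Shift.
Context (R : comNzRingType).
Implicit Types X A : complex R.

Definition shift_term X (s n : int) : lmodType R := X (n + s).
Fact shift_linear X s i j :
  linear (fun x : shift_term X s i => sg s *: diff X (i + s) (j + s) x : shift_term X s j).
Proof. by move=> a x y; rewrite linearP scalerDr !scalerA mulrC. Qed.
Program Definition shift X s : complex R :=
  @Complex R (shift_term X s) (fun i j => mklin (@shift_linear X s i j)) _ _.
Next Obligation.
by rewrite /= diff_shape ?scaler0 //; apply/eqP => E; case/eqP: H; lia.
Qed.
Next Obligation. by rewrite /= linearZ /= diff_diff !scaler0. Qed.

Lemma shiftE X s i j (x : shift X s i) :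
  diff (shift X s) i j x = sg s *: diff X (i + s) (j + s) x.
Proof. by []. Qed.

Lemma sg_scale0 (V : lmodType R) s (v : V) : sg s *: v = 0 -> v = 0.
Proof.
by move=> e; rewrite -[v]scale1r -(sgK _ s) -scalerA e scaler0.
Qed.

Lemma cycle_shift X s n (x : shift X s n) :
  cycle x <-> cycle (x : X (n + s)).
Proof.
have e : n - 1 + s = n + s - 1 by lia.
split=> c; last by rewrite /cycle shiftE cycleE // scaler0.
by have := sg_scale0 c; rewrite /cycle -e.
Qed.

Lemma boundary_shift X s n (x : shift X s n) :
  boundary x <-> boundary (x : X (n + s)).
Proof.
split=> [[y <-]|bx].
  by rewrite shiftE; apply: boundaryZ; exact: boundaryI.
have [|y <-] := @boundary_at _ _ _ (n + 1 + s) (x : X (n + s)) _ bx; first by lia.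
exists (sg s *: (y : shift X s (n + 1))).
by rewrite shiftE linearZ /= scalerA sgK scale1r.
Qed.

Lemma acyc_shift X s n : acyc (shift X s) n <-> acyc X (n + s).
Proof.
split=> h x; first by move/cycle_shift/(h x)/boundary_shift.
by move/cycle_shift/(h x) => bx; apply/boundary_shift.
Qed.

Program Definition hom_shift A X s n (f : Hom A (shift X s) n) :
    shift (Hom A X) s n :=
  @Hmap _ _ _ _ _ _ (fun i j x => tr j (f i (j - s) x : X (j - s + s))) _ _.
Next Obligation. by rewrite hmapD hmapZr linearP. Qed.
Next Obligation.
rewrite hmap_shape; first exact: (linear0 (@tr _ X _ j)).
by apply/eqP => E; case/eqP: H; lia.
Qed.

Lemma hom_shift_hmor A X s : hmor (@hom_shift A X s).
Proof.
apply: hmorI => [n f g|n m f ->].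
  by apply: hmap_eq => i j x; rewrite hmapBE /= [f i _ x - _]hmapBE linearB.
apply: hmap_eqP => i j x jE; rewrite shiftE hmapZE.
rewrite (@hdE _ _ _ _ _ _ _ (j + 1) (i - 1)) //; last by lia.
have hE k l y p (g : Hom A (shift X s) p) :
  hom_shift g k l y = tr l (g k (l - s) y : X (l - s + s)) by [].
rewrite !hE (@hdE _ _ _ _ _ _ _ (j + 1 - s) (i - 1)) //; last by lia.
have trB (a b : R) (u v : X (j - s + s)) :
    tr j (a *: u - b *: v) = a *: tr j u - b *: tr j v by rewrite linearB !linearZ.
rewrite diff_tr ?subrK // shiftE [RHS]trB.
rewrite tr_diff ?subrK // scalerBr scalerA sgD [_ * (_ * _)]mulrC -mulrA sgK mulr1.
by [].
Qed.

Lemma hom_shift_bij A X s n : bijective (@hom_shift A X s n).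
Proof.
have lin (g : Hom A X (n + s)) i j :
    linear (fun x => g i (j + s) x : shift X s j) by move=> a x y; rewrite hmapD hmapZr.
have sh (g : Hom A X (n + s)) i j x : j != i + n -> (g i (j + s) x : shift X s j) = 0.
  move=> e; have h : j + s != i + (n + s) by apply/eqP => E; case/eqP: e; lia.
  exact: (hmap_shape g x h).
exists (fun g : shift (Hom A X) s n => mkhmap (lin g) (sh g) : Hom A (shift X s) n).
  move=> f; apply: hmap_eq => i j x /=.
  by move: (j + s - s) (addrK s j) => k e; subst k; rewrite trE.
by move=> g; apply: hmap_eq => i j x /=; rewrite tr_hmap ?subrK.
Qed.

Lemma acyc_hom_shift A X s n :
  acyc (Hom A (shift X s)) n <-> acyc (Hom A X) (n + s).
Proof.
rewrite -acyc_shift.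
exact: acyc_bij (hom_shift_hmor A X s) (hom_shift_bij A X s) n.
Qed.

Section Unshift.
Context (L C : complex R) (s : int) (f : chain_map L (shift C s)).

Program Definition unshift_hmap : Hom (shift L (- s)) C 0 :=
  @Hmap _ _ _ _ _ _ (fun i j (x : L (i - s)) =>
    tr j (f (i - s) (j - s) x : C (j - s + s))) _ _.
Next Obligation. by rewrite hmapD hmapZr linearP. Qed.
Next Obligation.
rewrite hmap_shape; first exact: (linear0 (@tr _ C _ j)).
by apply/eqP => E; case/eqP: H; lia.
Qed.

Fact unshift_cycle : cycle unshift_hmap.
Proof.
apply/hd_cycle => i j k l x; rewrite addr0 => -> -> ->.
have uE a b y : unshift_hmap a b y = tr b (f (a - s) (b - s) y : C (b - s + s)) by [].
rewrite sg0 scale1r !uE shiftE hmapZr sgN -chain_mapP shiftE.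
rewrite linearZ /= linearZ /= scalerA sgK scale1r tr_diff ?subrK //.
by rewrite diff_tr ?subrK.
Qed.
Definition unshift : chain_map (shift L (- s)) C := mkchain unshift_cycle.

Lemma unshift_qi : quasi_iso f -> quasi_iso unshift.
Proof.
move=> qf n; have e : n - s + s = n by rewrite subrK.
have uE y : unshift n n y = tr n (f (n - s) (n - s) y : C (n - s + s)) by [].
split=> [x cx bx|y cy].
  apply/boundary_shift; apply: (qf (n - s)).1; first by apply/cycle_shift.
  apply/boundary_shift; rewrite -[f _ _ _](trE (X := C)) -(@tr_tr _ C _ n) //.
  by apply: boundary_tr; rewrite -uE.
have cy' : cycle (tr (n - s + s) y : shift C s (n - s)).
  by apply/cycle_shift; apply: cycle_tr.
have [x cx bx] := (qf (n - s)).2 _ cy'.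
exists x; first by apply/cycle_shift.
rewrite uE; have -> : y = tr n (tr (n - s + s) y) by rewrite tr_tr ?trE ?subrK.
by rewrite -linearB; apply: boundary_tr; apply/boundary_shift.
Qed.
End Unshift.
End Shift.

(** * Free resolutions *)

Section FreeResolution.
Context (R : comNzRingType) (nR : noetherian R).

Section NatComplex.
Context (k : nat -> nat) (D : forall n, 'M[R]_(k n.+1, k n)).
Hypothesis DD : forall n, D n.+1 *m D n = 0.

Definition nat_term (z : int) : lmodType R :=
  'rV[R]_(if z is Posz n then k n else 0).

Definition nat_mx (m n : nat) : 'M[R]_(k m, k n) :=
  if @eqP _ m n.+1 is ReflectT e
  then ecast l ('M[R]_(k l, k n)) (esym e) (D n) else 0.

Lemma nat_mxE n : nat_mx n.+1 n = D n.
Proof.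
by rewrite /nat_mx; case: eqP => // e; rewrite (eq_irrelevance e erefl).
Qed.
Lemma nat_mx0 m n : m != n.+1 -> nat_mx m n = 0.
Proof. by rewrite /nat_mx; case: eqP. Qed.

Definition nat_diff (a b : int) : nat_term a -> nat_term b :=
  match a, b return nat_term a -> nat_term b with
  | Posz m, Posz n => fun v => v *m nat_mx m n
  | _, _ => fun _ => 0
  end.
Fact nat_diff_linear a b : linear (@nat_diff a b).
Proof.
case: a b => [m|m] [n|n] c x y /=; rewrite ?scaler0 ?addr0 //.
by rewrite mulmxDl scalemxAl.
Qed.
Program Definition nat_complex : complex R :=
  @Complex R nat_term (fun a b => mklin (@nat_diff_linear a b)) _ _.
Next Obligation.
case: i j x H => [m|m] [n|n] x H //=.
by rewrite nat_mx0 ?mulmx0 //; apply/eqP => E; case/eqP: H; rewrite E; lia.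
Qed.
Next Obligation.
case: i j k0 x => [m|m] [n|n] [l|l] x //=; rewrite ?mul0mx //.
have [e|e] := eqVneq m n.+1; last by rewrite [nat_mx m n]nat_mx0 // mulmx0 mul0mx.
have [e'|e'] := eqVneq n l.+1; last by rewrite [nat_mx n l]nat_mx0 // mulmx0.
by subst n m; rewrite !nat_mxE -mulmxA DD mulmx0.
Qed.

Context (C : complex R) (f : forall n, {linear 'rV[R]_(k n) -> C n%:Z}).
Hypothesis fD : forall n (v : 'rV[R]_(k n.+1)),
  diff C n.+1%:Z n%:Z (f n.+1 v) = f n (v *m D n).
Hypothesis f0 : forall v, cycle (f 0 v).

Definition nat_map (a b : int) : nat_term a -> C b :=
  match a return nat_term a -> C b with
  | Posz m => fun v => tr b (f m v)
  | _ => fun _ => 0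
  end.
Program Definition nat_hmap : Hom nat_complex C 0 :=
  @Hmap _ _ _ _ _ _ nat_map _ _.
Next Obligation.
by case: i x y => [m|m] x y /=; rewrite ?linearP // scaler0 addr0.
Qed.
Next Obligation.
by move: x H; case: i => [m|m] x H //=; rewrite tr0 //; rewrite addr0 in H.
Qed.
Fact nat_map_cycle : cycle nat_hmap.
Proof.
apply/hd_cycle => i j l p x; rewrite addr0 sg0 scale1r => -> -> ->.
case: i x => [[|n]|m] x.
- by rewrite /= trE; rewrite (f0 x).
- have -> : Posz n.+1 - 1 = n%:Z by lia.
  by rewrite /= !trE fD nat_mxE.
- by have -> : x = 0 by [exact: thinmx0]; rewrite !(linear0, hmap_x0).
Qed.
Definition nat_chain : chain_map nat_complex C := mkchain nat_map_cycle.

Hypothesis inj : forall n (z : 'rV[R]_(k n.+1)), z *m D n = 0 ->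
  boundary (f n.+1 z) -> exists v, z = v *m D n.+1.
Hypothesis surj : forall n (c : C n.+1%:Z), cycle c ->
  exists2 v : 'rV[R]_(k n.+1), v *m D n = 0 & boundary (c - f n.+1 v).
Hypothesis k0 : k 0 = 0%N.
Hypothesis C0 : forall i : int, i <= 0 -> acyc C i.

Lemma nat_chain_qi : quasi_iso nat_chain.
Proof.
have t0 (i : int) (x : nat_complex i) : i <= 0 -> x = 0.
  case: i x => [[|n]|n] x // _; last exact: thinmx0.
  by apply/rowP => -[m mk]; exfalso; move: mk; rewrite k0.
move=> n; have [n0|] := leP n 0.
  split=> [x _ _|y cy]; first by rewrite (t0 _ x n0); exact: boundary0.
  exists 0; first by rewrite /cycle linear0.
  by rewrite hmap_x0 subr0; exact: C0.
case: n => [[|n]|n] // _; split=> [x cx bx|y cy].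
  have [v vE] : exists v, (x : 'rV_(k n.+1)) = v *m D n.+1.
    apply: inj; last by move: bx; rewrite /= trE.
    have := cycleE n%:Z cx; by rewrite /= nat_mxE.
  have -> : x = diff nat_complex n.+2%:Z n.+1%:Z v by rewrite /= nat_mxE vE.
  exact: boundaryI.
have [v vD bv] := surj cy; exists v; last by rewrite /= trE.
have e : (n.+1%:Z - 1)%R = n%:Z by lia.
by rewrite /cycle e /= nat_mxE.
Qed.
End NatComplex.

Section Construction.
Context (C : complex R) (fC : degreewise_homologically_finite C).
Hypothesis C0 : forall i : int, i <= 0 -> acyc C i.

(** A stage stores the rank of its predecessor as well as its own. Consecutive stages then fit
    together along an equality of ranks, resolved by [ecast] once the whole sequence exists. *)
Record stage (n : nat) := Stage {
  stage_k' : nat; stage_k : nat;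
  stage_D : 'M[R]_(stage_k, stage_k');
  stage_f : {linear 'rV[R]_stage_k -> C n%:Z} }.

(** Two kinds of new generators: [m] of them bound the cycles whose image in [C] is a boundary, for
    injectivity in degree [n]; the other [m'] go to cycles that generate the homology in degree
    [n + 1], for surjectivity there. *)
Lemma next_stage n (s : stage n) :
  exists (k : nat) (D : 'M[R]_(k, stage_k s)) (f : {linear 'rV[R]_k -> C n.+1%:Z}),
  [/\ D *m stage_D s = 0,
      forall v, diff C n.+1%:Z n%:Z (f v) = stage_f s (v *m D),
      forall z, z *m stage_D s = 0 -> boundary (stage_f s z) -> exists v, z = v *m D &
      forall c : C n.+1%:Z, cycle c -> exists2 v, v *m D = 0 & boundary (c - f v)].
Proof.
case: s => k' k D f /=.
pose U (z : 'rV[R]_k) := z *m D = 0 /\ boundary (f z).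
have U0 : U 0 by rewrite /U mul0mx linear0; split=> //; exact: boundary0.
have UD x y : U x -> U y -> U (x + y).
  by move=> [x1 x2] [y1 y2]; rewrite /U mulmxDl x1 y1 addr0 linearD; split=> //; exact: boundaryD.
have UZ (a : R) x : U x -> U (a *: x).
  by move=> [x1 x2]; rewrite /U -scalemxAl x1 scaler0 linearZ; split=> //; exact: boundaryZ.
have [m [z [zU zE]]] := noetherian_row nR (Submodule U0 UD UZ).
have /choice[c cE] : forall l, exists c : C n.+1%:Z, diff C n.+1%:Z n%:Z c = f (z l).
  by move=> l; apply: boundary_at (zU l).2; lia.
have [m' [c' [cc' c'E]]] := fC n.+1%:Z.
pose F (v : 'rV[R]_(m + m')) := \sum_l v 0 (lshift m' l) *: c l
  + \sum_l v 0 (rshift m l) *: c' l.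
have Flin : linear F.
  move=> a u v; rewrite /F scalerDr addrACA; congr (_ + _);
  rewrite scaler_sumr -big_split; apply: eq_bigr => l _ /=;
  by rewrite !mxE scalerDl scalerA.
have FE v : mklin Flin v = F v by [].
pose Z := \matrix_(l < m) z l.
have ZE (v : 'rV[R]_m) : v *m Z = \sum_l v 0 l *: z l.
  by rewrite mulmx_sum_row; apply: eq_bigr => l _; rewrite rowK.
have sp (v : 'rV[R]_(m + m')) : v *m col_mx Z 0 = \sum_l v 0 (lshift m' l) *: z l.
  rewrite -{1}[v]hsubmxK mul_row_col mulmx0 addr0 ZE.
  by apply: eq_bigr => l _; rewrite mxE.
exists (m + m')%N, (col_mx Z 0), (mklin Flin); split.
- have ZD : Z *m D = 0.
    by apply/row_matrixP => l; rewrite row_mul rowK (zU l).1 row0.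
  by rewrite mul_col_mx mul0mx ZD col_mx0.
- move=> v; rewrite sp FE /F linearD !linear_sum /=.
  rewrite [X in _ + X]big1 ?addr0 => [|l _]; last first.
    by rewrite linearZ /= (cycleE _ (cc' l)) scaler0.
  by apply: eq_bigr => l _; rewrite !linearZ /= cE.
- move=> y y1 y2; have [a aE] := zE y (conj y1 y2).
  exists (row_mx (\row_l a l) 0); rewrite mul_row_col mul0mx addr0 ZE aE.
  by apply: eq_bigr => l _; rewrite mxE.
- move=> d cd; have [a aE] := c'E d cd.
  exists (row_mx 0 (\row_l a l)).
    by rewrite mul_row_col mul0mx mulmx0 addr0.
  rewrite FE /F big1 ?add0r => [|l _]; last first.
    by rewrite row_mxEl mxE scale0r.
  rewrite (eq_bigr (fun l => a l *: c' l)) // => l _.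
  by rewrite row_mxEr mxE.
Qed.

Let nxt n (s : stage n) : {s' : stage n.+1 | exists e : stage_k' s' = stage_k s,
  let D := ecast l ('M[R]_(stage_k s', l)) e (stage_D s') in
  [/\ D *m stage_D s = 0,
      forall v, diff C n.+1%:Z n%:Z (stage_f s' v) = stage_f s (v *m D),
      forall z, z *m stage_D s = 0 -> boundary (stage_f s z) -> exists v, z = v *m D &
      forall c : C n.+1%:Z, cycle c ->
        exists2 v, v *m D = 0 & boundary (c - stage_f s' v)]}.
Proof.
apply: cid; have [k [D [f h]]] := next_stage s.
by exists (Stage D f), erefl.
Qed.

Let st n : stage n := nat_rect stage
  (@Stage 0 0 0 0 \0) (fun n s => sval (nxt s)) n.

Lemma free_resolution0 : exists (L : complex R) (f : chain_map L C),
  [/\ forall l, fgproj (L l), forall (l : int) (x : L l), l <= 0 -> x = 0 &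
      quasi_iso f].
Proof.
pose e n := projT1 (cid (svalP (nxt (st n)))).
have eP n := projT2 (cid (svalP (nxt (st n)))).
pose k n := stage_k (st n).
pose D n : 'M[R]_(k n.+1, k n) :=
  ecast l ('M[R]_(stage_k (st n.+1), l)) (e n) (stage_D (st n.+1)).
pose f n : {linear 'rV[R]_(k n) -> C n%:Z} := stage_f (st n).
have castP n m (z : 'rV[R]_m) (w : nat) (M : 'M[R]_(m, w)) (E : w = n) :
    z *m (ecast l ('M[R]_(m, l)) E M) = 0 <-> z *m M = 0 by case: n / E.
have castM n m p (z : 'M[R]_(p, m)) (w : nat) (M : 'M[R]_(m, w)) (E : w = n) :
    z *m (ecast l ('M[R]_(m, l)) E M) = 0 <-> z *m M = 0 by case: n / E.
have DD n : D n.+1 *m D n = 0.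
  by apply/castM; have [] := eP n.+1.
have fD n (v : 'rV[R]_(k n.+1)) : diff C n.+1%:Z n%:Z (f n.+1 v) = f n (v *m D n).
  by have [] := eP n.
have f0 v : cycle (f 0%N v) by rewrite /f /= /cycle linear0.
exists (nat_complex DD), (nat_chain DD fD f0); split.
- by move=> l; exact: fgproj_row.
- by move=> [[|n]|n] x // _; exact: thinmx0.
apply: nat_chain_qi => // [n z zD bz|n c cc].
  by have [_ _ h _] := eP n.+1; apply: h => //; apply: (castP _ _ _ _ _ (e n)).1 zD.
by have [_ _ _ h] := eP n; exact: h.
Qed.
End Construction.

Lemma free_resolution (C : complex R) (a : int) :
  degreewise_homologically_finite C -> (forall i, i < a -> acyc C i) ->
  exists (L : complex R) (f : chain_map L C),
  [/\ forall l, fgproj (L l), forall (l : int) (x : L l), l < a -> x = 0 &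
      quasi_iso f].
Proof.
(* The construction over the natural numbers is zero in degree 0, so a shift by [a - 1] puts its
   first generators in degree [a]. *)
move=> fC C0; pose s := a - 1.
have fC' : degreewise_homologically_finite (shift C s).
  move=> n; have [k [g [cg gE]]] := fC (n + s).
  exists k, g; split=> [l|z cz]; first by apply/cycle_shift; exact: cg.
  have [c cE] := gE z ((cycle_shift z).1 cz); exists c.
  by apply/boundary_shift; exact: cE.
have C0' i : i <= 0 -> acyc (shift C s) i.
  by move=> i0; apply/acyc_shift; apply: C0; rewrite /s; lia.
have [L [f [fgL L0 qf]]] := free_resolution0 fC' C0'.
exists (shift L (- s)), (unshift f); split.
- by move=> l; exact: fgL.
- by move=> l x la; apply: (L0 (l - s)); rewrite /s; lia.
exact: unshift_qi.
Qed.
End FreeResolution.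

(** * Flatness and finite projective resolutions *)

Definition mkbilinear (R : comNzRingType) (M N T : lmodType R) (f : M -> N -> T)
    (h : bilinear_for *:%R *:%R f) : {bilinear M -> N -> T} :=
  HB.pack f (bilinear_isBilinear.Build R M N T *:%R *:%R f h).

Section EquationalFlatness.
Context (R : comNzRingType).

Definition mxact (V : lmodType R) m n (b : 'M[R]_(m, n)) (y : 'I_n -> V) (i : 'I_m) : V :=
  \sum_j b i j *: y j.

Lemma mxactM (V : lmodType R) m n p (b : 'M[R]_(m, n)) (c : 'M[R]_(n, p))
    (z : 'I_p -> V) i : mxact (b *m c) z i = mxact b (mxact c z) i.
Proof.
rewrite /mxact (eq_bigr (fun l => \sum_j (b i j * c j l) *: z l)); last first.
  by move=> l _; rewrite mxE scaler_suml.
rewrite exchange_big; apply: eq_bigr => j _; rewrite scaler_sumr.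
by apply: eq_bigr => l _; rewrite scalerA.
Qed.

Lemma mxact_linear (V W : lmodType R) (f : {linear V -> W}) m n (b : 'M[R]_(m, n)) y i :
  f (mxact b y i) = mxact b (fun j => f (y j)) i.
Proof. by rewrite linear_sum; apply: eq_bigr => j _; rewrite linearZ. Qed.

(* The equational criterion: every linear relation is a consequence of relations
   among the coefficients. *)
Definition eflat (V : lmodType R) (U : submodule V) : Prop :=
  forall k (a : 'rV[R]_k) (x : 'I_k -> V), (forall i, U (x i)) -> mxact a x 0 = 0 ->
  exists m (b : 'M[R]_(k, m)) (y : 'I_m -> V),
    [/\ forall j, U (y j), forall i, x i = mxact b y i & a *m b = 0].

(** Induction on the number of rows: once the lower rows are trivialized, the top row becomes a
    single relation among the new elements [y]. *)
Lemma eflat_system (V : lmodType R) (U : submodule V) : eflat U ->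
  forall q k (a : 'M[R]_(q, k)) (x : 'I_k -> V), (forall i, U (x i)) ->
  (forall r, mxact a x r = 0) ->
  exists m (b : 'M[R]_(k, m)) (y : 'I_m -> V),
    [/\ forall j, U (y j), forall i, x i = mxact b y i & a *m b = 0].
Proof.
move=> fU; elim=> [|q IH] k a x Ux ax.
  exists k, 1%:M, x; split=> // [i|]; last exact: flatmx0.
  rewrite /mxact (bigD1 i) //= mxE eqxx scale1r big1 ?addr0 // => j ji.
  by rewrite mxE eq_sym (negPf ji) scale0r.
have axd r : mxact (dsubmx (a : 'M_(1 + q, k))) x r = 0.
  by rewrite -[RHS](ax (rshift 1 r)); apply: eq_bigr => j _; rewrite mxE.
have [m [b [y [Uy xE ab]]]] := IH k _ x Ux axd.
have e0 : mxact (usubmx (a : 'M_(1 + q, k)) *m b) y 0 = 0.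
  rewrite mxactM -[RHS](ax (lshift q (0 : 'I_1))); apply: eq_bigr => j _.
  by rewrite -xE mxE.
have [n [c [z [Uz yE abc]]]] := fU _ _ _ Uy e0.
exists n, (b *m c), z; split=> // [i|].
  by rewrite xE mxactM; apply: eq_bigr => j _; rewrite yE.
rewrite mulmxA; apply/row_matrixP => r; rewrite row0.
case: (split_ordP (r : 'I_(1 + q))) => s ->.
  transitivity (row s (usubmx (a : 'M_(1 + q, k)) *m b *m c)).
    by rewrite !row_mul row_usubmx.
  by rewrite abc row0.
transitivity (row s (dsubmx (a : 'M_(1 + q, k)) *m b *m c)).
  by rewrite !row_mul row_dsubmx.
by rewrite ab mul0mx row0.
Qed.

(** Let [K] be the module of row vectors annihilated by [a]. The quotient of the free module by [K]
    embeds in [R] through [a], so by flatness its tensor product with [M] embeds in [M]. That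
    product is realized as the [k]-tuples of [M] modulo the module [N] of tuples [b y] with
    [a b = 0]. The class of [x] goes to the given relation, which is zero; hence [x] lies in [N],
    and this is the criterion. *)
Lemma flat_eflat (M : lmodType R) : flat M -> eflat (full_submodule M).
Proof.
move=> fM k a x _ ax.
have K0 : (0 : 'rV[R]_k) *m a^T = 0 by rewrite mul0mx.
have KD (u v : 'rV[R]_k) : u *m a^T = 0 -> v *m a^T = 0 -> (u + v) *m a^T = 0.
  by rewrite mulmxDl => -> ->; rewrite addr0.
have KZ (c : R) (u : 'rV[R]_k) : u *m a^T = 0 -> (c *: u) *m a^T = 0.
  by rewrite -scalemxAl => ->; rewrite scaler0.
pose K := @Submodule R 'rV[R]_k (fun v => v *m a^T = 0) K0 KD KZ.
pose MK (w : {ffun 'I_k -> M}) := exists m (b : 'M[R]_(k, m)) (y : 'I_m -> M),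
  a *m b = 0 /\ forall i, w i = mxact b y i.
have MK0 : MK 0.
  exists 0%N, 0, (fun _ => 0); rewrite mulmx0; split=> // i.
  by rewrite /mxact big_ord0 ffunE.
have MKD u v : MK u -> MK v -> MK (u + v).
  move=> [m [b [y [ab uE]]]] [n [c [z [ac vE]]]].
  exists (m + n)%N, (row_mx b c),
    (fun l => match fintype.split l with inl j => y j | inr j => z j end).
  rewrite mul_mx_row ab ac row_mx0; split=> // i.
  rewrite ffunE uE vE /mxact big_split_ord; congr (_ + _); apply: eq_bigr => j _.
    by rewrite row_mxEl (unsplitK (inl _ j)).
  by rewrite row_mxEr (unsplitK (inr _ j)).
have MKZ (c : R) u : MK u -> MK (c *: u).
  move=> [m [b [y [ab uE]]]]; exists m, b, (fun j => c *: y j); split=> // i.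
  rewrite ffunE uE scaler_sumr; apply: eq_bigr => j _.
  by rewrite !scalerA mulrC.
pose N := Submodule MK0 MKD MKZ.
pose T := quo_type N; pose Q := quo_type K.
pose ten (m : M) (v : 'rV[R]_k) : {ffun 'I_k -> M} := [ffun i => v 0 i *: m].
have tenK m v : K v -> N (ten m v).
  move=> Kv; exists 1%N, v^T, (fun _ => m); split.
    by rewrite -[a]trmxK -trmx_mul Kv trmx0.
  by move=> i; rewrite ffunE /mxact big_ord1 mxE.
have tenDl c m m' v : ten (c *: m + m') v = c *: ten m v + ten m' v.
  by apply/ffunP => i; rewrite !ffunE scalerDr !scalerA mulrC.
have tenDr c m v v' : ten m (c *: v + v') = c *: ten m v + ten m v'.
  by apply/ffunP => i; rewrite !ffunE !mxE scalerDl scalerA.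
pose t0 (m : M) (q : Q) : T := cls N (ten m (repr_cls q)).
have t0E m v : t0 m (cls K v) = cls N (ten m v).
  apply/clsP; have -> : ten m (repr_cls (cls K v)) - ten m v =
      ten m (repr_cls (cls K v) - v).
    by apply/ffunP => i; rewrite !ffunE !mxE scalerBl.
  apply: tenK; exact: repr_clsP.
have t0b : bilinear_for *:%R *:%R t0.
  split=> [q|m] c; last first.
    move=> p q; have [[u ->] [v ->]] := (cls_surj p, cls_surj q).
    by rewrite -linearP !t0E tenDr linearP.
  by move=> m m'; have [u ->] := cls_surj q; rewrite !t0E tenDl linearP.
pose t := mkbilinear t0b.
have scb : bilinear_for *:%R *:%R (fun (m : M) (r : R^o) => (r : R) *: m).
  split=> [r c m m'|m c r r'].
    by rewrite scalerDr scalerA [r * c]mulrC -scalerA.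
  by rewrite scalerDl -scalerA.
pose t' := mkbilinear scb.
(* A bilinear map is determined by its values against the unit vectors [e i]. The induced map
   vanishes on [N] because the columns of the matrix [c] represent zero in [Q]. *)
have tens_t : is_tensor t.
  move=> U b; pose e (i : 'I_k) : Q := cls K (delta_mx 0 i).
  pose F (w : {ffun 'I_k -> M}) := \sum_i b (w i) (e i).
  have Flin : linear F.
    move=> c u v; rewrite scaler_sumr -big_split; apply: eq_bigr => i _ /=.
    by rewrite !ffunE linearPl.
  have FN u : N u -> F u = 0.
    move=> [m [c [y [ac uE]]]]; rewrite /F.
    rewrite (eq_bigr (fun i => \sum_j b (y j) (c i j *: e i))); last first.
      move=> i _; rewrite uE linear_sumlz; apply: eq_bigr => j _.
      by rewrite linearZl_LR linearZr_LR.
    rewrite exchange_big big1 // => j _; rewrite -linear_sumr.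
    have -> : \sum_i c i j *: e i = 0; last by rewrite linear0r.
    rewrite (eq_bigr (fun i => cls K (c i j *: delta_mx 0 i))); last first.
      by move=> i _; rewrite linearZ.
    rewrite -linear_sum -[RHS](linear0 (cls K)); apply/clsP; rewrite subr0 /=.
    have -> : \sum_i c i j *: delta_mx 0 i = (col j c)^T.
      rewrite [RHS]row_sum_delta; apply: eq_bigr => i _; by rewrite !mxE.
    rewrite -trmx_mul; have -> : a *m col j c = col j (a *m c).
      by apply/matrixP => p q; rewrite !mxE; apply: eq_bigr => l _; rewrite !mxE.
    by rewrite ac; apply/matrixP => p q; rewrite !mxE.
  pose f0 (q : T) := F (repr_cls q).
  have f0E w : f0 (cls N w) = F w.
    apply/eqP; rewrite -subr_eq0 -(linearB (mklin Flin)); apply/eqP.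
    by apply: FN; exact: (repr_clsP N w).
  have f0lin : linear f0.
    move=> c p q; have [[u ->] [v ->]] := (cls_surj p, cls_surj q).
    by rewrite -linearP !f0E Flin.
  exists (mklin f0lin) => [m q|g gE q].
    have [v ->] := cls_surj q; rewrite /= t0E f0E /F.
    rewrite (eq_bigr (fun i => b m (v 0 i *: e i))); last first.
      by move=> i _; rewrite ffunE linearZl_LR linearZr_LR.
    rewrite -linear_sumr; congr (b m _).
    rewrite [in RHS](row_sum_delta v) linear_sum; apply: eq_bigr => i _.
    by rewrite linearZ.
  have [w ->] := cls_surj q; rewrite /= f0E /F.
  have wE : w = \sum_i ten (w i) (delta_mx 0 i).
    apply/ffunP => i; rewrite sum_ffunE (bigD1 i) //= ffunE mxE !eqxx scale1r.
    rewrite big1 ?addr0 // => j ji; by rewrite ffunE mxE eq_sym (negPf ji) scale0r.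
  rewrite {1}wE !linear_sum; apply: eq_bigr => i _.
  by rewrite -gE /= t0E.
have tens_t' : is_tensor t'.
  move=> U b; have lin : linear (fun m : M => b m (1 : R^o)).
    by move=> c u v; rewrite linearPl.
  exists (mklin lin) => [m n|g gE m] /=.
    by rewrite linearZl_LR -linearZr_LR; congr (b m _); exact: mulr1.
  by rewrite -gE /= scale1r.
have aflin : linear (fun q : Q => (repr_cls q *m a^T) 0 0 : R^o).
  move=> c p q; have [[u ->] [v ->]] := (cls_surj p, cls_surj q).
  have afE z : repr_cls (cls K z) *m a^T = z *m a^T.
    by apply/eqP; rewrite -subr_eq0 -mulmxBl; apply/eqP; exact: (repr_clsP K z).
  by rewrite -linearP !afE mulmxDl -scalemxAl !mxE.
pose af := mklin aflin.
have afE z : af (cls K z) = (z *m a^T) 0 0.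
  congr (fun M : 'M[R]_1 => M 0 0); apply/eqP; rewrite -subr_eq0 -mulmxBl.
  by apply/eqP; exact: (repr_clsP K z).
have afi : injective af.
  move=> p q; have [[u ->] [v ->]] := (cls_surj p, cls_surj q).
  rewrite !afE => e; apply/clsP; rewrite /= mulmxBl; apply/eqP; rewrite subr_eq0.
  by apply/eqP/matrixP => i j; rewrite !ord1.
pose G (w : {ffun 'I_k -> M}) := mxact a w 0.
have Glin : linear G.
  move=> c u v; rewrite scaler_sumr -big_split; apply: eq_bigr => i _ /=.
  by rewrite !ffunE scalerDr !scalerA mulrC.
have GN u : N u -> G u = 0.
  move=> [m [b [y [ab uE]]]].
  rewrite /G /mxact (eq_bigr (fun i => a 0 i *: mxact b y i)); last first.
    by move=> i _; rewrite uE.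
  by rewrite -[LHS]/(mxact a (mxact b y) 0) -mxactM ab /mxact big1 // => j _;
    rewrite mxE scale0r.
have GE w : G (repr_cls (cls N w)) = G w.
  apply/eqP; rewrite -subr_eq0 -(linearB (mklin Glin)); apply/eqP.
  by apply: GN; exact: (repr_clsP N w).
have gl : linear (fun q : T => G (repr_cls q)).
  move=> c p q; have [[u ->] [v ->]] := (cls_surj p, cls_surj q).
  by rewrite -linearP !GE Glin.
have gi := fM _ _ af afi _ _ t t' tens_t tens_t' (mklin gl).
have : cls N [ffun i => x i] = 0.
  apply: gi => [m q|].
    have [v ->] := cls_surj q; rewrite afE /= t0E GE /G /mxact mxE scaler_suml.
    by apply: eq_bigr => i _; rewrite ffunE scalerA mxE mulrC.
  rewrite linear0 /= GE -[RHS]ax; apply: eq_bigr => i _; by rewrite ffunE.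
rewrite -[RHS](linear0 (cls N)) => /clsP; rewrite subr0 => -[m [b [y [ab xE]]]].
by exists m, b, y; split=> // i; rewrite -xE ffunE.
Qed.
End EquationalFlatness.

Section FlatResolutions.
Context (R : comNzRingType).

Lemma fgproj_eflat (V : lmodType R) : fgproj V -> eflat (full_submodule V).
Proof.
move=> [T [x [xi xiE]]] k a y _ ay.
exists #|T|, (\matrix_(i, j) xi (enum_val j) (y i)), (fun j => x (enum_val j)).
split=> // [i|].
  rewrite [LHS]xiE (reindex (@enum_val T predT)); last first.
    by apply: onW_bij; exact: enum_val_bij.
  by apply: eq_bigr => j _; rewrite mxE.
apply/rowP => j; rewrite !mxE.
rewrite (eq_bigr (fun i => xi (enum_val j) (a 0 i *: y i))); last first.
  by move=> i _; rewrite linearZ mxE.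
by rewrite -linear_sum [X in xi _ X]ay linear0.
Qed.

Lemma eflat_pair (V W : lmodType R) : eflat (full_submodule V) ->
  eflat (full_submodule W) -> eflat (full_submodule (V * W)%type).
Proof.
move=> fV fW k a x _ ax.
have [||m [b [y [_ yE ab]]]] := fV k a (fun i => (x i).1) => //.
  by rewrite -(mxact_linear fst) ax.
have [||n [c [z [_ zE ac]]]] := fW k a (fun i => (x i).2) => //.
  by rewrite -(mxact_linear snd) ax.
exists (m + n)%N, (row_mx b c),
  (fun l => match fintype.split l with inl j => (y j, 0) | inr j => (0, z j) end).
split=> // [i|]; last by rewrite mul_mx_row ab ac row_mx0.
rewrite /mxact big_split_ord /=.
rewrite (eq_bigr (fun j => (b i j *: y j, 0))); last first.
  by move=> j _; rewrite row_mxEl (unsplitK (inl _ j)); congr pair; rewrite /= scaler0.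
rewrite [X in _ + X](eq_bigr (fun j => (0, c i j *: z j))); last first.
  by move=> j _; rewrite row_mxEr (unsplitK (inr _ j)); congr pair; rewrite /= scaler0.
rewrite [LHS]surjective_pairing yE zE /mxact; congr pair => /=.
  rewrite -[LHS]addr0; congr (_ + _); first by rewrite (linear_sum fst).
  by rewrite (linear_sum fst) big1.
rewrite -[LHS]add0r; congr (_ + _); last by rewrite (linear_sum snd).
by rewrite (linear_sum snd) big1.
Qed.

(** Induction upwards from the range where [X] vanishes. Solve the relation in [X l]; the
    differentials of the new elements satisfy relations among cycles of degree [l - 1], and lifting
    a solution of those through the exact complex corrects the new elements into cycles. *)
Lemma eflat_cycles (X : complex R) (a : int) :
  (forall l (x : X l), l < a -> x = 0) -> (forall n, acyc X n) ->
  (forall l, eflat (full_submodule (X l))) -> forall n, eflat (cycle_sub X n).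
Proof.
move=> Xa aX fX n.
have small l : l < a -> eflat (cycle_sub X l).
  move=> la k c x _ _; exists 0%N, 0, (fun _ => 0); rewrite mulmx0.
  split=> // [[]//|i]; by rewrite (Xa _ (x i) la) /mxact big_ord0.
have step l : eflat (cycle_sub X (l - 1)) -> eflat (cycle_sub X l).
  move=> fl k c x cx xc.
  have [//|m [b [y [_ xE cb]]]] := fX l k c x _ xc.
  have e0 i : mxact b (fun j => diff X l (l - 1) (y j)) i = 0.
    by rewrite -(mxact_linear (diff X l (l - 1))) -xE; exact: cx.
  have [|n' [d [z [cz yE bd]]]] := eflat_system fl _ e0.
    by move=> i; rewrite /= /cycle diff_diff.
  have /choice[w wE] : forall j, exists w : X l, diff X l (l - 1) w = z j.
    by move=> j; apply: boundary_at (aX _ _ (cz j)); rewrite subrK.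
  exists m, b, (fun j => y j - mxact d w j); split=> // [j|i].
    rewrite /= /cycle linearB /= mxact_linear yE /mxact; apply/eqP.
    by rewrite subr_eq0; apply/eqP; apply: eq_bigr => p _; rewrite wE.
  rewrite xE /mxact -[LHS]subr0.
  rewrite [RHS](eq_bigr (fun j => b i j *: y j - b i j *: mxact d w j)); last first.
    by move=> j _; rewrite scalerBr.
  rewrite sumrB; congr (_ - _).
  by rewrite -[RHS]/(mxact b (mxact d w) i) -mxactM bd /mxact big1 // => j _;
    rewrite mxE scale0r.
have [na|an] := ltP n a; first exact: small.
have -> : n = a - 1 + (`|(n - (a - 1))%R|%N)%:Z by lia.
elim: `|_|%N => [|d IH]; first by rewrite addr0; apply: small; lia.
apply: step; have -> // : a - 1 + d.+1%:Z - 1 = a - 1 + d%:Z by lia.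
Qed.

(** Finitely presented and flat gives projective. Finitely many relations generate all relations
    among the [g i], and flatness writes [g = b y] with every relation killed by [b]. So if [u] has
    coefficients [c] in terms of [g], the vector [c b] depends on [u] only and provides coordinates
    with respect to [y]. *)
Lemma eflat_fgproj (nR : noetherian R) (V : lmodType R) (U : submodule V) k
    (g : 'I_k -> V) : eflat U -> (forall i, U (g i)) ->
  (forall u, U u -> exists a : 'I_k -> R, u = \sum_l a l *: g l) ->
  fgproj (sub_type U).
Proof.
move=> fU gU gE.
have K0 : mxact (0 : 'rV[R]_k) g 0 = 0.
  by rewrite /mxact big1 // => j _; rewrite mxE scale0r.
have KD (u v : 'rV[R]_k) : mxact u g 0 = 0 -> mxact v g 0 = 0 ->
    mxact (u + v) g 0 = 0.
  move=> u0 v0; rewrite -[RHS]addr0 -{1}u0 -v0 -big_split.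
  by apply: eq_bigr => j _; rewrite mxE scalerDl.
have KZ (c : R) (u : 'rV[R]_k) : mxact u g 0 = 0 -> mxact (c *: u) g 0 = 0.
  move=> u0; rewrite -[RHS](scaler0 _ c) -u0 scaler_sumr.
  by apply: eq_bigr => j _; rewrite mxE scalerA.
pose K := @Submodule R 'rV[R]_k (fun v => mxact v g 0 = 0) K0 KD KZ.
have [q [r [rK rE]]] := noetherian_row nR K.
pose a := \matrix_(i < q) r i.
have ag i : mxact a g i = 0.
  rewrite -[RHS](rK i); apply: eq_bigr => j _; by rewrite mxE.
have [m [b [y [yU gy ab]]]] := eflat_system fU gU ag.
have Kb (v : 'rV[R]_k) : K v -> v *m b = 0.
  move=> /rE[c ->]; rewrite mulmx_suml big1 // => i _; rewrite -scalemxAl.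
  have -> : r i *m b = row i (a *m b) by rewrite row_mul rowK.
  by rewrite ab row0 scaler0.
have /choice[co coE] : forall u : sub_type U, exists c : 'rV[R]_k, sub_val u = mxact c g 0.
  move=> u; have [c cE] := gE _ (sub_valP u); exists (\row_l c l).
  by rewrite cE; apply: eq_bigr => l _; rewrite mxE.
have uni (v w : 'rV[R]_k) : mxact v g 0 = mxact w g 0 -> v *m b = w *m b.
  move=> e; apply/eqP; rewrite -subr_eq0 -mulmxBl; apply/eqP; apply: Kb.
  have -> : v - w = (-1) *: w + v by rewrite scaleN1r addrC.
  rewrite /= /mxact (eq_bigr (fun j => v 0 j *: g j - w 0 j *: g j)); last first.
    by move=> j _; rewrite !mxE mulN1r scalerDl scaleNr addrC.
  by rewrite sumrB; apply/eqP; rewrite subr_eq0; apply/eqP.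
have lin j : linear (fun u : sub_type U => (co u *m b) 0 j : R^o).
  move=> c u v; have -> : co (c *: u + v) *m b = (c *: co u + co v) *m b.
    apply: uni; rewrite -coE /= !coE /mxact scaler_sumr -big_split.
    by apply: eq_bigr => l _; rewrite !mxE scalerDl scalerA.
  by rewrite mulmxDl -scalemxAl !mxE.
exists 'I_m, (fun j => SubElt (yU j)), (fun j => mklin (lin j)) => u.
apply: sub_val_inj; rewrite linear_sum coE.
rewrite (eq_bigr (fun j => (co u *m b) 0 j *: y j)) => [|j _]; last by rewrite linearZ.
rewrite -[RHS]/(mxact (co u *m b) y 0) mxactM; apply: eq_bigr => j _.
by rewrite -gy.
Qed.

Lemma fgproj_bij (M M' : lmodType R) (f : {linear M -> M'}) :
  bijective f -> fgproj M' -> fgproj M.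
Proof.
move=> [h fK hK] [T [x [xi xiE]]].
exists T, (fun t => h (x t)), (fun t => xi t \o f) => v.
apply: (can_inj fK); rewrite linear_sum [LHS]xiE.
by apply: eq_bigr => t _; rewrite linearZ /= hK.
Qed.
End FlatResolutions.

Section QuotientComplex.
Context (R : comNzRingType) (X : complex R) (U : subcomplex X).

Fact quo_diff_linear i j :
  linear (fun q : quo_type (U i) => cls (U j) (diff X i j (repr_cls q))).
Proof.
have dE x : cls (U j) (diff X i j (repr_cls (cls (U i) x))) = cls (U j) (diff X i j x).
  apply/clsP; rewrite -linearB; apply: in_cx_diff; exact: repr_clsP.
move=> a p q; have [[x ->] [y ->]] := (cls_surj p, cls_surj q).
by rewrite -linearP !dE !linearP.
Qed.
Definition quo_diff i j := mklin (@quo_diff_linear i j).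

Lemma quo_diffE i j x : quo_diff i j (cls (U i) x) = cls (U j) (diff X i j x).
Proof.
by apply/clsP; rewrite -linearB; apply: in_cx_diff; exact: repr_clsP.
Qed.

Program Definition quo_complex : complex R :=
  @Complex R (fun n => quo_type (U n)) quo_diff _ _.
Next Obligation.
by rewrite diff_shape // linear0.
Qed.
Next Obligation.
rewrite -[RHS](linear0 (cls (U k))); apply/clsP; rewrite subr0.
have := in_cx_diff k (repr_clsP (U j) (diff X i j (repr_cls x))).
by rewrite linearB diff_diff subr0.
Qed.

Lemma quo_complexE i j x :
  diff quo_complex i j (cls (U i) x) = cls (U j) (diff X i j x).
Proof. exact: quo_diffE. Qed.

Context (Y : complex R) (f : chain_map X Y).
Hypothesis fU : forall i j (x : X i), U i x -> f i j x = 0.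

Fact quo_map_fun_E i j x : f i j (repr_cls (cls (U i) x)) = f i j x.
Proof.
apply/eqP; rewrite -subr_eq0 -hmapB; apply/eqP; apply: fU; exact: repr_clsP.
Qed.
Program Definition quo_hmap : Hom quo_complex Y 0 :=
  @Hmap _ _ _ _ _ _ (fun i j (q : quo_type (U i)) => f i j (repr_cls q)) _ _.
Next Obligation.
have [[u ->] [v ->]] := (cls_surj x, cls_surj y).
by rewrite -linearP !quo_map_fun_E hmapP.
Qed.
Next Obligation. by rewrite hmap_shape. Qed.
Fact quo_map_cycle : cycle quo_hmap.
Proof.
apply/hd_cycle => i j k l x; rewrite addr0 sg0 scale1r => -> -> ->.
have [u ->] := cls_surj x; rewrite quo_complexE.
have qE a b y : quo_hmap a b (cls (U a) y) = f a b y by exact: quo_map_fun_E.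
by rewrite !qE chain_mapP.
Qed.
Definition quo_map : chain_map quo_complex Y := mkchain quo_map_cycle.
Lemma quo_mapE i j x : quo_map i j (cls (U i) x) = f i j x.
Proof. exact: quo_map_fun_E. Qed.
End QuotientComplex.

Section TruncatedResolution.
Context (R : comNzRingType) (M : lmodType R) (X : complex R)
  (e : chain_map X (sphere M)) (N : int).
Hypotheses (N0 : 0 <= N) (qe : quasi_iso e).
Local Notation W := (tboundary X N).

Lemma sphere_cycle n (x : sphere M n) : cycle x.
Proof. by []. Qed.
Lemma sphere_boundary n (x : sphere M n) : boundary x <-> x = 0.
Proof. by split=> [[y <-]//|->]; exact: boundary0. Qed.
Lemma sphere0 n (x : sphere M n) : n != 0 -> x = 0.
Proof. by case: n x => [[|n]|n] x // _; exact: thinmx0. Qed.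

Lemma resolution_acyc n : n != 0 -> acyc X n.
Proof.
move=> n0 x cx; apply: (qe n).1 => //.
by rewrite [e n n x](sphere0 _ n0); exact: boundary0.
Qed.

Lemma resolution_kills_tboundary i j (x : X i) : W i x -> e i j x = 0.
Proof.
move=> [x0 xb]; have [ji|ji] := eqVneq j i; last by rewrite hmap_shape ?addr0.
subst j; have [i0|i0] := eqVneq i 0; last exact: sphere0.
have [iN|iN] := ltP i N; first by rewrite x0 ?hmap_x0.
have [|y <-] := xb; first by lia.
by rewrite -chain_mapP.
Qed.
Definition trunc_map := quo_map resolution_kills_tboundary.

Lemma trunc_map_qi : quasi_iso trunc_map.
Proof.
pose q n (x : X n) : quo_complex W n := cls (W n) x.
have qm : hmor q.
  by split=> [n x y|i j x]; [rewrite /q linearB | exact: quo_complexE].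
apply: (@hbij_cancel_r _ _ _ X (quo_complex W) (sphere M) q (fun n => trunc_map n n)
  (fun n => e n n)) => //.
- by move=> n x _; rewrite /q quo_mapE subrr; exact: boundary0.
- exact: chain_hmor.
move=> n; split=> [x cx [y yE]|y cy].
  have [z zE] := cls_surj y; rewrite zE quo_complexE in yE.
  have /clsP/= [h0 hN] := yE; have [nN|] := ltP n N.
    have /eqP := h0 nN; rewrite subr_eq0 => /eqP <-; exact: boundaryI.
  rewrite le_eqVlt => /predU1P[NE|Nn]; last by apply: resolution_acyc => //; lia.
  rewrite -[x](subKr (diff X (n + 1) n z)).
  by apply: boundaryB; [exact: boundaryI | apply: hN].
have [x xE] := cls_surj y; have [nN|Nn] := leP n N.
  exists x; last by rewrite /q -xE subrr; exact: boundary0.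
  move: cy; rewrite xE /cycle quo_complexE -[0](linear0 (cls (W (n - 1)))).
  by move/clsP => -[h0 _]; have := h0 _; rewrite subr0; apply; lia.
exists 0; first by rewrite /cycle linear0.
have -> : y = 0.
  by rewrite xE -[RHS](linear0 (cls (W n))); apply/clsP; rewrite subr0; split=> h; exfalso; lia.
by rewrite sub0r; apply: boundaryN; rewrite /q linear0; exact: boundary0.
Qed.

Lemma trunc_zero n (x : quo_complex W n) : N < n -> x = 0.
Proof.
move=> Nn; have [y ->] := cls_surj x.
by rewrite -[RHS](linear0 (cls (W n))); apply/clsP; split=> h; exfalso; lia.
Qed.
Lemma trunc_zero_below n (x : quo_complex W n) :
  (forall y : X n, y = 0) -> x = 0.
Proof. by move=> X0; have [y ->] := cls_surj x; rewrite (X0 y) linear0. Qed.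

Lemma trunc_fgproj_below n : n < N -> fgproj (X n) -> fgproj (quo_complex W n).
Proof.
move=> nN; apply: (@fgproj_bij _ _ _ (mklin (f := fun q : quo_type (W n) => repr_cls q) _)).
  move=> a p q; have [[x ->] [y ->]] := (cls_surj p, cls_surj q).
  have rK z : repr_cls (cls (W n) z) = z.
    have [h _] := repr_clsP (W n) z; by apply/eqP; rewrite -subr_eq0; apply/eqP; exact: h.
  by rewrite -linearP !rK.
move=> h; exists (cls (W n)) => z /=; first exact: repr_clsK.
have [h0 _] := repr_clsP (W n) z; by apply/eqP; rewrite -subr_eq0; apply/eqP; exact: h0.
Qed.
End TruncatedResolution.

Section FiniteResolution.
Context (R : comNzRingType) (nR : noetherian R).

Lemma fgproj0 (V : lmodType R) : (forall v : V, v = 0) -> fgproj V.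
Proof.
move=> V0; exists 'I_0, (fun _ => 0), (fun _ => \0) => v.
by rewrite big_ord0 [v]V0.
Qed.

Lemma sphere_fg (M : lmodType R) : fin_gen M ->
  degreewise_homologically_finite (sphere M).
Proof.
move=> [k [g gE]] n; have [->|n0] := eqVneq n 0.
  exists k, g; split=> // z _; have [a ->] := gE z.
  by exists a; rewrite subrr; exact: boundary0.
exists 0%N, (fun _ => 0); split=> // z _; exists (fun _ => 0).
by rewrite big_ord0 (sphere0 z n0) subr0; exact: boundary0.
Qed.

Lemma homotopic_homology (X Y : complex R) (f : Hom X Y 0) n (x : X n) :
  boundary f -> cycle x -> boundary (f n n x).
Proof.
move=> bf cx; have [|w <-] := @boundary_at _ _ _ 1 f _ bf; first by [].
rewrite (@hdE _ _ _ _ _ _ _ (n + 1) (n - 1)) // (cycleE _ cx) hmap_x0 scaler0 subr0.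
exact: boundaryI.
Qed.

Lemma projective_lift (L F Y : complex R) (f : chain_map L Y) (e : chain_map F Y) :
  bounded_below_projective L -> quasi_iso f -> quasi_iso e ->
  exists g : chain_map L F, quasi_iso g.
Proof.
move=> pL qf qe; have [_ h] := post_projective_qi pL qe 0.
have [u cu bu] := h f (chain_cycle f); exists (mkchain cu).
apply: (@hbij_cancel_l _ _ _ L F Y (fun n => mkchain cu n n) (fun n => e n n)
  (fun n => f n n)) => //.
- move=> n x cx; have := homotopic_homology bu cx.
  by rewrite hmapBE (@postE _ _ _ _ _ _ _ _ _ n) ?addr0.
- exact: (chain_hmor (mkchain cu)).
- exact: chain_hmor.
Qed.

Lemma sphere_resolution (M : lmodType R) : fin_gen M ->
  exists (L : complex R) (e : chain_map L (sphere M)),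
  [/\ forall l, fgproj (L l), forall (l : int) (x : L l), l < 0 -> x = 0 &
      quasi_iso e].
Proof.
move=> fM; apply: free_resolution => //; first exact: sphere_fg.
move=> i i0 x _; rewrite (sphere0 x); first exact: boundary0.
by rewrite lt_eqF.
Qed.

Definition fg_resolution (M : lmodType R) (N : int) : Prop :=
  exists (P : complex R) (e : chain_map P (sphere M)),
  [/\ forall l, fgproj (P l), forall (l : int) (x : P l), l < 0 -> x = 0,
      forall (l : int) (x : P l), N < l -> x = 0 & quasi_iso e].

(** A resolution [L] by finitely generated projectives maps to the flat resolution [F]; the cone is
    bounded below, acyclic and flat, so its cycles are flat. Beyond the length of [F] these are
    cycles of [L], which are finitely generated and therefore projective, and [L] can be truncated
    there. *)
Lemma finite_resolution (M : lmodType R) n : fin_gen M ->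
  has_resolution (@flat R) M n -> exists N : nat, fg_resolution M N.
Proof.
move=> fM [F [eF [flF F0 qF]]].
have [L [e [pL L0 qe]]] := sphere_resolution fM.
have bL : bounded_below_projective L.
  by split; [exists 0 => l x; exact: L0 | move=> l; exact: fgproj_projective].
have [g qg] := projective_lift bL qe qF.
have /acyclicE aC := (cone_qi g).1 qg.
have fC l : eflat (full_submodule (cone g l)).
  by apply: eflat_pair; [exact: flat_eflat | exact: fgproj_eflat].
have C0 l (x : cone g l) : l < 0 -> x = 0.
  case: x => y x l0; congr pair; first by apply: F0; rewrite l0.
  by apply: L0; lia.
(* [F m] has to vanish, and [m - 1] has to be positive for [L] to be exact there. *)
pose m : int := (`|n|%N.+2)%:Z.
have aL l : l != 0 -> acyc L l by exact: resolution_acyc.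
have fZ : eflat (cycle_sub L (m - 1)).
  move=> k a x cx ax.
  have czE (y : F m) (z : L (m - 1)) : cycle ((y, z) : cone g m) <-> cycle z.
    rewrite /cycle coneE; split=> [c|cz].
      by have := congr1 snd c => /= /eqP; rewrite oppr_eq0 => /eqP.
    congr pair; last by rewrite /= cz oppr0.
    by rewrite /=; apply: F0; apply/orP; right; rewrite /m; lia.
  have fZm : eflat (cycle_sub (cone g) m) by exact: eflat_cycles C0 aC fC m.
  have [|| k' [b [y [cy xE ab]]]] := fZm k a (fun i => ((0, x i) : cone g m)).
  - by move=> i; apply/czE; exact: cx.
  - rewrite [LHS]surjective_pairing (mxact_linear fst) (mxact_linear snd) /= ax.
    by congr pair; rewrite /mxact big1 // => j _; rewrite scaler0.
  exists k', b, (fun j => (y j).2); split=> // [j|i].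
    by have := cy j; case: (y j) => y1 y2 /czE.
  by rewrite -(mxact_linear snd) -xE.
have [k [h [hZ hE]]] : exists (k : nat) (h : 'I_k -> L (m - 1)),
    (forall i, cycle_sub L (m - 1) (h i)) /\
    forall u, cycle_sub L (m - 1) u -> exists a : 'I_k -> R, u = \sum_l a l *: h l.
  have [|k [h [hZ hE]]] := @fg_mod_ord R (L (m - 1)) (cycle_sub L (m - 1))
      (zero_submodule (L (m - 1))).
    apply: (noetherian_fg_mod nR (V := fun _ => True)) => //.
    have [T [x [xi xiE]]] := pL (m - 1); exists T, x; split=> // u _.
    by exists (fun t => xi t u); rewrite /= -xiE subrr.
  exists k, h; split=> // u /hE[a aE]; exists a; apply/eqP.
  by rewrite -subr_eq0; apply/eqP.
have pZ := eflat_fgproj nR fZ hZ hE.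
have m0 : 0 <= m by [].
exists `|m|%N, (quo_complex (tboundary L m)), (trunc_map e m0); split.
- move=> l; have [lm|] := ltP l m; first exact: trunc_fgproj_below.
  rewrite le_eqVlt => /predU1P[<-|ml]; last first.
    by apply: fgproj0 => v; exact: trunc_zero.
  pose f0 (q : quo_complex (tboundary L m) m) : sub_type (cycle_sub L (m - 1)) :=
    SubElt (@diff_diff _ L m (m - 1) (m - 1 - 1) (repr_cls q)
      : cycle_sub L (m - 1) (diff L m (m - 1) (repr_cls q))).
  have f0E x : sub_val (f0 (cls _ x)) = diff L m (m - 1) x.
    apply/eqP; rewrite /= -subr_eq0 -linearB; apply/eqP.
    by have [_ /(_ erefl)] := repr_clsP (tboundary L m m) x; exact: boundary_cycle.
  have fl : linear f0.
    move=> a p q; have [[x ->] [y ->]] := (cls_surj p, cls_surj q).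
    apply: sub_val_inj; rewrite -linearP f0E linearP.
    by rewrite -(f0E x) -(f0E y).
  apply: (@fgproj_bij _ _ _ (mklin fl)) pZ.
  have /choice[h' h'E] : forall z : sub_type (cycle_sub L (m - 1)),
      exists x : L m, diff L m (m - 1) x = sub_val z.
    by move=> z; apply: boundary_at (aL (m - 1) _ _ (sub_valP z)); rewrite ?subrK.
  exists (fun z => cls _ (h' z)) => [q|z].
    have [x ->] := cls_surj q; apply/clsP; split=> [|_]; first by rewrite ltxx.
    apply: aL => //; by rewrite /cycle linearB /= h'E f0E subrr.
  by apply: sub_val_inj; rewrite f0E h'E.
- by move=> l x l0; apply: trunc_zero_below => y; exact: L0.
- by move=> l x ml; apply: trunc_zero; rewrite gez0_abs in ml.
- exact: trunc_map_qi.
Qed.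

(** The idempotent [1 - d r] of [P (N - 1)] vanishes on boundaries, so it splits the projection onto
    the cokernel of the top differential. That cokernel is then projective, and truncation at
    [N - 1] is allowed. *)
Lemma shorten_resolution (M : lmodType R) (N : int) (P : complex R)
    (e : chain_map P (sphere M)) (r : {linear P (N - 1) -> P N}) : 1 <= N ->
  (forall l, fgproj (P l)) -> (forall (l : int) (x : P l), l < 0 -> x = 0) ->
  (forall (l : int) (x : P l), N < l -> x = 0) -> quasi_iso e ->
  (forall x : P N, r (diff P N (N - 1) x) = x) -> fg_resolution M (N - 1).
Proof.
move=> N1 pP P0 PN qe rE; have N0 : 0 <= N - 1 by lia.
exists (quo_complex (tboundary P (N - 1))), (trunc_map e N0); split.
- move=> l; have [lm|] := ltP l (N - 1); first exact: trunc_fgproj_below.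
  rewrite le_eqVlt => /predU1P[<-|ml]; last first.
    by apply: fgproj0 => v; exact: trunc_zero.
  have [T [x [xi xiE]]] := pP (N - 1).
  pose c v := v - diff P N (N - 1) (r v).
  have cl : linear c.
    move=> a u v; by rewrite /c !linearP /= addrACA -scalerDr.
  pose q0 (q : quo_complex (tboundary P (N - 1)) (N - 1)) := c (repr_cls q).
  have cb v : tboundary P (N - 1) (N - 1) v -> c v = 0.
    move=> [_ /(_ erefl) bv]; have [|y <-] := @boundary_at _ _ _ N v _ bv.
      by rewrite subrK.
    by rewrite /c rE subrr.
  have q0E v : q0 (cls _ v) = c v.
    apply/eqP; rewrite -subr_eq0 -(linearB (mklin cl)); apply/eqP.
    by apply: cb; exact: (repr_clsP (tboundary P (N - 1) (N - 1)) v).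
  have q0l : linear q0.
    move=> a p q; have [[u ->] [v ->]] := (cls_surj p, cls_surj q).
    by rewrite -linearP !q0E cl.
  exists T, (fun t => cls _ (x t)), (fun t => xi t \o mklin q0l) => q.
  have [v ->] := cls_surj q.
  transitivity (cls (tboundary P (N - 1) (N - 1)) (\sum_t xi t (c v) *: x t)).
    rewrite -xiE; apply/clsP; rewrite /c subKr.
    by split=> [|_]; [rewrite ltxx | exact: boundaryI].
  rewrite linear_sum; apply: eq_bigr => t _.
  by rewrite linearZ /= q0E.
- by move=> l x l0; apply: trunc_zero_below => y; exact: P0.
- by move=> l x ml; exact: trunc_zero.
- exact: trunc_map_qi.
Qed.
End FiniteResolution.

(** * Nilpotence *)

Section Nilpotence.
Context (R : comNzRingType) (Q : complex R) (e : Q 0) (ce : cycle e).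
Hypotheses (pQ : forall l, fgproj (Q l))
  (Q0 : exists a : int, forall l (x : Q l), l < a -> x = 0).
Implicit Types Y : complex R.

Program Definition ev_hmap Y : Hom (Hom Q Y) Y 0 :=
  @Hmap _ _ _ _ _ _ (fun i j (g : Hom Q Y i) => g 0 j e) _ _.
Next Obligation. by rewrite -hmapZE. Qed.
Next Obligation. by rewrite hmap_shape // add0r -[i]addr0. Qed.
Fact ev_cycle Y : cycle (ev_hmap Y).
Proof.
apply/hd_cycle => i j k l g; rewrite addr0 sg0 scale1r => -> -> ->.
have evE a b (h : Hom Q Y a) : ev_hmap Y a b h = h 0 b e by [].
rewrite !evE (@hdE _ _ _ _ _ _ _ i (-1)) ?subrK //.
by rewrite (cycleE _ ce) hmap_x0 scaler0 subr0.
Qed.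
Definition ev Y : chain_map (Hom Q Y) Y := mkchain (ev_cycle Y).
Lemma evE Y i j (g : Hom Q Y i) : ev Y i j g = g 0 j e.
Proof. by []. Qed.

Definition cofib Y : complex R := cone (ev Y).
Definition eta Y n (y : Y n) : cofib Y n := (y, 0).

Lemma cofibE Y i j (y : Y i) (g : Hom Q Y (i - 1)) :
  diff (cofib Y) i j ((y, g) : cofib Y i) =
    (diff Y i j y + g 0 j e, - diff (Hom Q Y) (i - 1) (j - 1) g).
Proof. by []. Qed.

Lemma etaD Y n (y y' : Y n) : eta (y + y') = eta y + eta y'.
Proof. by congr pair; rewrite addr0. Qed.
Lemma etaZ Y n a (y : Y n) : eta (a *: y) = a *: eta y.
Proof. by congr pair; rewrite scaler0. Qed.
Lemma eta_diff Y i j (y : Y i) : diff (cofib Y) i j (eta y) = eta (diff Y i j y).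
Proof. by rewrite /eta coneE linear0 oppr0 evE hmap0E addr0. Qed.

Lemma hin0 Y (U : subcomplex Y) n : hin U (0 : Hom Q Y n).
Proof. by move=> i j x; exact: in_sub0. Qed.

Section Cofsub.
Context (Y : complex R) (U : subcomplex Y).
(** The cofibre of a subcomplex as a subcomplex of the cofibre, so that iterated cofibres of [V / U]
    are again given by pairs. *)
Program Definition cofsub_sub n : submodule (cofib Y n) :=
  @Submodule R (cofib Y n) (fun v => U n v.1 /\ hin U v.2) _ _ _.
Next Obligation. by split; [exact: in_sub0 | exact: hin0]. Qed.
Next Obligation.
split; first exact: in_subD.
by move=> i j z; rewrite hmapDE; exact: in_subD.
Qed.
Next Obligation.
split; first exact: in_subZ.
by move=> i j z; rewrite hmapZE; exact: in_subZ.
Qed.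
Program Definition cofsub : subcomplex (cofib Y) :=
  @Subcomplex R (cofib Y) cofsub_sub _.
Next Obligation.
split.
  by apply: in_subD; [exact: in_cx_diff | exact: H0].
move=> k l z; have [ji|ji] := eqVneq j (i - 1); last first.
  rewrite (@diff_shape _ (Hom Q Y)) ?oppr0; first exact: in_sub0.
  by apply/eqP => E; case/eqP: ji; lia.
subst j; rewrite hmapNE; apply: in_subN.
have [lk|lk] := eqVneq l (k + (i - 1 - 1)); last first.
  by rewrite hmap_shape //; exact: in_sub0.
rewrite -/(diff (Hom Q Y) (i - 1) (i - 1 - 1) _).
rewrite (@hdE _ _ _ _ _ _ _ (l + 1) (k - 1)) //.
apply: in_subB; first by apply: in_cx_diff; exact: H0.
by apply: in_subZ; exact: H0.
Qed.
End Cofsub.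

Lemma cofsub_eta Y (U : subcomplex Y) n (y : Y n) : U n y -> cofsub U n (eta y).
Proof. by move=> Uy; split=> //; exact: hin0. Qed.

Lemma cofsub_mono Y (V U : subcomplex Y) : (forall n x, V n x -> U n x) ->
  forall n x, cofsub V n x -> cofsub U n x.
Proof. by move=> VU n x [x1 x2]; split; [exact: VU | move=> i j z; exact: VU]. Qed.

Lemma cofsub_scale Y (V U : subcomplex Y) (a : R) :
  (forall n x, V n x -> U n (a *: x)) ->
  forall n x, cofsub V n x -> cofsub U n (a *: x).
Proof.
move=> VU n x [x1 x2]; split; first exact: VU.
by move=> i j z; rewrite hmapZE; exact: VU.
Qed.

(* [fnull r V U y]: the class of [y] in the subquotient [V / U] dies in the
   [r]-fold cofibre. *)
Fixpoint fnull r Y (V U : subcomplex Y) n (y : Y n) : Prop :=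
  if r is r'.+1 then fnull r' (cofsub V) (cofsub U) (eta y)
  else exists2 w : Y (n + 1), V _ w & U n (y - diff Y (n + 1) n w).

Lemma fnull_mono r Y (V V' U U' : subcomplex Y) n (y : Y n) :
  (forall m x, V m x -> V' m x) -> (forall m x, U m x -> U' m x) ->
  fnull r V U y -> fnull r V' U' y.
Proof.
elim: r Y V V' U U' n y => [|r IH] Y V V' U U' n y VV UU /=.
  by move=> [w Vw Uw]; exists w; [exact: VV | exact: UU].
by apply: IH; exact: cofsub_mono.
Qed.

Lemma fnullD r Y (V U : subcomplex Y) n (y y' : Y n) :
  fnull r V U y -> fnull r V U y' -> fnull r V U (y + y').
Proof.
elim: r Y V U n y y' => [|r IH] Y V U n y y' /=; last by rewrite etaD; exact: IH.
move=> [w Vw Uw] [w' Vw' Uw']; exists (w + w'); first exact: in_subD.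
by rewrite linearD opprD addrACA; exact: in_subD.
Qed.

Lemma fnull_sub r Y (V U : subcomplex Y) n (y : Y n) : U n y -> fnull r V U y.
Proof.
elim: r Y V U n y => [|r IH] Y V U n y Uy /=.
  by exists 0; [exact: in_sub0 | rewrite (linear0 (diff Y _ _)) subr0].
by apply: IH; exact: cofsub_eta.
Qed.

Lemma fnull_boundary r Y (V U : subcomplex Y) n (w : Y (n + 1)) :
  V _ w -> fnull r V U (diff Y (n + 1) n w).
Proof.
elim: r Y V U n w => [|r IH] Y V U n w Vw /=.
  by exists w; rewrite ?subrr //; exact: in_sub0.
by rewrite -eta_diff; apply: IH; exact: cofsub_eta.
Qed.

Program Definition cofmap_hmap Y Y' (f : chain_map Y Y') : Hom (cofib Y) (cofib Y') 0 :=
  @Hmap _ _ _ _ _ _ (fun i j v =>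
    (f i j v.1, hcomp (j - 1) (f : Hom Y Y' 0) v.2)) _ _.
Next Obligation.
by congr pair; rewrite /= ?hmapP // hcompDr hcompZr.
Qed.
Next Obligation.
congr pair; first by rewrite hmap_shape.
by rewrite hcomp0 //; apply/eqP => E; case/eqP: H; lia.
Qed.
Fact cofmap_cycle Y Y' (f : chain_map Y Y') : cycle (cofmap_hmap f).
Proof.
apply/hd_cycle => i j k l [y g]; rewrite addr0 sg0 scale1r => -> -> ->.
have fE a b (v : cofib Y a) : cofmap_hmap f a b v =
  (f a b v.1, hcomp (b - 1) (f : Hom Y Y' 0) v.2) by [].
rewrite !fE !coneE; congr pair.
  rewrite hmapD -chain_mapP; congr (_ + _); rewrite !evE.
  rewrite [(_, _).2]/= (@hcompE _ _ _ _ _ _ _ _ _ _ _ (i - 1)); [|lia|lia].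
  by [].
rewrite [(_, _).2]/= hcompNr; congr (- _).
rewrite (@hcomp_diff _ _ _ _ _ _ _ _ (-1) (i - 1 - 1)) ?addr0 //.
have -> : diff (Hom Y Y') 0 (-1) (f : Hom Y Y' 0) = 0 by exact: chain_cycle.
by rewrite hcomp0l add0r sg0 scale1r.
Qed.
Definition cofmap Y Y' (f : chain_map Y Y') := mkchain (cofmap_cycle f).

Lemma fnull_map r Y Y' (f : chain_map Y Y') (V U : subcomplex Y)
    (V' U' : subcomplex Y') n (y : Y n) :
  (forall i j x, V i x -> V' j (f i j x)) ->
  (forall i j x, U i x -> U' j (f i j x)) ->
  fnull r V U y -> fnull r V' U' (f n n y).
Proof.
elim: r Y Y' f V U V' U' n y => [|r IH] Y Y' f V U V' U' n y VV UU /=.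
  move=> [w Vw Uw]; exists (f _ _ w); first exact: VV.
  by rewrite chain_mapP -hmapB; exact: UU.
have -> : eta (f n n y) = cofmap f n n (eta y).
  by congr pair; rewrite /= hcomp0r.
have hc (A : subcomplex Y) (A' : subcomplex Y') : (forall i j x, A i x -> A' j (f i j x)) ->
    forall i j x, cofsub A i x -> cofsub A' j (cofmap f i j x).
  move=> AA i j x [x1 x2]; split; first exact: AA.
  move=> k l z /=; case: eqP => _; last exact: in_sub0.
  exact: AA.
by apply: IH; exact: hc.
Qed.

(** The map [g] that sends [q] to [sigma q *: y] takes the value [sigma e *: y] at [e], so this
    element comes from [Hom Q Y] and dies in the cofibre. Modulo [U] the map [g] is a cycle: [y] is
    one, [sigma] sends boundaries into [p], and [p] carries [V] into [U]. *)
Lemma fnull_scale (p : ideal R) (sigma : {linear Q 0 -> R^o}) Y (V U : subcomplex Y)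
    n (y : Y n) :
  (forall q : Q 1, p (sigma (diff Q 1 0 q))) ->
  (forall a m x, p a -> V m x -> U m (a *: x)) ->
  V n y -> U _ (diff Y n (n - 1) y) -> fnull 1 V U ((sigma e : R) *: y).
Proof.
move=> psig pVU Vy Udy /=.
have lin : linear (fun q => (sigma q : R) *: y).
  by move=> a u v; rewrite linearP scalerDl -scalerA.
have E : n = 0 + (n + 1 - 1) by lia.
pose g : Hom Q Y (n + 1 - 1) := hsingle E (mklin lin).
have gE i j x : g i j x = tr j ((sigma (tr 0 x) : R) *: y) by [].
have gV : hin V g.
  move=> i j x; rewrite gE; have [->|jn] := eqVneq j n.
    by rewrite trE; exact: in_subZ.
  by rewrite tr0 //; exact: in_sub0.
exists ((0, g) : cofib Y (n + 1)); first by split=> //; exact: in_sub0.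
split; first by rewrite linear0 add0r gE !trE subrr; exact: in_sub0.
move=> i j x; rewrite sub0r opprK -/(diff (Hom Q Y) (n + 1 - 1) (n - 1) g).
have [ji|ji] := eqVneq j (i + (n - 1)); last by rewrite hmap_shape //; exact: in_sub0.
rewrite (@hdE _ _ _ _ _ _ _ (j + 1) (i - 1)) //; last by lia.
apply: in_subB.
  rewrite gE; have [jn|jn] := eqVneq (j + 1) n; last first.
    by rewrite tr0 // linear0; exact: in_sub0.
  have j1 : j = n - 1 by lia.
  by rewrite diff_tr // linearZ /= j1; exact: in_subZ.
apply: in_subZ; rewrite gE; have [i1|i1] := eqVneq i 1; last first.
  rewrite [tr 0 _]tr0; last by apply/eqP => E'; case/eqP: i1; lia.
  by rewrite linear0 scale0r linear0; exact: in_sub0.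
subst i; have [->|jn] := eqVneq j n; last by rewrite tr0 //; exact: in_sub0.
rewrite trE tr_diff //; exact: pVU.
Qed.
End Nilpotence.

Lemma dep_choice (A : Type) (T : A -> Type) (P : forall i, T i -> Prop) :
  (forall i, exists y, P i y) -> exists f : forall i, T i, forall i, P i (f i).
Proof.
by move=> h; exists (fun i => projT1 (cid (h i))) => i; exact: projT2 (cid (h i)).
Qed.

Section SubcomplexConstructions.
Context (R : comNzRingType) (Y : complex R).

Program Definition add_scaled_sub (U V : subcomplex Y) (c : R) n : submodule (Y n) :=
  @Submodule R (Y n) (fun x => exists2 z, V n z & U n (x - c *: z)) _ _ _.
Next Obligation. by exists 0; rewrite ?scaler0 ?subr0; exact: in_sub0. Qed.
Next Obligation.
exists (H + H0); first exact: in_subD.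
by rewrite scalerDr opprD addrACA; exact: in_subD.
Qed.
Next Obligation.
exists (a *: H); first exact: in_subZ.
by rewrite scalerA mulrC -scalerA -scalerBr; exact: in_subZ.
Qed.
Program Definition add_scaled (U V : subcomplex Y) (c : R) : subcomplex Y :=
  @Subcomplex R Y (add_scaled_sub U V c) _.
Next Obligation.
exists (diff Y i j H); first exact: in_cx_diff.
by rewrite -linearZ -linearB; exact: in_cx_diff.
Qed.

Program Definition colon_sub (U V : subcomplex Y) (c : R) n : submodule (Y n) :=
  @Submodule R (Y n) (fun x => V n x /\ U n (c *: x)) _ _ _.
Next Obligation. by rewrite scaler0; split; exact: in_sub0. Qed.
Next Obligation. by rewrite scalerDr; split; exact: in_subD. Qed.
Next Obligation.
split; first exact: in_subZ.
by rewrite scalerA mulrC -scalerA; exact: in_subZ.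
Qed.
Program Definition colon (U V : subcomplex Y) (c : R) : subcomplex Y :=
  @Subcomplex R Y (colon_sub U V c) _.
Next Obligation.
split; first exact: in_cx_diff.
by rewrite -linearZ; exact: in_cx_diff.
Qed.
End SubcomplexConstructions.

Section NilpotenceTheorem.
Context (R : comNzRingType) (nR : noetherian R).
Context (Q : complex R) (e : Q 0) (ce : cycle e).
Hypotheses (pQ : forall l, fgproj (Q l))
  (Q0 : exists a : int, forall l (x : Q l), l < a -> x = 0).
Implicit Types Y : complex R.
Local Notation fnull := (fnull ce).
Local Notation cofsub := (cofsub ce).
Local Notation cofib := (cofib ce).

Context (I : ideal R).
Hypothesis sigmaP : forall p : ideal R, is_prime p -> (forall a, I a -> p a) ->
  exists sigma : {linear Q 0 -> R^o},
    (forall q : Q 1, p (sigma (diff Q 1 0 q))) /\ ~ p (sigma e).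

(** The bound is uniform in [Y], in the pair and in the degree; this is what permits its use on
    iterated cofibres. *)
Definition nilp (J : ideal R) (r : nat) : Prop :=
  forall Y (V U : subcomplex Y), (forall n x, U n x -> V n x) ->
  (forall a n x, J a -> V n x -> U n (a *: x)) ->
  forall n (y : Y n), V n y -> U _ (diff Y n (n - 1) y) -> fnull r V U y.

(** Cofibres add up along an extension: after [r1] of them the class comes from the [r1]-fold
    cofibre of [W / U], which is still annihilated by [J2]. *)
Lemma nilp_step (J2 : ideal R) r1 r2 Y (V W U : subcomplex Y) n (y : Y n) :
  nilp J2 r2 -> (forall n x, U n x -> W n x) -> (forall n x, W n x -> V n x) ->
  (forall b n x, J2 b -> W n x -> U n (b *: x)) ->
  V n y -> U _ (diff Y n (n - 1) y) -> fnull r1 V W y -> fnull (r1 + r2) V U y.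
Proof.
move=> nJ2; elim: r1 Y V W U n y => [|r1 IH] Y V W U n y UW WV JW Vy Udy.
  move=> [w Vw Ww]; rewrite -[y](subrK (diff Y (n + 1) n w)).
  apply: fnullD; last exact: fnull_boundary.
  apply: (fnull_mono (V := W) (U := U)) => //; apply: nJ2 => //.
  by rewrite linearB diff_diff subr0.
move=> h; apply: (IH _ _ (cofsub W)) => //.
- exact: cofsub_mono.
- exact: cofsub_mono.
- by move=> b m x Jb; apply: cofsub_scale => k z; exact: JW.
- exact: cofsub_eta.
- by rewrite eta_diff; exact: cofsub_eta.
Qed.

Section PrimeCase.
Context (p : ideal R) (sigma : {linear Q 0 -> R^o}).
Hypothesis psig : forall q : Q 1, p (sigma (diff Q 1 0 q)).
Local Notation c := (sigma e : R).

(** In the [k]-fold cofibre the differential of [z] becomes that of some [k'] in [K], modulo [U].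
    Then [z - k'] is a cycle modulo [U], and [c z] agrees with [c (z - k')] modulo [U] because [c]
    carries [K] into [U]; one more cofibre kills the latter by [fnull_scale]. *)
Lemma fnull_colon k Y (V K U : subcomplex Y) n (z : Y n) :
  (forall n x, U n x -> K n x) -> (forall n x, K n x -> V n x) ->
  (forall a n x, p a -> V n x -> U n (a *: x)) ->
  (forall n x, K n x -> U n (c *: x)) ->
  V n z -> K _ (diff Y n (n - 1) z) -> fnull k K U (diff Y n (n - 1) z) ->
  fnull k.+1 V U (c *: z).
Proof.
elim: k Y V K U n z => [|k IH] Y V K U n z UK KV pVU cKU Vz Kdz.
  rewrite /= -/(fnull 1 V U (c *: z)).
  move: (n - 1 + 1) (subrK 1 n) => m mn; subst m => -[k' Kk' Uk'].
  rewrite -[z](subrK k') scalerDr; apply: fnullD; last first.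
    by apply: fnull_sub; exact: cKU.
  apply: fnull_scale psig pVU _ _; last by rewrite linearB.
  by apply: in_subB => //; exact: KV.
move=> h.
have h' : fnull k (cofsub K) (cofsub U) (diff (cofib Y) n (n - 1) (eta ce z)).
  by rewrite eta_diff.
change (fnull k.+1 (cofsub V) (cofsub U) (eta ce (c *: z))); rewrite etaZ.
apply: (IH _ _ (cofsub K)) => //.
- exact: cofsub_mono.
- exact: cofsub_mono.
- by move=> a m x pa; apply: cofsub_scale => l y; exact: pVU.
- exact: cofsub_scale.
- exact: cofsub_eta.
- by rewrite eta_diff; exact: cofsub_eta.
Qed.

(** Once a class has moved into [U + c V] the induction hypothesis does not apply directly, as [c]
    need not annihilate that module modulo [U]. But if the class is [c z], the differential of [z]
    lies in the submodule [K] of elements of [V] that [c] sends into [U]. Since [p + (c)]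
    annihilates [K / U], this differential dies after [r'] cofibres, and [fnull_colon] returns to
    [c z] at the cost of one more. *)
Lemma nilp_prime_step b r' Y (V W U : subcomplex Y) n (y : Y n) :
  nilp (ideal_add p c) r' -> (forall n x, U n x -> V n x) ->
  (forall a n x, p a -> V n x -> U n (a *: x)) ->
  (forall n x, W n x -> exists2 z, V n z & U n (x - c *: z)) ->
  V n y -> U _ (diff Y n (n - 1) y) -> fnull b V W y ->
  fnull (b + r'.+1) V U y.
Proof.
move=> nJ; elim: b Y V W U n y => [|b IH] Y V W U n y UV pVU WUV Vy Udy.
  move=> [w Vw Ww]; rewrite -[y](subrK (diff Y (n + 1) n w)).
  apply: fnullD; last exact: fnull_boundary.
  have [z Vz Uz] := WUV _ _ Ww; rewrite -[y - _](subrK (c *: z)).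
  apply: fnullD; first exact: fnull_sub.
  have Udz : U _ (c *: diff Y n (n - 1) z).
    rewrite -[_ *: _]opprK; apply: in_subN.
    have := in_cx_diff (n - 1) Uz.
    rewrite !linearB /= diff_diff subr0 linearZ /= => h.
    have := in_subB (U (n - 1)) h Udy; by rewrite addrAC subrr add0r.
  have Kdz : colon U V c _ (diff Y n (n - 1) z) by split=> //; exact: in_cx_diff.
  apply: (fnull_colon (K := colon U V c)) => //.
  - move=> m x Ux; split; first exact: UV.
    exact: in_subZ.
  - by move=> m x [].
  - by move=> m x [].
  apply: nJ => //.
  - move=> m x Ux; split; first exact: UV.
    exact: in_subZ.
  - move=> a m x [s ps] [Vx Ux]; rewrite -[a](subrK (s * c)) scalerDl.
    apply: in_subD; first exact: pVU.
    by rewrite -scalerA; exact: in_subZ.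
  - by rewrite diff_diff; exact: in_sub0.
move=> h; apply: (IH _ _ (cofsub W)) => //.
- exact: cofsub_mono.
- by move=> a m x pa; apply: cofsub_scale => l z; exact: pVU.
- move=> m [x g] [/= Wx Wg]; have [z Vz Uz] := WUV _ _ Wx.
  (* A map from [Q] into [U + c V] decomposes accordingly: the factors of [c] are chosen on a dual
     basis of each [Q i] and extended linearly. *)
  have [h1 h1V h1U] : exists2 h1 : Hom Q Y (m - 1), hin V h1 & hin U (g - c *: h1).
    have /dep_choice[H HP] : forall i, exists h1 : {linear Q i -> Y (i + (m - 1))},
        (forall q, V _ (h1 q)) /\ forall q, U _ (g i (i + (m - 1)) q - c *: h1 q).
      move=> i; have [T [x' [xi xiE]]] := pQ i.
      have /choice[v vP] : forall t, exists v, V (i + (m - 1)) v /\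
          U _ (g i (i + (m - 1)) (x' t) - c *: v).
        by move=> t; have [v] := WUV _ _ (Wg i (i + (m - 1)) (x' t)); exists v.
      have lin : linear (fun q => \sum_t xi t q *: v t).
        move=> a u w; rewrite scaler_sumr -big_split; apply: eq_bigr => t _ /=.
        by rewrite linearP scalerDl scalerA.
      exists (mklin lin); split=> q.
        apply: (in_sub_sum (U := V (i + (m - 1)))) => t.
        by apply: in_subZ; exact: (vP t).1.
      have -> : mklin lin q = \sum_t xi t q *: v t by [].
      rewrite [X in g _ _ X](xiE q) hmap_sum.
      rewrite scaler_sumr -sumrB.
      apply: (in_sub_sum (U := U (i + (m - 1)))) => t.
      rewrite hmapZr scalerA mulrC -scalerA -scalerBr; apply: in_subZ.
      exact: (vP t).2.
    pose h1f i j (q : Q i) : Y j := tr j (H i q).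
    have lin i j : linear (@h1f i j) by move=> a u v; rewrite /h1f !linearP.
    have sh i j x' : j != i + (m - 1) -> @h1f i j x' = 0 by exact: tr0.
    exists (mkhmap lin sh) => i j q.
      rewrite /= /h1f; have [->|ji] := eqVneq j (i + (m - 1)).
        by rewrite trE; exact: (HP i).1.
      by rewrite tr0 //; exact: in_sub0.
    rewrite hmapBE hmapZE; have -> : mkhmap lin sh i j q = tr j (H i q) by [].
    have [->|ji] := eqVneq j (i + (m - 1)).
      by rewrite trE; exact: (HP i).2.
    by rewrite tr0 // hmap_shape // scaler0 subr0; exact: in_sub0.
  exists ((z, h1) : cofib Y m); first by split.
  by split.
- exact: cofsub_eta.
- by rewrite eta_diff; exact: cofsub_eta.
Qed.
End PrimeCase.

(* At a prime [p], [sigma] makes multiplication by [sigma e], which is not in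
   [p], null on [V / U]; the ideal [p + (sigma e)] is bigger. *)
Lemma nilp_exists (J : ideal R) : (forall a, I a -> J a) -> exists r, nilp J r.
Proof.
move: J; apply: (noetherian_ind nR) => J IH IJ.
have IHa (a : R) : ~ J a -> exists r, nilp (ideal_add J a) r.
  move=> nJa; apply: IH => [x||].
  - exact: ideal_add_sub.
  - by exists a => //; exact: ideal_add_mem.
  - by move=> x /IJ; exact: ideal_add_sub.
have [J1|nJ1] := pselect (J 1).
  exists 0%N => Y V U UV JVU n y Vy _; exists 0; first exact: in_sub0.
  rewrite (linear0 (diff Y _ _)) subr0 -[y]scale1r; exact: JVU.
(* For a non-prime ideal, filter [V] through [U + a V]: the upper quotient is annihilated by
   [J + (a)], the lower one by [J + (b)] because [a * b] lies in [J]. *)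
have [[a [b [nJa nJb Jab]]]|np] :=
    pselect (exists a b : R, [/\ ~ J a, ~ J b & J (a * b)]).
  have [r1 n1] := IHa a nJa; have [r2 n2] := IHa b nJb.
  exists (r1 + r2)%N => Y V U UV JVU n y Vy Udy.
  have UW m x : U m x -> add_scaled U V a m x.
    by move=> Ux; exists 0; [exact: in_sub0 | rewrite scaler0 subr0].
  have WV m x : add_scaled U V a m x -> V m x.
    move=> [z Vz Uz]; rewrite -[x](subrK (a *: z)); apply: in_subD; first exact: UV.
    exact: in_subZ.
  apply: (nilp_step (J2 := ideal_add J b) (W := add_scaled U V a)) => //.
    move=> d m x [s Js] [z Vz Uz]; rewrite -[d](subrK (s * b)) scalerDl.
    apply: in_subD; first by apply: JVU => //; apply: WV; exists z.
    rewrite -scalerA; apply: in_subZ; rewrite -[x](subrK (a *: z)) scalerDr.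
    apply: in_subD; first exact: in_subZ.
    by rewrite scalerA mulrC; exact: JVU.
  apply: n1 => //; last exact: UW.
  move=> d m x [s Js] Vx; exists (s *: x); first exact: in_subZ.
  by rewrite scalerA [a * s]mulrC -scalerBl; exact: JVU.
have pJ : is_prime J.
  split=> // a b Jab; apply: contrapT => h; apply: np; exists a, b.
  by split=> // h'; apply: h; [left|right].
have [sigma [psig nc]] := sigmaP pJ IJ.
have [r' nr'] := IHa _ nc.
(* The first [r'] cofibres move the class into [U + c V] with [c = sigma e]; the other [r' + 1] kill
   it there. *)
exists (r' + r'.+1)%N => Y V U UV JVU n y Vy Udy.
have UW m x : U m x -> add_scaled U V (sigma e) m x.
  by move=> Ux; exists 0; [exact: in_sub0 | rewrite scaler0 subr0].
apply: (nilp_prime_step psig nr' UV JVU (W := add_scaled U V (sigma e))) => //.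
apply: nr' => //.
- move=> m x [z Vz Uz]; rewrite -[x](subrK ((sigma e : R) *: z)).
  by apply: in_subD; [exact: UV | exact: in_subZ].
- move=> d m x [s Js] Vx; exists (s *: x); first exact: in_subZ.
  by rewrite scalerA [(sigma e : R) * s]mulrC -scalerBl; exact: JVU.
- exact: UW.
Qed.
End NilpotenceTheorem.

Section BoundedNilpotence.
Context (R : comNzRingType) (nR : noetherian R).
Context (Q : complex R) (e : Q 0) (ce : cycle e).
Hypotheses (pQ : forall l, fgproj (Q l))
  (Q0 : exists a : int, forall l (x : Q l), l < a -> x = 0).
Implicit Types Y : complex R.
Local Notation fnull := (fnull ce).
Local Notation cofsub := (cofsub ce).
Local Notation cofib := (cofib ce).

(** In an extension the bound for the lower quotient is needed on the iterated cofibres produced by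
    the upper one, so the statement is carried for [b]-fold cofibres. *)
Fixpoint fnull_all r b Y (V U : subcomplex Y) : Prop :=
  if b is b'.+1 then fnull_all r b' (cofsub V) (cofsub U)
  else forall n (y : Y n), V n y -> U _ (diff Y n (n - 1) y) -> fnull r V U y.

Lemma fnull_all_extend r1 r2 Y (V W U : subcomplex Y) :
  (forall n x, U n x -> W n x) -> (forall n x, W n x -> V n x) ->
  (forall b, fnull_all r1 b V W) -> (forall b, fnull_all r2 b W U) ->
  forall b, fnull_all (r1 + r2) b V U.
Proof.
move=> UW WV h1 h2 b; elim: b Y V W U UW WV h1 h2 => [|b IH] Y V W U UW WV h1 h2; last first.
  apply: (IH _ _ (cofsub W)).
  - exact: cofsub_mono.
  - exact: cofsub_mono.
  - by move=> b'; exact: (h1 b'.+1).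
  - by move=> b'; exact: (h2 b'.+1).
move=> n y Vy Udy; have := h1 0%N n y Vy (UW _ _ Udy); move: Vy Udy.
clear h1; elim: r1 Y V W U n y UW WV h2 => [|r1 IH] Y V W U n y UW WV h2 Vy Udy.
  move=> [w Vw Ww]; rewrite -[y](subrK (diff Y (n + 1) n w)).
  apply: fnullD; last exact: fnull_boundary.
  apply: (fnull_mono (V := W) (U := U)) => //; apply: (h2 0%N) => //.
  by rewrite linearB diff_diff subr0.
move=> h; apply: (IH _ _ (cofsub W)) => //.
- exact: cofsub_mono.
- exact: cofsub_mono.
- by move=> b'; exact: (h2 b'.+1).
- exact: cofsub_eta.
- by rewrite eta_diff; exact: cofsub_eta.
Qed.

Lemma fnull_all_nilp (J : ideal R) r : nilp ce J r ->
  forall b Y (V U : subcomplex Y), (forall n x, U n x -> V n x) ->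
  (forall a n x, J a -> V n x -> U n (a *: x)) -> fnull_all r b V U.
Proof.
move=> nJ; elim=> [|b IH] Y V U UV JVU; first exact: nJ.
apply: IH; first exact: cofsub_mono.
by move=> a n x Ja; apply: cofsub_scale => m z; exact: JVU.
Qed.

Definition acyclic_pair Y (V U : subcomplex Y) : Prop :=
  forall n (v : Y n), V n v -> U _ (diff Y n (n - 1) v) ->
  exists2 w : Y (n + 1), V _ w & U n (v - diff Y (n + 1) n w).

(** Acyclic pairs stay acyclic under cofibres: by [range] the component in [Hom Q Y] is a relative
    boundary, and subtracting it leaves a relative cycle in [Y]. *)
Lemma fnull_all_acyclic b Y (V U : subcomplex Y) :
  (forall n x, U n x -> V n x) -> acyclic_pair V U -> fnull_all 0 b V U.
Proof.
elim: b Y V U => [|b IH] Y V U UV aVU; first by move=> n y Vy Uy; exact: aVU.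
apply: IH; first exact: cofsub_mono.
move=> n [y g] [/= Vy Vg] [/= Uy Ug].
have [a Qa] := Q0.
have [w Vw Uw] : exists2 w : Hom Q Y (n - 1 + 1), hin V w &
    hin U (g - diff (Hom Q Y) (n - 1 + 1) (n - 1) w).
  apply: (@range R Q Y a) => //.
  - by move=> l; apply: fgproj_projective.
  - by move=> i j x; rewrite -[X in U j X]opprK; apply: in_subN; exact: Ug.
  - by move=> l; right=> v; exact: aVU.
have {w Vw Uw}[w Vw Uw] : exists2 w : Hom Q Y n, hin V w &
    hin U (g - diff (Hom Q Y) n (n - 1) w).
  by move: w Vw Uw; rewrite subrK => w; exists w.
have Vyw : V n (y + w 0 n e) by apply: in_subD.
have Udyw : U _ (diff Y n (n - 1) (y + w 0 n e)).
  have dwe : diff Y n (n - 1) (w 0 n e) = diff (Hom Q Y) n (n - 1) w 0 (n - 1) e.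
    by rewrite (@hdE _ _ _ _ _ _ _ n (-1)) ?subrK // (cycleE _ ce) hmap_x0 scaler0 subr0.
  rewrite linearD /= dwe.
  have := in_subB (U (n - 1)) Uy (Uw 0 (n - 1) e); rewrite hmapBE opprB.
  by rewrite addrACA subrr addr0.
have [v Vv Uv] := aVU _ _ Vyw Udyw.
exists ((v, tr (n + 1 - 1) (- w)) : cofib Y (n + 1)).
  split=> //=; move: (n + 1 - 1) (addrK 1 n) => k kn; subst k; rewrite trE => i j x.
  by apply: in_subN.
have E : diff (cofib Y) (n + 1) n ((v, tr (n + 1 - 1) (- w)) : cofib Y (n + 1)) =
    (diff Y (n + 1) n v - w 0 n e, diff (Hom Q Y) n (n - 1) w).
  rewrite cofibE; move: (n + 1 - 1) (addrK 1 n) => k kn; subst k; rewrite trE.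
  by rewrite hmapNE linearN opprK.
suff : cofsub U n (((y, g) : cofib Y n)
    - diff (cofib Y) (n + 1) n ((v, tr (n + 1 - 1) (- w)) : cofib Y (n + 1))) by [].
rewrite E; split; last by move=> i j x; exact: Uw.
have E2 : y - (diff Y (n + 1) n v - w 0 n e) = y + w 0 n e - diff Y (n + 1) n v.
  by rewrite opprB addrA.
have E3 : U n (y - (diff Y (n + 1) n v - w 0 n e)) by rewrite E2.
exact: E3.
Qed.

Context (I : ideal R).
Hypothesis sigmaP : forall p : ideal R, is_prime p -> (forall a, I a -> p a) ->
  exists sigma : {linear Q 0 -> R^o},
    (forall q : Q 1, p (sigma (diff Q 1 0 q))) /\ ~ p (sigma e).

(** The filtration of [Y] by truncations, from the top down: each degree costs [rI] cofibres for its
    homology, which [I] annihilates, and none for the acyclic quotient that follows. *)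
Lemma bounded_nilp Y (a b : int) : (forall l (x : Y l), l < a -> x = 0) ->
  (forall l (x : Y l), b < l -> x = 0) ->
  (forall c n (y : Y n), I c -> cycle y -> boundary (c *: y)) ->
  exists r, forall n (y : Y n), cycle y -> fnull r (full_cx Y) (zero_cx Y) y.
Proof.
move=> Ya Yb IY; have [rI nI] := nilp_exists nR ce pQ sigmaP (fun a h => h).
have zsub (V : subcomplex Y) n x : zero_cx Y n x -> V n x.
  by move=> /= ->; exact: in_sub0.
have claim d : exists r, forall k, fnull_all r k (tcycle Y (b + 1 - d%:Z)) (zero_cx Y).
  elim: d => [|d [r rP]].
    exists 0%N => k; apply: fnull_all_acyclic => [|n v [v0 _] _]; first exact: zsub.
    exists 0; first exact: in_sub0.
    have [nb|bn] := leP n b; last by rewrite (Yb _ v bn) sub0r; apply: in_subN;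
      rewrite linear0; exact: in_sub0.
    rewrite v0; last by lia.
    by rewrite sub0r; apply: in_subN; rewrite linear0; exact: in_sub0.
  set t := b + 1 - d.+1%:Z; have tE : b + 1 - d%:Z = t + 1 by rewrite /t; lia.
  rewrite tE in rP; exists (rI + (0 + r))%N => k.
  apply: (fnull_all_extend (W := tboundary Y t)).
  - exact: zsub.
  - by move=> n x [x0 xb]; split=> // /xb; exact: boundary_cycle.
  - move=> k'; apply: fnull_all_nilp nI _ _ _ _ _ _.
      by move=> n x [x0 xb]; split=> // /xb; exact: boundary_cycle.
    move=> c n x Ic [x0 xc]; split=> [nt|nt]; first by rewrite x0 // scaler0.
    by apply: IY => //; exact: xc.
  move=> k'; apply: (fnull_all_extend (W := tcycle Y (t + 1))).
  - exact: zsub.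
  - by move=> n x [x0 xb]; split=> nt; [|rewrite x0; [exact: boundary0|]]; rewrite ?x0 //; lia.
  - move=> k''; apply: fnull_all_acyclic.
      by move=> n x [x0 xb]; split=> nt; [|rewrite x0; [exact: boundary0|]]; rewrite ?x0 //; lia.
    move=> n v [v0 vb] [dv0 dvc].
    have [nt|] := ltP n t.
      exists 0; first exact: in_sub0.
      by rewrite v0 // sub0r; apply: in_subN; rewrite linear0; exact: in_sub0.
    rewrite le_eqVlt => /predU1P[tn|tn].
      have [w <-] := vb (esym tn); exists w; last by rewrite subrr; exact: in_sub0.
      by split=> h; exfalso; lia.
    exists 0; first exact: in_sub0.
    rewrite (linear0 (diff Y _ _)) subr0; split=> h; first by exfalso; lia.
    by apply: dv0; lia.
  exact: rP.
(* For this length the truncation begins at [a] or below, so it contains every cycle of [Y]. *)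
have [r rP] := claim `|(b + 1 - a)%R|%N.
exists r => n y cy.
apply: (fnull_mono (V := tcycle Y (b + 1 - `|(b + 1 - a)%R|%N%:Z)) (U := zero_cx Y)) => //.
apply: (rP 0%N) => //.
split=> nt //; have na : n < a by lia.
exact: Ya.
Qed.

(* A null class dies in an iterated cofibre; acyclicity of [Hom Q] lets one
   peel off the cofibres again. *)
Lemma fnull_boundary_of r Y (V U : subcomplex Y) n (y : Y n) :
  (forall m x, U m x -> x = 0) ->
  (forall b, (b < r)%N -> acyc (Hom Q (iter b cofib Y)) n) ->
  fnull r V U y -> boundary y.
Proof.
elim: r Y V U n y => [|r IH] Y V U n y U0 hQ /=.
  by move=> [w _ /U0/eqP]; rewrite subr_eq0 => /eqP ->; exists w.
move=> h; have [||[v w]] := IH _ _ _ _ _ _ _ h.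
- move=> m [x g] [/= /U0 -> g0]; congr pair.
  by apply: hmap_eq => i j z; rewrite hmap0E; apply: U0; exact: g0.
- by move=> b br; rewrite -iterSr; apply: hQ.
rewrite cofibE => E.
have vw : diff Y (n + 1) n v + w 0 n e = y := congr1 fst E.
have Dw : diff (Hom Q Y) (n + 1 - 1) (n - 1) w = 0.
  by apply: oppr_inj; rewrite oppr0; exact: (congr1 snd E).
have [u uw] : exists u : Hom Q Y (n + 1), diff (Hom Q Y) (n + 1) n u = (tr n w : Hom Q Y n).
  apply: (hQ 0%N) => //; move: w Dw {vw E}.
  by move: (n + 1 - 1) (addrK 1 n) => k kn w; subst k; rewrite trE.
have wE : w 0 n e = diff Y (n + 1) n (u 0 (n + 1) e).
  have -> : w 0 n e = (tr n w : Hom Q Y n) 0 n e.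
    by move: (n + 1 - 1) (addrK 1 n) w {vw Dw u uw E} => k kn w; subst k; rewrite trE.
  rewrite -uw (@hdE _ _ _ _ _ _ _ (n + 1) (-1)) ?sub0r ?add0r ?addrK //.
  by rewrite (cycleE _ ce) hmap_x0 scaler0 subr0.
exists (v + u 0 (n + 1) e); rewrite linearD -wE; exact: vw.
Qed.
End BoundedNilpotence.

(** * Exchange of arguments in Hom, and acyclicity in windows of degrees *)

Section Swap.
Context (R : comNzRingType).
Implicit Types A B Z : complex R.

Definition swap_fun A B Z n (G : Hom A (Hom B Z) n) (j : int) (b : B j) (i k : int)
  (a : A i) : Z k := (sg (i * j) : R) *: G i (i + n) a j k b.

Program Definition swap_in A B Z n (G : Hom A (Hom B Z) n) j (b : B j) :
    Hom A Z (j + n) :=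
  @Hmap _ _ _ _ _ _ (@swap_fun A B Z n G j b) _ _.
Next Obligation.
by rewrite /swap_fun hmapP hmapDE hmapZE scalerDr !scalerA mulrC.
Qed.
Next Obligation.
rewrite /swap_fun hmap_shape ?scaler0 //; apply/eqP => E; case/eqP: H; lia.
Qed.
Program Definition swap A B Z n (G : Hom A (Hom B Z) n) : Hom B (Hom A Z) n :=
  @Hmap _ _ _ _ _ _ (fun j m b => tr m (swap_in G b)) _ _.
Next Obligation.
rewrite -linearP; congr (tr _ _); apply: hmap_eq => k l a.
rewrite hmapDE hmapZE /= /swap_fun hmapP scalerDr !scalerA.
by congr (_ + _ *: _); rewrite mulrC.
Qed.
Next Obligation. by rewrite tr0. Qed.

Lemma swapE A B Z n (G : Hom A (Hom B Z) n) j m b i k l a :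
  m = j + n -> l = i + n ->
  swap G j m b i k a = (sg (i * j) : R) *: G i l a j k b.
Proof. by move=> -> ->; rewrite /= trE. Qed.

Lemma swapK A B Z n (G : Hom A (Hom B Z) n) : swap (swap G) = G.
Proof.
apply: hmap_eqP => i m a mE; apply: hmap_eqP => j k b kE.
rewrite (swapE _ _ _ _ (l := j + n)) // (swapE _ _ _ _ (l := m)) //.
by rewrite scalerA [i * j]mulrC sgK scale1r.
Qed.

Lemma sgM1 (V : lmodType R) (i j : int) (v : V) :
  (sg (i * (j - 1)) : R) *: v = (sg i : R) *: ((sg (i * j) : R) *: v).
Proof.
by rewrite scalerA mulrBr mulr1 sgD sgN mulrC.
Qed.

Lemma swap_diff A B Z n (G : Hom A (Hom B Z) n) :
  diff (Hom B (Hom A Z)) n (n - 1) (swap G) = swap (diff (Hom A (Hom B Z)) n (n - 1) G).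
Proof.
apply: hmap_eqP => j m b mE; apply: hmap_eqP => i k a kE.
rewrite (@hdE _ _ _ _ _ _ _ (m + 1) (j - 1)) // hmapBE hmapZE.
rewrite (@hdE _ _ _ _ _ _ _ (k + 1) (i - 1)) //; try lia.
rewrite (swapE _ _ _ _ (l := i + n)) //; try lia.
rewrite (swapE _ _ _ _ (l := i + n - 1)) //; try lia.
rewrite (swapE _ _ _ _ (l := i + n)) //; try lia.
rewrite (swapE _ _ _ _ (l := i + n - 1)) //; try lia.
rewrite (@hdE _ _ _ _ _ _ _ (i + n) (i - 1)) ?subrK //; try lia.
rewrite hmapBE hmapZE (@hdE _ _ _ _ _ _ _ (k + 1) (j - 1)) //; try lia.
rewrite linearZ /= [(i - 1) * j]mulrC !sgM1 [j * i]mulrC !scalerBr.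
rewrite -!addrA; congr (_ + _).
have -> : m + 1 = j + n by lia.
rewrite !sgD !scalerA [LHS]addrC; congr (- (_ *: _) - (_ *: _)); first by ring.
by rewrite -[RHS]mul1r -(sgK R j); ring.
Qed.

Lemma swap0 A B Z n : swap (0 : Hom A (Hom B Z) n) = 0.
Proof.
by apply: hmap_eqP => j m b ->; apply: hmap_eqP => i k a kE; rewrite /= trE /= /swap_fun scaler0.
Qed.

Lemma acyc_swap A B Z n : acyc (Hom A (Hom B Z)) n -> acyc (Hom B (Hom A Z)) n.
Proof.
move=> aG x cx; have [|y yx] := aG (swap x); first by rewrite /cycle swap_diff cx swap0.
exists (swap y); have := swap_diff y.
by move: y yx (n + 1 - 1) (addrK 1 n) => y yx k e; subst k; rewrite yx swapK.
Qed.
End Swap.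

Section Windows.
Context (R : comNzRingType).
Implicit Types X Y F Q : complex R.

Definition win X (n : int) (w : nat) : Prop :=
  forall m, n - w%:Z <= m -> m <= n + w%:Z -> acyc X m.
Definition bounded X (d : nat) : Prop := forall l (x : X l), d%:Z < `|l| -> x = 0.

Lemma win_le X n w w' : (w' <= w)%N -> win X n w -> win X n w'.
Proof. by move=> ww h m m1 m2; apply: h; lia. Qed.

Lemma bounded_projective F d : (forall l, fgproj (F l)) -> bounded F d ->
  bounded_below_projective F.
Proof.
move=> pF bF; split; last by move=> l; exact: fgproj_projective.
by exists (- d%:Z) => l x ld; apply: bF; lia.
Qed.

Lemma win_hom F X n w d : (forall l, fgproj (F l)) -> bounded F d ->
  win X n (w + d) -> win (Hom F X) n w.
Proof.
move=> pF bF wX m m1 m2; apply: acyc_hom; first exact: bounded_projective bF.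
move=> l; have [ld|ld] := leP `|l| d%:Z; last by left=> x; exact: bF.
by right; apply: wX; lia.
Qed.

Lemma acyc_cone X Y (f : chain_map X Y) n : acyc Y n -> acyc X (n - 1) -> acyc (cone f) n.
Proof.
move=> aY aX [y x] /= c; have := c; rewrite /cycle coneE => E.
have cx : cycle x.
  by apply: oppr_inj; rewrite oppr0; exact: (congr1 snd E).
have [|u ux] := @boundary_at _ _ _ n x _ (aX _ cx); first by rewrite subrK.
have fu : f (n - 1) (n - 1) x = diff Y n (n - 1) (f n n u) by rewrite chain_mapP ux.
have cy : cycle (y + f n n u).
  by rewrite /cycle linearD -fu; exact: (congr1 fst E).
have [v vy] := aY _ cy.
exists ((v, - tr (n + 1 - 1) u) : cone f (n + 1)); rewrite coneE; congr pair.
  by move: (n + 1 - 1) (addrK 1 n) => k e; subst k; rewrite trE hmapN vy addrK.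
by move: (n + 1 - 1) (addrK 1 n) => k e; subst k; rewrite trE linearN opprK ux.
Qed.

(** The cofibre contains [Hom Q X] moved by one degree, and the outer [Hom Q] spreads it over [d]
    degrees on either side; hence the loss of [d + 1]. *)
Lemma win_cofib Q (e : Q 0) (ce : cycle e) d X n w :
  (forall l, fgproj (Q l)) -> bounded Q d ->
  win (Hom Q X) n (w + d.+1) -> win (Hom Q (cofib ce X)) n w.
Proof.
move=> pQ bQ wX m m1 m2; apply/acyc_hom_cone/acyc_cone; first by apply: wX; lia.
have h : win (Hom Q (Hom Q X)) n w.+1 by apply: win_hom bQ _ => //; rewrite addSnnS.
by apply: h; lia.
Qed.

Lemma win_iter_cofib Q (e : Q 0) (ce : cycle e) d b X n w :
  (forall l, fgproj (Q l)) -> bounded Q d ->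
  win (Hom Q X) n (w + b * d.+1) -> win (Hom Q (iter b (cofib ce) X)) n w.
Proof.
move=> pQ bQ; elim: b w => [|b IH] w /=; first by rewrite addn0.
by move=> h; apply: win_cofib bQ _ => //; apply: IH; rewrite -addnA -mulSn.
Qed.
End Windows.

(** * Koszul complexes *)

Lemma fgproj_prod (R : comNzRingType) (M N : lmodType R) :
  fgproj M -> fgproj N -> fgproj (M * N)%type.
Proof.
move=> [T [x [xi xE]]] [T' [x' [xi' xE']]].
have lin t : linear (fun v : M * N => xi t v.1) by move=> a u v; exact: linearP.
have lin' t : linear (fun v : M * N => xi' t v.2) by move=> a u v; exact: linearP.
exists (T + T')%type.
exists (fun t => match t with inl t => (x t, 0) | inr t => (0, x' t) end).
exists (fun t => match t with inl t => mklin (lin t) | inr t => mklin (lin' t) end).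
move=> [v w]; rewrite big_sumType /=.
have p1 (U : finType) (F : U -> M * N) : (\sum_t F t).1 = \sum_t (F t).1.
  by elim/big_rec2: _ => // t y1 y2 _ <-.
have p2 (U : finType) (F : U -> M * N) : (\sum_t F t).2 = \sum_t (F t).2.
  by elim/big_rec2: _ => // t y1 y2 _ <-.
congr pair.
  rewrite [LHS](xE v) /= !p1 [X in _ = _ + X]big1 ?addr0 // => t _.
  by rewrite /= scaler0.
rewrite [LHS](xE' w) /= !p2 [X in _ = X + _]big1 ?add0r // => t _.
by rewrite /= scaler0.
Qed.

Lemma fgproj_regular (R : comNzRingType) : fgproj (R^o : lmodType R).
Proof.
exists unit, (fun _ => 1), (fun _ => idfun) => v.
by rewrite big_const cardT enumT unlock /= addr0 /GRing.scale /= mulr1.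
Qed.

Section Koszul.
Context (R : comNzRingType).
Implicit Types X Y K : complex R.

Lemma scal_cycle (x : R) K : cycle (x *: hid K : Hom K K 0).
Proof. by apply: cycleZ; exact: hid_cycle. Qed.
Definition scal (x : R) K : chain_map K K := mkchain (scal_cycle x K).
Lemma scalE x K i y : scal x K i i y = x *: y.
Proof. by rewrite -[in RHS](hidE y) -hmapZE. Qed.

Fixpoint kos (xs : seq R) : complex R :=
  if xs is x :: xs' then cone (scal x (kos xs')) else sphere (R^o : lmodType R).

Lemma kos_fgproj xs l : fgproj (kos xs l).
Proof.
elim: xs l => [|x xs IH] l; last exact: fgproj_prod.
have [->|l0] := eqVneq l 0; first exact: fgproj_regular.
by apply: fgproj0 => v; exact: sphere0.
Qed.

Lemma kos_zero xs l (v : kos xs l) : (l < 0) || ((size xs)%:Z < l) -> v = 0.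
Proof.
elim: xs l v => [|x xs IH] l v lP; first by apply: sphere0; move: lP => /=; lia.
by case: v => y z; congr pair; apply: IH; move: lP => /=; lia.
Qed.

Definition null_scalar K (a : R) : Prop := boundary (a *: hid K : Hom K K 0).

Lemma null_scalar_cone x K : null_scalar (cone (scal x K)) x.
Proof.
pose f i j (v : cone (scal x K) i) : cone (scal x K) j := (0, tr (j - 1) v.1).
have fl i j : linear (@f i j).
  by move=> a [u u'] [w w']; congr pair; rewrite /= ?linearP // scaler0 addr0.
have fs i j v : j != i + 1 -> @f i j v = 0.
  move=> ji; congr pair; rewrite tr0 //; apply/eqP => E; case/eqP: ji; lia.
exists (mkhmap fl fs : Hom (cone (scal x K)) (cone (scal x K)) 1).
apply: hmap_eqP => i j v; rewrite addr0 => ->; case: v => y z.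
rewrite (@hdE _ _ _ _ _ _ _ (i + 1) (i - 1)) // hmapZE hidE.
have fE a b (v : cone (scal x K) a) : mkhmap fl fs a b v = (0, tr (b - 1) v.1) by [].
rewrite !fE !coneE (sgS _ 0) sg0 scaleN1r opprK linear0 add0r.
rewrite [X in _ + (0, X)]/= trE [(y, z).1]/=.
move: (i + 1 - 1) (addrK 1 i) => k e; subst k; rewrite !trE !scalE.
congr pair; first by rewrite /= addr0.
by rewrite /= /hid_fun trE addKr.
Qed.

(** A homotopy on [K] commutes with multiplication by [x'], so it acts on the cone componentwise,
    with a sign on the shifted copy. *)
Lemma null_scalar_consS x x' K : null_scalar K x -> null_scalar (cone (scal x' K)) x.
Proof.
move=> [h hE].
pose f i j (v : cone (scal x' K) i) : cone (scal x' K) j := (h i j v.1, - h (i - 1) (j - 1) v.2).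
have fl i j : linear (@f i j).
  move=> a [u u'] [w w']; congr pair; rewrite /= hmapP // opprD scalerN //.
have fs i j v : j != i + 1 -> @f i j v = 0.
  move=> ji; congr pair; rewrite hmap_shape ?oppr0 //; apply/eqP => E; case/eqP: ji; lia.
exists (mkhmap fl fs : Hom (cone (scal x' K)) (cone (scal x' K)) 1).
have hP i y : x *: y = diff K (i + 1) i (h i (i + 1) y) + h (i - 1) i (diff K i (i - 1) y).
  have <- : (x *: hid K : Hom K K 0) i i y = x *: y by rewrite hmapZE hidE.
  rewrite -hE (@hdE _ _ _ _ _ _ _ (i + 1) (i - 1)) //.
  by rewrite (sgS _ 0) sg0 scaleN1r opprK.
apply: hmap_eqP => i j v; rewrite addr0 => ->; case: v => y z.
rewrite (@hdE _ _ _ _ _ _ _ (i + 1) (i - 1)) // hmapZE hidE.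
have fE a b (v : cone (scal x' K) a) :
  mkhmap fl fs a b v = (h a b v.1, - h (a - 1) (b - 1) v.2) by [].
rewrite !fE !coneE scalE (sgS _ 0) sg0 scaleN1r opprK.
congr pair; rewrite [LHS]/= [RHS]/=.
  have -> : h (i - 1) (i + 1 - 1) z = tr (i + 1 - 1) (h (i - 1) i z : K i).
    by rewrite tr_hmap // addrK.
  rewrite hP -[LHS]addrA; congr (_ + _); rewrite hmapD hmapZr /hid_fun.
  move: (i + 1 - 1) (addrK 1 i) => k e; subst k; rewrite !trE scalerN.
  by rewrite [LHS]addrC addrK.
rewrite hP !linearN hmapN !opprK; congr (_ + _).
by move: (i + 1 - 1) (addrK 1 i) (i - 1 + 1) (subrK 1 i) => k e k' e'; subst k k'.
Qed.

Lemma null_scalar_kos xs x : x \in xs -> null_scalar (kos xs) x.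
Proof.
elim: xs => [//|y xs IH]; rewrite in_cons => /predU1P[->|/IH].
  exact: null_scalar_cone.
exact: null_scalar_consS.
Qed.

Lemma null_scalar_sum K k (g a : 'I_k -> R) : (forall i, null_scalar K (g i)) ->
  null_scalar K (\sum_i a i * g i).
Proof.
move=> h; rewrite /null_scalar scaler_suml; apply: boundary_sum => i.
by rewrite -scalerA; apply: boundaryZ; exact: h.
Qed.

Lemma null_scalar_boundary K X a n (y : Hom K X n) :
  null_scalar K a -> cycle y -> boundary (a *: y).
Proof.
move=> [h hE] cy; rewrite -[y]hcomp1 -hcompZr -hE.
rewrite -[hcomp _ _ _]scale1r -(sgK _ n) -scalerA; apply: boundaryZ.
have E : diff (Hom K X) (n + 1) n (hcomp (n + 1) y h) =
    hcomp n (diff (Hom K X) n (n - 1) y) h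
      + sg n *: hcomp n y (diff (Hom K K) (0 + 1) 0 h).
  by apply: hcomp_diff; lia.
rewrite -[_ *: _]add0r -(@hcomp0l _ K K X _ (n - 1) n h) -cy -E; exact: boundaryI.
Qed.

Context (nR : noetherian R).

(** Extend a cycle [u] of degree [n + 1] by zero to a cycle on the cone. The extension is a
    boundary, so [u] is, up to boundaries, [x] times a cycle. Nakayama's lemma gives a multiplier
    congruent to 1 modulo [x] that kills the homology, and it is a unit since [x] lies in every
    maximal ideal. *)
Lemma kos_step x xs X n : (forall m : {pred R}, maximal_ideal m -> x \in m) ->
  degreewise_homologically_finite X -> acyc (Hom (kos (x :: xs)) X) n ->
  acyc (Hom (kos xs) X) (n + 1).
Proof.
move=> xm fX aX; set K := kos xs in aX *.
have fK : homology_fin_gen (Hom K X) (n + 1).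
  apply: (@hom_fg _ nR K X (n + 1) (size xs)%:Z) => //.
  - by exists 0 => l v l0; apply: kos_zero; rewrite l0.
  - exact: kos_fgproj.
  - by move=> l ls; left=> v; apply: kos_zero; rewrite ls orbT.
pose a : ideal R := ideal_add (zero_submodule R^o) x.
have [u cu|s [r rE] sb] := homology_nakayama (a := a) fK.
  have cV : cycle (hcopair (scal x K) (0 : Hom K X n) u : Hom (cone (scal x K)) X n).
    apply: hmap_eqP => i j [y z] jE; rewrite (hcopair_diff _ _ _ _ _ jE).
    by rewrite linear0 (cycleE _ cu) !hmap0E scaler0 subr0 addr0.
  have [V VE] := aX _ cV; rewrite -(hcopairK V) in VE.
  move: (hinl V) (hinr V) VE => v w VE.
  have E0 i j y z : j = i + n -> (0 : Hom K X n) i j y + u (i - 1) j z =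
      diff (Hom K X) (n + 1) n v i j y +
        (diff (Hom K X) (n + 1 + 1) (n + 1) w (i - 1) j z
           - sg (n + 1) *: v (i - 1) j (scal x K (i - 1) (i - 1) z)).
    move=> jE; have e : n = n + 1 - 1 by rewrite addrK.
    have := congr1 (fun g : Hom (cone (scal x K)) X n => g i j (y, z)) VE.
    have -> : diff (Hom (cone (scal x K)) X) (n + 1) n (hcopair (scal x K) v w) =
      tr n (diff (Hom (cone (scal x K)) X) (n + 1) (n + 1 - 1) (hcopair (scal x K) v w)).
      by rewrite tr_diff // addrK.
    have -> : diff (Hom K X) (n + 1) n v =
      tr n (diff (Hom K X) (n + 1) (n + 1 - 1) v).
      by rewrite tr_diff // addrK.
    have := @hcopair_diff _ _ _ _ (scal x K) (n + 1) v w i j y z.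
    move: (n + 1 - 1) (addrK 1 n) => k kn; subst k; by rewrite !trE => -> // ->.
  have cv : cycle v.
    rewrite /cycle addrK; apply: hmap_eqP => i j y jE; have := E0 i j y 0 jE.
    by rewrite !hmap_x0 scaler0 subr0 !addr0 => E1; rewrite hmap0E.
  exists x, (- sg (n + 1) *: v); split=> //.
  - by exists 1; rewrite mul1r subrr.
  - exact: cycleZ.
  exists w; apply: hmap_eqP => i j z jE.
  have := E0 (i + 1) j 0 (tr (i + 1 - 1) z); rewrite !hmap_x0 !add0r.
  move: (i + 1 - 1) (addrK 1 i) => k e; subst k; rewrite trE => E1.
  rewrite hmapBE !hmapZE E1; last by lia.
  by rewrite scalE hmapZr scaleNr scalerN opprK !scalerA [x * _]mulrC subrK.
have [t ts] : exists t, t * s = 1.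
  apply: (unit_of_maximal nR) => m mm; apply/negP => sm.
  have [[m0 m1 mc] _] := mm.
  have xm' := xm _ mm; case/negP: m1.
  have := mc (- r) x s xm' sm; move: rE => /= /eqP; rewrite subr_eq0 => /eqP rE.
  by rewrite mulNr -rE opprB subrK.
move=> y cy; rewrite -[y]scale1r -ts -scalerA; apply: boundaryZ; exact: sb.
Qed.

Lemma acyc_hom_sphere X n : acyc (Hom (sphere (R^o : lmodType R)) X) n -> acyc X n.
Proof.
move=> aX x cx; have e : n = 0 + n by rewrite add0r.
have lin : linear (fun r : sphere (R^o : lmodType R) 0 => (r : R) *: x).
  by move=> a u v; rewrite scalerDl scalerA.
pose g : Hom (sphere (R^o : lmodType R)) X n := hsingle e (mklin lin).
have gE i j r : g i j r = tr j ((tr 0 r : R) *: x) by [].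
have [|w wE] := aX g.
  apply: hmap_eqP => i j r jE; rewrite (@hdE _ _ _ _ _ _ _ (j + 1) (i - 1)) // hmap0E.
  have [i0|i0] := eqVneq i 0; last first.
    by rewrite (sphere0 r i0) !linear0 !hmap_x0 linear0 scaler0 subr0.
  subst i; rewrite gE diff_tr; last by lia.
  have -> : diff X n j ((tr 0 r : R) *: x) = 0 by rewrite linearZ /= (cycleE _ cx) scaler0.
  rewrite gE; have -> : tr 0 (diff (sphere (R^o : lmodType R)) 0 (0 - 1) r) = 0 by rewrite linear0.
  by rewrite scale0r (linear0 (tr j)) scaler0 subr0.
exists (w 0 (n + 1) (1 : R)).
have := congr1 (fun h : Hom (sphere (R^o : lmodType R)) X n => h 0 n (1 : R)) wE.
rewrite (@hdE _ _ _ _ _ _ _ (n + 1) (0 - 1)) ?addrK // hmap_x0 scaler0 subr0 => ->.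
by rewrite gE !trE scale1r.
Qed.

Lemma kos_acyc xs X n :
  (forall x, x \in xs -> forall m : {pred R}, maximal_ideal m -> x \in m) ->
  degreewise_homologically_finite X -> acyc (Hom (kos xs) X) n ->
  acyc X (n + (size xs)%:Z).
Proof.
move=> xsm fX; elim: xs n xsm => [|x xs IH] n xsm /= aX.
  by rewrite addr0; exact: acyc_hom_sphere.
have -> : n + (size xs).+1%:Z = n + 1 + (size xs)%:Z by lia.
apply: IH; first by move=> y ys; apply: xsm; rewrite in_cons ys orbT.
by apply: (@kos_step x) => //; apply: xsm; rewrite in_cons eqxx.
Qed.
End Koszul.

Section WindowTheorem.
Context (R : comNzRingType) (nR : noetherian R).
Context (Q : complex R) (e : Q 0) (ce : cycle e) (d : nat).
Hypotheses (pQ : forall l, fgproj (Q l)) (bQ : bounded Q d).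
Context (I : ideal R).
Hypothesis sigmaP : forall p : ideal R, is_prime p -> (forall a, I a -> p a) ->
  exists sigma : {linear Q 0 -> R^o},
    (forall q : Q 1, p (sigma (diff Q 1 0 q))) /\ ~ p (sigma e).
Hypothesis I_rad : forall a : R, I a -> forall m : {pred R}, maximal_ideal m -> a \in m.

(** After a shift, a cycle of [Hom K X] is a chain map [f] defined on [K], that is, the identity of
    [K] composed with [f]. The identity dies in the [r]-fold cofibre of [Hom K K], for an [r] that
    does not involve [X]; by naturality so does [f], and the window allows the cofibres to be
    removed again. *)
Lemma acyc_window : exists w : nat, forall X,
  degreewise_homologically_finite X -> forall n, win (Hom Q X) n w -> acyc X n.
Proof.
have [k [g gE]] := noetherian_fg nR I.
pose xs := [seq g i | i <- enum 'I_k]; pose K := kos xs.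
have bK : bounded K (size xs) by move=> l x lx; apply: kos_zero; lia.
have IK (c : R) : I c -> null_scalar K c.
  move=> /gE[a ->]; apply: null_scalar_sum => i; apply: null_scalar_kos.
  by apply: map_f; rewrite mem_enum.
have Q0 : exists a : int, forall l (x : Q l), l < a -> x = 0.
  by exists (- d%:Z) => l x ld; apply: bQ; lia.
have [r rP] : exists r, forall n (y : Hom K K n), cycle y ->
    fnull ce r (full_cx (Hom K K)) (zero_cx (Hom K K)) y.
  apply: (bounded_nilp nR ce pQ Q0 sigmaP (a := - (size xs)%:Z) (b := (size xs)%:Z)).
  - move=> l x lx; apply: hmap_eqP => i j z jE.
    have [i0|i0] := leP i (size xs)%:Z.
      by rewrite [LHS](kos_zero (xs := xs)) //; apply/orP; left; lia.
    by rewrite (kos_zero (xs := xs) z) ?hmap_x0 //; apply/orP; right.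
  - move=> l x lx; apply: hmap_eqP => i j z jE.
    have [i0|i0] := leP 0 i.
      by rewrite [LHS](kos_zero (xs := xs)) //; apply/orP; right; lia.
    by rewrite (kos_zero (xs := xs) z) ?hmap_x0 // i0.
  - by move=> c n y Ic cy; apply: null_scalar_boundary => //; exact: IK.
(* Removing [r] cofibres costs [r * d.+1] degrees, the functor [Hom K] costs [size xs], and
   [kos_acyc] moves the centre by another [size xs]. *)
exists (0 + r * d.+1 + size xs + size xs)%N => X fX n wX.
rewrite -[n](subrK (size xs)%:Z); apply: (kos_acyc nR) => //.
  by move=> x /mapP[i _ ->]; apply: I_rad; apply/gE; exists (fun j => (j == i)%:R);
    rewrite (bigD1 i) //= eqxx mul1r big1 ?addr0 // => j /negPf ->; rewrite mul0r.
set s := n - (size xs)%:Z; rewrite -/K -[s]add0r; apply/acyc_hom_shift.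
move=> z cz; pose f : chain_map K (shift X s) := mkchain cz.
apply: (fnull_boundary_of (ce := ce) (r := r) (V := full_cx _) (U := zero_cx _)) => //.
  move=> b br; have h : win (Hom Q (Hom K (shift X s))) 0 (0 + r * d.+1).
    move=> m m1 m2; apply: acyc_swap.
    apply: (win_hom (d := size xs) (w := 0 + r * d.+1) (n := 0)) => //; first exact: kos_fgproj.
    move=> l l1 l2; apply/acyc_hom_shift; apply: wX; rewrite /s; lia.
  have h2 : win (Hom Q (iter b (cofib ce) (Hom K (shift X s)))) 0 0.
    apply: (win_iter_cofib (d := d)) => //.
    by apply: win_le h; rewrite leq_add2l leq_mul2r ltnW ?orbT.
  by apply: h2; rewrite ?subr0 ?addr0.
have -> : z = post K f 0 0 (hid K) by rewrite -[LHS](hcomp1 (z : Hom K (shift X s) 0)).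
apply: (fnull_map (V := full_cx _) (U := zero_cx _)) => //.
  by move=> i j x x0; have -> : x = 0 := x0; exact: hmap_x0.
exact: rP (hid_cycle K).
Qed.
End WindowTheorem.

(** * Endomorphisms of a finite projective resolution *)

Lemma fgproj_sum (R : comNzRingType) (L : finType) (M : lmodType R)
    (N : L -> lmodType R) (p : forall l, {linear M -> N l})
    (i : forall l, {linear N l -> M}) :
  (forall v, v = \sum_l i l (p l v)) -> (forall l, fgproj (N l)) -> fgproj M.
Proof.
move=> ipE fN; pose T l := projT1 (cid (fN l)).
pose x l := projT1 (cid (projT2 (cid (fN l)))).
pose xi l := projT1 (cid (projT2 (cid (projT2 (cid (fN l)))))).
have xE l v : v = \sum_t xi l t v *: x l t := projT2 (cid (projT2 (cid (projT2 (cid (fN l)))))) v.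
exists {l : L & T l}, (fun t => i _ (x _ (tagged t))).
exists (fun t => xi _ (tagged t) \o p (tag t)) => v; rewrite [LHS]ipE.
rewrite -(sig_big_dep (fun _ => true) (fun _ _ => true)
  (fun l t => (xi l t (p l v) : R) *: i l (x l t))) /=.
apply: eq_bigr => l _; rewrite [in LHS](xE l (p l v)) linear_sum; apply: eq_bigr => t _.
by rewrite linearZ.
Qed.

Section TotalBasis.
Context (R : comNzRingType) (P : complex R).

(** A dual basis of all degrees at once, each element carrying its own degree, so that a graded
    expansion is one finite sum. *)
Definition total_basis (B : finType) (deg : B -> int) (x : forall b, P (deg b))
    (xi : forall b, {linear P (deg b) -> R^o}) : Prop :=
  forall l (v : P l), v = \sum_b (xi b (tr (deg b) v) : R) *: tr l (x b).

Lemma total_basis_exists d : (forall l, fgproj (P l)) -> bounded P d ->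
  exists (B : finType) (deg : B -> int) x xi, @total_basis B deg x xi.
Proof.
move=> pP bP; pose dg (i : 'I_d.*2.+1) : int := i%:Z - d%:Z.
pose T l := projT1 (cid (pP l)).
pose x l := projT1 (cid (projT2 (cid (pP l)))).
pose xi l := projT1 (cid (projT2 (cid (projT2 (cid (pP l)))))).
have xE l v : v = \sum_t xi l t v *: x l t := projT2 (cid (projT2 (cid (projT2 (cid (pP l)))))) v.
exists {i : 'I_d.*2.+1 & T (dg i)}, (fun b => dg (tag b)).
exists (fun b => x _ (tagged b)), (fun b => xi _ (tagged b)) => l v.
rewrite -(sig_big_dep (fun _ => true) (fun _ _ => true)
  (fun i t => (xi (dg i) t (tr (dg i) v) : R) *: tr l (x (dg i) t))) /=.
have [ld|ld] := leP `|l| d%:Z; last first.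
  rewrite [LHS](bP _ v ld) big1 // => i _; rewrite big1 // => t _.
  by rewrite (bP _ v ld) !linear0 scale0r.
have li : (`|(l + d%:Z)%R|%N < d.*2.+1)%N by lia.
have lE : dg (Ordinal li) = l by rewrite /dg /=; lia.
rewrite (bigD1 (Ordinal li)) //= [X in _ + X]big1 ?addr0 => [|i il]; last first.
  rewrite big1 // => t _; rewrite tr0 ?linear0 ?scale0r //; apply/eqP => e.
  by case/eqP: il; apply: val_inj; move: e lE; rewrite /dg /=; lia.
move: (dg (Ordinal li)) lE => k e; subst k; rewrite [LHS]xE.
by apply: eq_bigr => t _; rewrite !trE.
Qed.

Context (B : finType) (deg : B -> int) (x : forall b, P (deg b))
  (xi : forall b, {linear P (deg b) -> R^o}) (xE : total_basis x xi).

Lemma hmap_total_basis (Y : complex R) n (g : Hom P Y n) i j v : j = i + n ->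
  g i j v = \sum_b (xi b (tr (deg b) v) : R) *: tr j (g (deg b) (deg b + n) (x b)).
Proof.
move=> ->; rewrite [in LHS](xE v) hmap_sum; apply: eq_bigr => b _; rewrite hmapZr.
have [e|e] := eqVneq (deg b) i; first by subst i; rewrite !trE.
by rewrite [tr (deg b) v]tr0 // linear0 !scale0r.
Qed.

Lemma dyad_linear (M : lmodType R) b (y : M) : linear (fun v => (xi b v : R) *: y).
Proof. by move=> a u v; rewrite linearP scalerDl -scalerA. Qed.
Definition dyad (Y : complex R) n b m (e : m = deg b + n) (y : Y m) : Hom P Y n :=
  hsingle e (mklin (@dyad_linear (Y m) b y)).
Lemma dyadE (Y : complex R) n b m (e : m = deg b + n) (y : Y m) i j v :
  dyad e y i j v = tr j ((xi b (tr (deg b) v) : R) *: y).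
Proof. by []. Qed.

Lemma hom_total_basis (Y : complex R) n (g : Hom P Y n) :
  g = \sum_b dyad (erefl (deg b + n)) (g (deg b) (deg b + n) (x b)).
Proof.
apply: hmap_eqP => i j v jE; rewrite hmap_sumE (hmap_total_basis _ _ jE).
by apply: eq_bigr => b _; rewrite dyadE linearZ.
Qed.

Lemma hom_fgproj (Y : complex R) n : (forall l, fgproj (Y l)) -> fgproj (Hom P Y n).
Proof.
move=> pY.
have lp b : linear (fun g : Hom P Y n => g (deg b) (deg b + n) (x b)).
  by move=> a u v; rewrite hmapDE hmapZE.
have li b : linear (fun y : Y (deg b + n) => dyad (erefl (deg b + n)) y : Hom P Y n).
  move=> a u v; apply: hmap_eq => i j z; rewrite hmapDE hmapZE !dyadE.
  by rewrite scalerDr scalerA mulrC -scalerA linearP.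
by apply: (fgproj_sum (p := fun b => mklin (lp b)) (i := fun b => mklin (li b))) => [g|b];
  [exact: hom_total_basis | exact: pY].
Qed.

Lemma hom_bounded (Y : complex R) d d' : bounded P d -> bounded Y d' ->
  bounded (Hom P Y) (d + d').
Proof.
move=> bP bY l g ld; apply: hmap_eqP => i j v jE.
have [id|id] := leP `|i| d%:Z; last by rewrite (bP _ v id) !hmap_x0.
by rewrite [LHS](bY _ _ _) //; lia.
Qed.
End TotalBasis.

Section EndomorphismWindow.
Context (R S : comNzRingType) (phi : {rmorphism R -> S}).
Context (nR : noetherian R) (phi_finite : fin_gen (restrict phi S^o)).
Local Notation SR := (restrict phi S^o : lmodType R).
Context (P : complex R) (eps : chain_map P (sphere SR)) (d : nat).
Hypotheses (pP : forall l, fgproj (P l)) (P0 : forall l (x : P l), l < 0 -> x = 0)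
  (bP : bounded P d) (qe : quasi_iso eps).

Lemma resolution_unit : exists e0 : P 0, eps 0 0 e0 = (1 : S).
Proof.
have [e0 _ /sphere_boundary/eqP] := (qe 0).2 (1 : S) (sphere_cycle _).
by rewrite subr_eq0 => /eqP e; exists e0.
Qed.

Definition phi_ker : ideal R.
Proof.
refine (@Submodule R R^o (fun a : R => phi a = 0) _ _ _).
- exact: rmorph0.
- by move=> a b ha hb; rewrite rmorphD ha hb addr0.
- by move=> a b hb; rewrite /GRing.scale /= rmorphM hb mulr0.
Defined.

(** An endomorphism [t] is sent to [lam] of the class of [t e0] in [S], where [e0] lifts 1. A
    boundary has class zero, since [e0] has no differential and [eps] kills boundaries; the identity
    gives [lam 1]. As [lam] is linear only modulo [p], the formula is linearized through a dual
    basis of the degree 0 endomorphisms. *)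
Lemma endomorphism_functional (p : ideal R) : is_prime p ->
  (forall a, phi_ker a -> p a) ->
  exists sigma : {linear Hom P P 0 -> R^o},
    (forall q : Hom P P 1, p (sigma (diff (Hom P P) 1 0 q))) /\ ~ p (sigma (hid P)).
Proof.
move=> pp kp; have [lam [lamP lam1]] := lying_over_functional phi_finite pp kp.
have [e0 e0E] := resolution_unit.
have [B [deg [x [xi xE]]]] := total_basis_exists pP bP.
have [T [th [Xi XiE]]] := hom_fgproj xE 0 pP.
pose f (t : Hom P P 0) : R := lam (eps 0 0 (t 0 0 e0)).
have lin : linear (fun t : Hom P P 0 => \sum_i (Xi i t : R) *: (f (th i) : R^o)).
  move=> a u v; rewrite scaler_sumr -big_split; apply: eq_bigr => i _ /=.
  by rewrite linearP scalerDl scalerA.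
have lam0 : p (lam 0).
  have := lamP 1 0 0; rewrite scaler0 addr0 mul1r opprD addrA subrr sub0r => h.
  by rewrite -[lam 0]opprK; exact: in_subN.
have fP t : p (\sum_i (Xi i t : R) *: (f (th i) : R^o) - f t).
  have -> : f t = lam (\sum_i (Xi i t : R) *: eps 0 0 (th i 0 0 e0)).
    rewrite /f [in LHS](XiE t) hmap_sumE hmap_sum; congr lam; apply: eq_bigr => i _.
    by rewrite hmapZE hmapZr.
  elim/big_rec2: _ => [|i y1 y2 _ IH]; first by rewrite sub0r; apply: in_subN.
  have := in_subB p IH (lamP (Xi i t) (eps 0 0 (th i 0 0 e0)) y1).
  rewrite opprB /GRing.scale /= -/(f (th i)) => h.
  by move: h; congr (p _); ring.
exists (mklin lin); split=> [q|].
  have := fP (diff (Hom P P) 1 0 q); set A := \sum_i _ => h.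
  apply: (in_subDr p (- f (diff (Hom P P) 1 0 q))) => //; apply: in_subN.
  rewrite /f (@hdE _ _ _ _ _ _ _ 1 (-1)) // (P0 (diff P 0 (-1) e0)) // hmap_x0 scaler0 subr0.
  rewrite -(@chain_mapP _ _ _ eps 1 0 (q 0 1 e0)); exact: lam0.
move=> h; apply: lam1; have := in_subB p h (fP (hid P)).
by rewrite opprB addrC subrK /f hidE e0E.
Qed.

Lemma acyc_hom_endomorphism_window : (forall a : R, phi a = 0 ->
    forall m : {pred R}, maximal_ideal m -> a \in m) ->
  exists w : nat, forall X, degreewise_homologically_finite X ->
    forall n, win (Hom (Hom P P) X) n w -> acyc X n.
Proof.
move=> kr; have [B [deg [x [xi xE]]]] := total_basis_exists pP bP.
apply: (@acyc_window R nR _ _ (hid_cycle P) (d + d)%N _ _ phi_ker) => //.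
- by move=> l; exact: (hom_fgproj xE).
- exact: hom_bounded.
- exact: endomorphism_functional.
Qed.
End EndomorphismWindow.

(** * Tensor evaluation and biduality *)

Notation sphereR R := (sphere (GRing.regular R : lmodType R)).

Section Evaluation.
Context (R : comNzRingType) (P : complex R).
Implicit Types Y Z : complex R.

Definition dual : complex R := Hom P (sphereR R).

(** The image of [xi] tensor [y] in [Hom P Y]. For a finite projective [P] such maps span [Hom P Y],
    which thereby stands in for the tensor product of the dual with [Y]. *)
Definition mu_fun Y u v w (xi : dual u) (y : Y v) (i j : int) (p : P i) : Y j :=
  if w == u + v then (xi i 0 p : R) *: tr j y else 0.
Program Definition mu Y u v w (xi : dual u) (y : Y v) : Hom P Y w :=
  @Hmap _ _ _ _ _ _ (@mu_fun Y u v w xi y) _ _.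
Next Obligation.
rewrite /mu_fun; case: eqP => _; last by rewrite scaler0 addr0.
by rewrite hmapP scalerDl -scalerA.
Qed.
Next Obligation.
rewrite /mu_fun; case: eqP => // w_uv; have [jv|jv] := eqVneq j v; last first.
  by rewrite tr0 ?scaler0.
rewrite (_ : xi i 0 x = 0) ?scale0r //; apply: hmap_shape.
by apply/eqP => E; case/eqP: H; lia.
Qed.

Lemma muE Y u v w (xi : dual u) (y : Y v) i j p : w = u + v ->
  mu w xi y i j p = (xi i 0 p : R) *: tr j y.
Proof. by move=> e; rewrite /= /mu_fun e eqxx. Qed.

Lemma muDl Y u v w a (xi xi' : dual u) (y : Y v) :
  mu w (a *: xi + xi') y = a *: mu w xi y + mu w xi' y.
Proof.
apply: hmap_eq => i j p; rewrite hmapDE hmapZE /= /mu_fun.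
by case: eqP => _; [rewrite scalerDl hmapZE scalerA | rewrite scaler0 addr0].
Qed.
Lemma muDr Y u v w a (xi : dual u) (y y' : Y v) :
  mu w xi (a *: y + y') = a *: mu w xi y + mu w xi y'.
Proof.
apply: hmap_eq => i j p; rewrite hmapDE hmapZE /= /mu_fun.
case: eqP => _; rewrite ?scaler0 ?addr0 // linearP scalerDr.
by rewrite !scalerA mulrC.
Qed.

Lemma mu_diff Y u v w w' u' v' (xi : dual u) (y : Y v) :
  w = u + v -> w' = w - 1 -> u' = u - 1 -> v' = v - 1 ->
  diff (Hom P Y) w w' (mu w xi y) =
    (sg v : R) *: mu w' (diff dual u u' xi) y + mu w' xi (diff Y v v' y).
Proof.
move=> wE wE' uE vE; apply: hmap_eqP => i j p jE.
rewrite (@hdE _ _ _ _ _ _ _ (j + 1) (i - 1)) // hmapDE hmapZE.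
rewrite !muE; try lia.
rewrite (@hdE _ _ _ _ _ _ _ (0 + 1) (i - 1)) // /= sub0r linearZ /=.
rewrite [RHS]addrC; congr (_ + _).
  have [jv|jv] := eqVneq (j + 1) v.
    by rewrite (diff_tr _ _ (esym jv)) [tr j (diff Y v v' y)]tr_diff //; lia.
  have -> : xi i 0 p = 0 by apply: hmap_shape; apply/eqP => E; case/eqP: jv; lia.
  by rewrite !scale0r.
rewrite scaleNr scalerN wE sgD; congr (- _).
by rewrite -[in RHS]scalerA [RHS]scalerA [sg u * _]mulrC.
Qed.

Section Phi.
Context (Y Z : complex R).

Program Definition phi_in n (G : Hom (Hom P Y) Z n) u (xi : dual u) :
    Hom Y Z (u + n) :=
  @Hmap _ _ _ _ _ _ (fun v k y =>
    (sg (u * v) : R) *: G (u + v) k (mu (u + v) xi y)) _ _.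
Next Obligation. by rewrite muDr hmapP scalerDr !scalerA mulrC. Qed.
Next Obligation.
by rewrite hmap_shape ?scaler0 //; apply/eqP => E; case/eqP: H; lia.
Qed.
(** Tensor evaluation followed by adjunction: a map out of [Hom P Y] is a map from the dual into
    [Hom Y Z]. It serves twice, for the biduality square with [Y = Z] and, with [Y = P], to rewrite
    [Hom (Hom P P) X]. *)
Program Definition phi_map n (G : Hom (Hom P Y) Z n) : Hom dual (Hom Y Z) n :=
  @Hmap _ _ _ _ _ _ (fun u m xi => tr m (phi_in G xi)) _ _.
Next Obligation.
rewrite -linearP; congr (tr _ _); apply: hmap_eq => v k z.
by rewrite hmapDE hmapZE /= muDl hmapP scalerDr !scalerA mulrC.
Qed.
Next Obligation. by rewrite tr0. Qed.

Lemma phi_mapE n (G : Hom (Hom P Y) Z n) u m xi v k w y : m = u + n -> w = u + v ->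
  phi_map G u m xi v k y = (sg (u * v) : R) *: G w k (mu w xi y).
Proof. by move=> -> ->; rewrite /= trE. Qed.

Lemma sgM1l (V : lmodType R) (i j : int) (v : V) :
  (sg ((i - 1) * j) : R) *: v = (sg j : R) *: ((sg (i * j) : R) *: v).
Proof. by rewrite mulrC sgM1 [j * i]mulrC. Qed.

Lemma phi_map_hmor : hmor phi_map.
Proof.
apply: hmorI => [n G G'|n m G mE].
  apply: hmap_eqP => u m xi ->; apply: hmap_eqP => v k y kE.
  by rewrite !hmapBE !(phi_mapE _ _ _ _ erefl erefl) hmapBE scalerBr.
subst m; apply: hmap_eqP => u m xi mE; apply: hmap_eqP => v k y kE.
rewrite (@hdE _ _ _ _ _ _ _ (m + 1) (u - 1)) // hmapBE hmapZE.
rewrite (@hdE _ _ _ _ _ _ _ (k + 1) (v - 1)) //; try lia.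
rewrite (phi_mapE _ _ _ _ (w := u + v)) //; try lia.
rewrite (phi_mapE _ _ _ _ (w := u + v - 1)) //; try lia.
rewrite (phi_mapE _ _ _ _ (w := u + v - 1)) //; try lia.
rewrite (phi_mapE _ _ _ _ (w := u + v)) //; try lia.
rewrite (@hdE _ _ _ _ _ _ _ (k + 1) (u + v - 1)) //; try lia.
rewrite (mu_diff _ _ (u' := u - 1) (v' := v - 1)) // hmapD hmapZr.
rewrite linearZ /= sgM1 sgM1l scalerBr !scalerDr opprD -!addrA; congr (_ + _).
have -> : m + 1 = u + n by lia.
rewrite sgD [RHS]addrC !scalerA; congr (- (_ *: _) - (_ *: _)).
  by rewrite -[RHS]mul1r -(sgK R u); ring.
by ring.
Qed.

Context (B : finType) (deg : B -> int) (x : forall b, P (deg b))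
  (xi : forall b, {linear P (deg b) -> R^o}) (xE : total_basis x xi).

Definition xis b : dual (- deg b) :=
  hsingle (esym (subrr (deg b)) : 0 = deg b + - deg b)
    (xi b : {linear P (deg b) -> sphereR R 0}).
Lemma xisE b i j p : xis b i j p = tr j (xi b (tr (deg b) p) : sphereR R 0).
Proof. by []. Qed.

Lemma dual_basis u (f : dual u) :
  f = \sum_b (f (deg b) 0 (x b) : R) *: tr u (xis b).
Proof.
apply: hmap_eqP => i j v jE; rewrite hmap_sumE.
have [j0|j0] := eqVneq j 0; last first.
  by rewrite [LHS](sphere0 _ j0) [RHS](sphere0 _ j0).
move: j0 jE => -> jE; rewrite (hmap_total_basis xE _ _ jE); apply: eq_bigr => b _.
rewrite hmapZE; have [e|e] := eqVneq (deg b) i; last first.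
  rewrite [tr (deg b) v]tr0 // linear0 scale0r tr0 ?hmap0E ?scaler0 //.
  by apply/eqP => E; case/eqP: e; lia.
have e2 : u = - deg b by lia.
subst u i; rewrite !trE xisE !trE tr_hmap; last by rewrite subrr.
by rewrite /GRing.scale /= mulrC.
Qed.

Program Definition psi_map n (H : Hom dual (Hom Y Z) n) : Hom (Hom P Y) Z n :=
  @Hmap _ _ _ _ _ _ (fun m k g =>
    \sum_b (sg (deg b * (deg b + m)) : R) *:
      H (- deg b) (- deg b + n) (xis b) (deg b + m) k (g (deg b) (deg b + m) (x b))) _ _.
Next Obligation.
rewrite scaler_sumr -big_split; apply: eq_bigr => b _ /=.
by rewrite hmapZr hmapP scalerDr !scalerA mulrC.
Qed.
Next Obligation.
rewrite big1 // => b _; rewrite hmap_shape ?scaler0 //.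
by apply/eqP => E; case/eqP: H0; lia.
Qed.
Lemma psi_mapE n (H : Hom dual (Hom Y Z) n) m k g : psi_map H m k g =
  \sum_b (sg (deg b * (deg b + m)) : R) *:
    H (- deg b) (- deg b + n) (xis b) (deg b + m) k (g (deg b) (deg b + m) (x b)).
Proof. by []. Qed.

Lemma phi_map_bij n : bijective (@phi_map n).
Proof.
exists (@psi_map n) => [G|H].
  apply: hmap_eqP => m k g kE; rewrite psi_mapE [in RHS](hom_total_basis xE g) hmap_sum.
  apply: eq_bigr => b _; rewrite (phi_mapE _ _ _ _ (w := m)) //; last by lia.
  rewrite scalerA mulNr sgN sgK scale1r; congr (G _ _ _).
  apply: hmap_eqP => i j v jE; rewrite muE; last by lia.
  by rewrite dyadE linearZ xisE trE.
apply: hmap_eqP => u m f ->; apply: hmap_eqP => v k y kE.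
rewrite (phi_mapE _ _ _ _ (w := u + v)) // psi_mapE [in RHS](dual_basis f) hmap_sum hmap_sumE.
rewrite scaler_sumr; apply: eq_bigr => b _; rewrite muE // !hmapZr hmapZE.
have [e|e] := eqVneq u (- deg b); last first.
  rewrite (_ : f (deg b) 0 (x b) = 0) ?scale0r ?scaler0 //.
  by apply: hmap_shape; apply/eqP => E; case/eqP: e; lia.
subst u; rewrite trE; have vE : deg b + (- deg b + v) = v by lia.
by rewrite vE trE scalerA mulNr sgN sgK scale1r.
Qed.
End Phi.

Section Biduality.
Context (B : finType) (deg : B -> int) (x : forall b, P (deg b))
  (xi : forall b, {linear P (deg b) -> R^o}) (xE : total_basis x xi).

Program Definition delta_hmap Z : Hom P (Hom (Hom P Z) Z) 0 :=
  @Hmap _ _ _ _ _ _ (fun l n p =>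
    @Hmap _ _ _ _ _ _ (fun m k g => (sg (l * m) : R) *: if n == l then g l k p else 0) _ _) _ _.
Next Obligation.
case: eqP => _; last by rewrite !scaler0 addr0.
by rewrite hmapZr scalerDr !scalerA mulrC.
Qed.
Next Obligation.
case: eqP => [E|_]; last by rewrite scaler0.
by rewrite hmap_shape ?scaler0 //; apply/eqP => E'; case/eqP: H; lia.
Qed.
Next Obligation.
apply: hmap_eq => m k g; rewrite hmapDE hmapZE /=; case: eqP => _.
  by rewrite hmapP scalerDr !scalerA mulrC.
by rewrite !scaler0 addr0.
Qed.
Next Obligation.
apply: hmap_eq => m k g /=; case: eqP => [E|_]; last by rewrite scaler0.
by case/eqP: H; lia.
Qed.
Lemma delta_hmapE Z l p m k g : delta_hmap Z l l p m k g = (sg (l * m) : R) *: g l k p.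
Proof. by rewrite /= eqxx. Qed.
Fact delta_cycle Z : cycle (delta_hmap Z).
Proof.
apply/hd_cycle => l n n' l' p; rewrite addr0 sg0 scale1r => -> -> ->.
apply: hmap_eqP => m k g kE.
rewrite (@hdE _ _ _ _ _ _ _ (k + 1) (m - 1)) // !delta_hmapE.
rewrite (@hdE _ _ _ _ _ _ _ (k + 1) (l - 1)) //; try lia.
rewrite linearZ /= sgM1 sgM1l scalerA sgK scale1r scalerBr opprB addrCA subrr addr0.
by rewrite !scalerA mulrC.
Qed.
Definition delta Z : chain_map P (Hom (Hom P Z) Z) := mkchain (delta_cycle Z).

Program Definition bidual_hmap : Hom P (Hom dual (sphereR R)) 0 :=
  @Hmap _ _ _ _ _ _ (fun l n p =>
    @Hmap _ _ _ _ _ _ (fun u j f => if n == l then (sg l : R) *: f l j p else 0) _ _) _ _.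
Next Obligation.
case: eqP => _; last by rewrite !scaler0 addr0.
by rewrite hmapZr scalerDr !scalerA mulrC.
Qed.
Next Obligation.
case: eqP => [E|_] //.
by rewrite hmap_shape ?scaler0 //; apply/eqP => E'; case/eqP: H; lia.
Qed.
Next Obligation.
apply: hmap_eq => m k g; rewrite hmapDE hmapZE /=; case: eqP => _.
  by rewrite hmapP scalerDr !scalerA mulrC.
by rewrite !scaler0 addr0.
Qed.
Next Obligation.
apply: hmap_eq => m k g /=; case: eqP => [E|_] //.
by case/eqP: H; lia.
Qed.
Lemma bidual_hmapE l p u j f : bidual_hmap l l p u j f = (sg l : R) *: f l j p.
Proof. by rewrite /= eqxx. Qed.
Fact bidual_cycle : cycle bidual_hmap.
Proof.
apply/hd_cycle => l n n' l' p; rewrite addr0 sg0 scale1r => -> -> ->.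
apply: hmap_eqP => u k f kE.
rewrite (@hdE _ _ _ _ _ _ _ (k + 1) (u - 1)) // !bidual_hmapE.
rewrite (@hdE _ _ _ _ _ _ _ (k + 1) (l - 1)) //; try lia.
have d0 (n1 n2 : int) (y : sphereR R n1) : diff (sphereR R) n1 n2 y = 0 by [].
rewrite !d0 !sub0r !scalerN opprK scalerA sgK scale1r.
have [k0|k0] := eqVneq k 0; last by rewrite [LHS](sphere0 _ k0) [RHS](sphere0 _ k0).
by congr (_ *: _); rewrite -sgN; congr sg; lia.
Qed.
Definition bidual : chain_map P (Hom dual (sphereR R)) := mkchain bidual_cycle.

Lemma bidual_qi : quasi_iso bidual.
Proof.
apply: (hbij_bij (f := fun n => bidual n n)); first exact: chain_hmor.
move=> l; exists (fun H : Hom dual (sphereR R) l => (sg l : R) *: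
  \sum_b (H (- deg b) 0 (xis xi b) : R) *: tr l (x b)) => [p|H].
  rewrite [RHS](xE p) scaler_sumr; apply: eq_bigr => b _.
  rewrite bidual_hmapE xisE trE.
  by rewrite scalerA -[_ * _]/((sg l : R) * (sg l * _)) mulrA sgK mul1r.
apply: hmap_eqP => u j f jE; rewrite bidual_hmapE hmapZr scalerA sgK scale1r.
have [j0|j0] := eqVneq j 0; last by rewrite [LHS](sphere0 _ j0) [RHS](sphere0 _ j0).
move: j0 jE => -> jE; rewrite [in RHS](dual_basis xE f) !hmap_sum; apply: eq_bigr => b _.
rewrite !hmapZr; have [e|e] := eqVneq (deg b) l; last first.
  rewrite [tr l _]tr0 1?eq_sym // hmap_x0 [tr u _]tr0 ?hmap_x0 ?scaler0 //.
  by apply/eqP => E; case/eqP: e; lia.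
have e2 : u = - deg b by lia.
by subst u l; rewrite !trE /GRing.scale /= mulrC.
Qed.

(** Evaluation on [P] turns into the homothety of [Z] preceded by biduality. The two signs agree
    because a nonzero value forces [u = - l], and [l * l] has the parity of [l]; this explains
    [sg l] in [bidual_hmap]. *)
Lemma delta_square Z l (p : P l) :
  phi_map (delta Z l l p) =
    post dual (homothety (mkchain (hid_cycle Z))) l l (bidual l l p).
Proof.
apply: hmap_eqP => u m f mE; apply: hmap_eqP => v k y kE.
rewrite (phi_mapE _ _ _ _ (w := u + v)) //; try lia.
rewrite delta_hmapE muE // (@postE _ _ _ _ _ _ _ _ _ m) // bidual_hmapE.
have [m0|m0] := eqVneq m 0; last first.
  rewrite [f l m p](sphere0 _ m0) scaler0 hmap_x0 hmap0E.
  rewrite (_ : f l 0 p = 0) ?scale0r ?scaler0 //; apply: hmap_shape.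
  by apply/eqP => E; case/eqP: m0; lia.
move: m0 mE kE => -> mE kE.
have -> : homothety (mkchain (hid_cycle Z)) 0 0 (sg l *: f l 0 p) v k y =
  tr k (((sg l : R) * f l 0 p) *: y) by [].
have trZ c : tr k (c *: y) = c *: tr k y by rewrite linearZ.
rewrite trZ scalerA -sgD -[in RHS]scalerA; congr (_ *: _).
have uE : u = - l by lia.
transitivity (sg (- (l * l)) : R).
  by congr sg; rewrite uE mulrDr mulNr mulrN; lia.
by rewrite sgN !sgE abszM oddM andbb.
Qed.

Lemma delta_qi Z : quasi_iso (delta Z) <->
  quasi_iso (post dual (homothety (mkchain (hid_cycle Z)))).
Proof.
have hb := bidual_qi.
have bphi : hbij (@phi_map Z Z).
  by apply: hbij_bij; [exact: phi_map_hmor | exact: phi_map_bij xE].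
split=> h.
  apply: (@hbij_cancel_r _ _ _ _ _ _ (fun n => bidual n n)
    (fun n => post dual (homothety (mkchain (hid_cycle Z))) n n)
    (fun n x => phi_map (delta Z n n x))) => //.
  - by move=> n p _; rewrite delta_square subrr; exact: boundary0.
  - exact: chain_hmor.
  - exact: chain_hmor.
  - apply: hbij_comp => //; [exact: chain_hmor | exact: phi_map_hmor].
apply: (@hbij_cancel_l _ _ _ _ _ _ (fun n => delta Z n n) (@phi_map Z Z)
    (fun n x => post dual (homothety (mkchain (hid_cycle Z))) n n (bidual n n x))) => //.
- by move=> n p _; rewrite delta_square subrr; exact: boundary0.
- exact: chain_hmor.
- exact: phi_map_hmor.
- apply: (hbij_comp (f := fun n => bidual n n)
    (g := fun n => post dual (homothety (mkchain (hid_cycle Z))) n n)) => //; exact: chain_hmor.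
Qed.
End Biduality.
End Evaluation.

(** * Coinduced complexes *)

Section Restriction.
Context (R S : comNzRingType) (phi : {rmorphism R -> S}).

Fact restr_linear (M N : lmodType S) (f : {linear M -> N}) :
  linear (fun x : restrict phi M => f x : restrict phi N).
Proof. by move=> a x y; rewrite linearD; congr (_ + _); exact: (linearZ_LR f (phi a) x). Qed.
Definition restr_diff (A : complex S) i j :
    {linear restrict phi (A i) -> restrict phi (A j)} :=
  mklin (@restr_linear _ _ (diff A i j)).
Program Definition restr (A : complex S) : complex R :=
  @Complex R (fun n => restrict phi (A n) : lmodType R) (restr_diff A) _ _.
Next Obligation. exact: diff_shape. Qed.
Next Obligation. exact: diff_diff. Qed.

Context (I : complex R).
Local Notation B := (hom_complex phi (sphere (S^o : lmodType S)) I).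
Local Notation SR := (restrict phi S^o : lmodType R).

Lemma hmap_phi_eq n (b c : B n) : (forall s : S, b 0 n s = c 0 n s) -> b = c.
Proof.
move=> bc; apply: hmap_eq => u k s.
have [u0|u0] := eqVneq u 0; last by rewrite [s](sphere0 _ u0) !hmap_x0.
subst u; have [->|kn] := eqVneq k n; first exact: bc.
by rewrite !hmap_shape ?add0r.
Qed.

Lemma phi_diffE n m k (b : B n) (s : S) : m = n - 1 -> k = m + 1 ->
  diff B n m b 0 m s = diff I k m (b 0 k s).
Proof.
move=> -> ->; rewrite /= eqxx.
have E0 (z : sphere (S^o : lmodType S) (0 - 1)) : b (0 - 1) (n - 1) z = 0.
  by rewrite (sphere0 z) ?hmap_x0.
by rewrite E0 scaler0 subr0.
Qed.

Section Adjunction.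
Context (A : complex S).

(** Evaluation at 1: the adjunction between restriction of scalars and coinduction. *)
Program Definition gam n (G : Hom A B n) : Hom (restr A) I n :=
  @Hmap _ _ _ _ _ _ (fun i j a => (G i j a : B j) 0 j (1 : S)) _ _.
Next Obligation.
have -> : G i j (r *: x + y) = (phi r : S) *: G i j x + G i j y.
  by rewrite -[RHS]hmap_semilinear.
have E (b c : B j) : ((phi r : S) *: b + c) 0 j (1 : S) = b 0 j (phi r *: (1 : S^o)) + c 0 j (1 : S) by [].
by rewrite E hmapZ.
Qed.
Next Obligation. by rewrite (hmap_shape G x H). Qed.

Lemma gamE n (G : Hom A B n) i j a : gam G i j a = (G i j a : B j) 0 j (1 : S).
Proof. by []. Qed.

Lemma gam_hmor : hmor gam.
Proof.
apply: hmorI => [n G G'|n m G mE]; first by apply: hmap_eq => i j a.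
subst m; apply: hmap_eqP => i j a jE.
rewrite (@hdE _ _ _ _ _ _ _ (j + 1) (i - 1)) // !gamE.
rewrite (@hdE _ A _ _ _ _ _ (j + 1) (i - 1)) //.
have E (b c : B j) (e : S) : (b - e *: c) 0 j (1 : S) = b 0 j (1 : S) - c 0 j (e *: (1 : S^o)) by [].
rewrite E (phi_diffE _ _ (k := j + 1)) //; last by rewrite addrK.
congr (_ - _); rewrite -hmapZ.
by rewrite -[LHS]/(G (i - 1) j (diff A i (i - 1) a) 0 j _) !sgE; case: odd;
  rewrite ?rmorphN rmorph1.
Qed.

Definition ungam_fun n (g : Hom (restr A) I n) i m (a : A i) (u k : int) :
    sphere (S^o : lmodType S) u -> I k :=
  match u return sphere (S^o : lmodType S) u -> I k with
  | Posz 0 => fun s => if k == m then g i k ((s : S) *: a : A i) else 0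
  | _ => fun _ => 0
  end.
Program Definition ungam_in n (g : Hom (restr A) I n) i m (a : A i) : B m :=
  @Hmap _ _ _ _ _ _ (@ungam_fun n g i m a) _ _.
Next Obligation.
case: i0 x y => [[|u]|u] x y /=; rewrite ?scaler0 ?addr0 //.
case: eqP => _; last by rewrite scaler0 addr0.
rewrite -[RHS]hmapP; congr (g i j _).
by rewrite scalerDl; congr (_ + _); rewrite -scalerA.
Qed.
Next Obligation.
case: i0 x H => [[|u]|u] x H //=; move: H; rewrite add0r => /negPf.
by rewrite /= => ->.
Qed.
Program Definition ungam n (g : Hom (restr A) I n) : Hom A B n :=
  @Hmap _ _ _ _ _ _ (fun i m a => ungam_in g m a) _ _.
Next Obligation.
apply: hmap_phi_eq => s; rewrite /= eqxx -[RHS]hmapD; congr (g _ _ _).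
by rewrite scalerDr !scalerA mulrC.
Qed.
Next Obligation.
by apply: hmap_phi_eq => s; rewrite /= eqxx hmap_shape.
Qed.

Lemma gam_bij n : bijective (@gam n).
Proof.
exists (@ungam n) => [G|g]; last first.
  by apply: hmap_eq => i j a; rewrite gamE /= eqxx scale1r.
apply: hmap_eq => i m a; apply: hmap_phi_eq => s.
rewrite /= eqxx; have -> : G i m (s *: a) = s *: G i m a by rewrite -[RHS]hmapZr.
by rewrite -[LHS]/(G i m a 0 m (s *: (1 : S^o))) /GRing.scale /= mulr1.
Qed.

Lemma acyc_adj n : acyc (Hom A B) n <-> acyc (Hom (restr A) I) n.
Proof. exact: (acyc_bij gam_hmor gam_bij). Qed.
End Adjunction.

Lemma coinduced_K_injective : K_injective I -> K_injective B.
Proof.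
move=> KI A aA; apply/acyclicE => n; apply/acyc_adj.
by apply/acyclicE: n; apply: KI.
Qed.

(** The same maps, typed over [phi] on one side and over the restricted module on the other; only
    the latter form can be compared with resolutions over [R]. *)
Definition beta_fun n m (b : B n) (u k : int) : sphere SR u -> I k :=
  match u return sphere SR u -> I k with
  | Posz 0 => fun s => if m == n then b 0 k s else 0
  | _ => fun _ => 0
  end.
Program Definition beta_in n m (b : B n) : Hom (sphere SR) I m :=
  @Hmap _ _ _ _ _ _ (@beta_fun n m b) _ _.
Next Obligation.
case: i x y => [[|u]|u] x y /=; rewrite ?scaler0 ?addr0 //.
case: eqP => _; last by rewrite scaler0 addr0.
by rewrite hmap_semilinear.
Qed.
Next Obligation.
case: i x H => [[|u]|u] x H //=; move: H; rewrite add0r => H.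
by case: eqP => // E; subst m; rewrite hmap_shape ?add0r.
Qed.
Program Definition beta_hmap : Hom (restr B) (Hom (sphere SR) I) 0 :=
  @Hmap _ _ _ _ _ _ (fun n m b => beta_in m b) _ _.
Next Obligation.
apply: hmap_eq => u k s; rewrite hmapDE hmapZE.
case: u s => [[|u]|u] s /=; rewrite ?scaler0 ?addr0 //.
case: eqP => _; last by rewrite scaler0 addr0.
by congr (_ + _); rewrite -hmapZ.
Qed.
Next Obligation.
apply: hmap_eq => u k s; move: H; rewrite addr0 => /negPf E.
by case: u s => [[|u]|u] s //=; rewrite E.
Qed.
Lemma beta_hmapE n b k (s : S) : beta_hmap n n b 0 k s = (b : B n) 0 k s.
Proof. by rewrite /= eqxx. Qed.
Fact beta_cycle : cycle beta_hmap.
Proof.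
apply/hd_cycle => n n' m m' b; rewrite addr0 sg0 scale1r => -> -> ->.
apply: hmap_eqP => u k s kE; have [u0|u0] := eqVneq u 0; last first.
  by rewrite [s](sphere0 _ u0) !hmap_x0.
subst u; have {kE}kE : k = n - 1 by rewrite kE add0r.
subst k; rewrite (@hdE _ _ _ _ _ _ _ n (0 - 1)) ?subrK // !beta_hmapE.
rewrite hmap_x0 scaler0 subr0.
by rewrite (phi_diffE _ _ (k := n)) ?subrK.
Qed.
Definition beta : chain_map (restr B) (Hom (sphere SR) I) := mkchain beta_cycle.

Definition unbeta_fun n (g : Hom (sphere SR) I n) (u k : int) :
    sphere (S^o : lmodType S) u -> I k :=
  match u return sphere (S^o : lmodType S) u -> I k with
  | Posz 0 => fun s => g 0 k s
  | _ => fun _ => 0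
  end.
Program Definition unbeta n (g : Hom (sphere SR) I n) : restr B n :=
  @Hmap _ _ _ _ _ _ (@unbeta_fun n g) _ _.
Next Obligation.
case: i x y => [[|u]|u] x y /=; rewrite ?scaler0 ?addr0 //.
by rewrite -[RHS]hmapP.
Qed.
Next Obligation. by case: i x H => [[|u]|u] x H //=; rewrite hmap_shape. Qed.

Lemma beta_qi : quasi_iso beta.
Proof.
apply: (hbij_bij (f := fun n => beta n n)); first exact: chain_hmor.
move=> n; exists (@unbeta n) => [b|g].
  by apply: hmap_phi_eq => s; rewrite -[LHS]/(beta_hmap n n b 0 n s) beta_hmapE.
apply: hmap_eq => u k s; have [u0|u0] := eqVneq u 0; last first.
  by rewrite [s](sphere0 _ u0) !hmap_x0.
by subst u; rewrite -[LHS]/(beta_hmap n n (unbeta g) 0 k s) beta_hmapE.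
Qed.
End Restriction.

Section ChainMaps.
Context (R : comNzRingType).
Implicit Types X Y Z : complex R.

Definition chcomp X Y Z (g : chain_map Y Z) (f : chain_map X Y) : chain_map X Z :=
  mkchain (hcomp_cycle 0 (chain_cycle g) (chain_cycle f)).
Lemma chcompE X Y Z (g : chain_map Y Z) (f : chain_map X Y) i j x :
  chcomp g f i j x = g i j (f i i x).
Proof.
by rewrite -[LHS]/(hcomp 0 (g : Hom Y Z 0) (f : Hom X Y 0) i j x)
  (@hcompE _ _ _ _ _ _ _ _ _ _ _ i) ?addr0.
Qed.
Lemma qi_comp X Y Z (g : chain_map Y Z) (f : chain_map X Y) :
  quasi_iso f -> quasi_iso g -> quasi_iso (chcomp g f).
Proof.
apply: (hbij_homotopic_comp (f := fun n => f n n) (g := fun n => g n n)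
  (h := fun n => chcomp g f n n)); last 2 first.
- exact: chain_hmor.
- exact: chain_hmor.
by move=> n x _; rewrite chcompE subrr; exact: boundary0.
Qed.

Lemma qi_homology_fin_gen X Y (f : chain_map X Y) n : quasi_iso f ->
  homology_fin_gen X n <-> homology_fin_gen Y n.
Proof.
move=> qf; have fm := chain_hmor f; split=> -[k [g [cg gE]]].
  exists k, (fun l => f n n (g l)); split=> [l|z cz]; first exact: (hmor_cycle fm).
  have [x cx bx] := (qf n).2 z cz; have [a ba] := gE x cx; exists a.
  rewrite -(subrKA (f n n x)); apply: boundaryD => //.
  have -> : \sum_l a l *: f n n (g l) = f n n (\sum_l a l *: g l).
    by rewrite hmap_sum; apply: eq_bigr => l _; rewrite hmapZr.
  by rewrite -hmapB; exact: (hmor_boundary fm).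
have /choice[h hE] l : exists x : X n, cycle x /\ boundary (g l - f n n x).
  by have [x cx bx] := (qf n).2 (g l) (cg l); exists x.
exists k, h; split=> [l|z cz]; first exact: (hE l).1.
have [a ba] := gE (f n n z) (hmor_cycle fm cz); exists a.
apply: (qf n).1.
  by apply: cycleB => //; apply: cycle_sum => l; apply: cycleZ; exact: (hE l).1.
rewrite hmapB -(subrKA (\sum_l a l *: g l)); apply: boundaryD => //.
rewrite hmap_sum -sumrB; apply: boundary_sum => l; rewrite hmapZr -scalerBr.
by apply: boundaryZ; exact: (hE l).2.
Qed.

Lemma homothety_pre X I (iota : chain_map X I) n r :
  homothety iota n n r = pre I iota n n (homothety (mkchain (hid_cycle I)) n n r).
Proof.
have [n0|n0] := eqVneq n 0; last by rewrite [r](sphere0 _ n0) !hmap_x0.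
subst n; apply: hmap_eqP => i j x ->; rewrite preE addr0.
have -> : homothety iota 0 0 r i i x = iota i i ((r : R) *: x) by [].
have -> y : homothety (mkchain (hid_cycle I)) 0 0 r i i y = hid I i i ((r : R) *: y) by [].
by rewrite hidE hmapZr.
Qed.

(** The homothety of [X] factors as that of [I] followed by [pre I iota], a quasi-isomorphism by
    K-injectivity that [Hom D] preserves. *)
Lemma post_homothety D X I (iota : chain_map X I) : bounded_below_projective D ->
  K_injective I -> quasi_iso iota ->
  quasi_iso (post D (homothety (mkchain (hid_cycle I)))) <->
  quasi_iso (post D (homothety iota)).
Proof.
move=> bD KI qi.
have qp := post_projective_qi bD (pre_injective_qi KI qi).
have E n u : post D (homothety iota) n n u =
    post D (pre I iota) n n (post D (homothety (mkchain (hid_cycle I))) n n u).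
  apply: hmap_eqP => i j x jE; rewrite !(@postE _ _ _ _ _ _ _ _ _ j) //.
  exact: homothety_pre.
have fgh n (u : Hom D (sphereR R) n) : cycle u -> boundary (post D (homothety iota) n n u -
    post D (pre I iota) n n (post D (homothety (mkchain (hid_cycle I))) n n u)).
  by rewrite E subrr => _; exact: boundary0.
have m1 := chain_hmor (post D (homothety (mkchain (hid_cycle I)))).
have m2 := chain_hmor (post D (pre I iota)).
split=> q.
  exact: (@hbij_homotopic_comp _ _ _ _ _ _
    (fun n => post D (homothety (mkchain (hid_cycle I))) n n)
    (fun n => post D (pre I iota) n n) (fun n => post D (homothety iota) n n)).
exact: (@hbij_cancel_l _ _ _ _ _ _
    (fun n => post D (homothety (mkchain (hid_cycle I))) n n)
    (fun n => post D (pre I iota) n n) (fun n => post D (homothety iota) n n)).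
Qed.
End ChainMaps.

Section CoinducedHomothety.
Context (R S : comNzRingType) (phi : {rmorphism R -> S}).
Context (I : complex R) (KI : K_injective I).
Local Notation B := (hom_complex phi (sphere (S^o : lmodType S)) I).
Local Notation SR := (restrict phi S^o : lmodType R).

Lemma acyc_coinduced (F C : complex R) (e : chain_map F (sphere SR))
    (iota : chain_map C I) n : bounded_below_projective F -> quasi_iso e ->
  quasi_iso iota -> acyc B n <-> acyc (Hom F C) n.
Proof.
move=> bF qe qi.
have h1 := hbij_acyc (chain_hmor (beta phi I)) (@beta_qi _ _ phi I) n.
have h2 := hbij_acyc (chain_hmor (pre I e)) (pre_injective_qi KI qe) n.
have h3 := hbij_acyc (chain_hmor (post F iota)) (post_projective_qi bF qi) n.
by split=> h; [apply/h3/h2/h1 | apply/h1/h2/h3].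
Qed.

Lemma homology_fin_gen_coinduced (F C : complex R) (e : chain_map F (sphere SR))
    (iota : chain_map C I) n : bounded_below_projective F -> quasi_iso e ->
  quasi_iso iota -> homology_fin_gen (Hom F C) n -> homology_fin_gen B n.
Proof.
move=> bF qe qi /(qi_homology_fin_gen n (post_projective_qi bF qi)).
move/(qi_homology_fin_gen n (pre_injective_qi KI qe)).
move/(qi_homology_fin_gen n (@beta_qi _ _ phi I)) => [k [g [cg gE]]].
by exists k, g; split=> // z cz; have [a ba] := gE z cz; exists (phi \o a).
Qed.

Context (P : complex R) (eps : chain_map P (sphere SR)) (qe : quasi_iso eps).

Definition eps_dual : chain_map (restr phi B) (Hom P I) :=
  chcomp (pre I eps) (beta phi I).
Lemma eps_dual_qi : quasi_iso eps_dual.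
Proof. by apply: qi_comp; [exact: beta_qi | exact: pre_injective_qi]. Qed.

Definition swp n : sphere SR n -> sphere (S^o : lmodType S) n :=
  match n return sphere SR n -> sphere (S^o : lmodType S) n with
  | Posz 0 => id | _ => fun _ => 0 end.
Lemma swp_hmor : hmor swp.
Proof.
split=> [|i j x]; first by case=> [[|n]|n] x y //=; rewrite subr0.
have -> : diff (sphere SR) i j x = 0 by [].
have -> : diff (sphere (S^o : lmodType S)) i j (swp x) = 0 by [].
by case: j => [[|n]|n].
Qed.
Lemma swp_hbij : hbij swp.
Proof.
move=> n; split=> [x _ /sphere_boundary x0|y _]; have [n0|n0] := eqVneq n 0.
- by subst n; apply/sphere_boundary.
- by apply/sphere_boundary; exact: sphere0.
- by subst n; exists y; [exact: sphere_cycle | rewrite subrr; exact: boundary0].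
exists 0; first exact: sphere_cycle.
by apply/sphere_boundary; exact: sphere0.
Qed.

(** Both sides send [b] to its value at the class of [p] in [S]. So the homothety of [B] is, up to
    adjunction and resolution, the evaluation map [delta P I]. *)
Lemma coinduced_square l (p : P l) :
  gam (homothety (mkchain (hid_cycle B)) l l (swp (eps l l p))) =
    pre I eps_dual l l (delta P I l l p).
Proof.
apply: hmap_eqP => m k b kE; rewrite gamE preE.
have -> : delta P I l l p m k (eps_dual m m b) =
  (sg (l * m) : R) *: eps_dual m m b l k p by exact: delta_hmapE.
rewrite chcompE preE; have [l0|l0] := eqVneq l 0; last first.
  rewrite [eps l l p](sphere0 _ l0) hmap_x0 scaler0.
  by rewrite (hmor0 swp_hmor) hmap_x0.
subst l; rewrite mul0r sg0 scale1r.
have -> : beta phi I m m b 0 k (eps 0 0 p) = (b : B m) 0 k (eps 0 0 p) by exact: beta_hmapE.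
have {kE}kE : k = m by rewrite kE addr0.
subst k; set s : S := eps 0 0 p.
have -> : homothety (mkchain (hid_cycle B)) 0 0 (swp (eps 0 0 p)) m m b =
  hid B m m (s *: b : B m) by [].
rewrite hidE; have -> : (s *: b : B m) 0 m (1 : S) = (b : B m) 0 m (s *: (1 : S^o)) by [].
by rewrite /GRing.scale /= mulr1.
Qed.

Lemma coinduced_homothety_delta :
  quasi_iso (homothety (mkchain (hid_cycle B))) <-> quasi_iso (delta P I).
Proof.
have f2m := hmor_comp (chain_hmor eps) swp_hmor.
have f2b := hbij_comp (chain_hmor eps) swp_hmor qe swp_hbij.
have gm := @gam_hmor _ _ phi I B.
have gb : hbij (@gam _ _ phi I B) by apply: hbij_bij => //; exact: gam_bij.
have hm := chain_hmor (homothety (mkchain (hid_cycle B))).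
have pq := pre_injective_qi KI eps_dual_qi.
have dm := chain_hmor (delta P I); have pm := chain_hmor (pre I eps_dual).
split=> q.
  apply: (@hbij_cancel_l _ _ _ _ _ _ _ (fun n => pre I eps_dual n n)
    (fun n p => gam (homothety (mkchain (hid_cycle B)) n n (swp (eps n n p))))) => //.
    by move=> n p _; rewrite coinduced_square subrr; exact: boundary0.
  apply: (hbij_comp (f := fun n p => swp (eps n n p))
    (g := fun n s => gam (homothety (mkchain (hid_cycle B)) n n s))) => //.
    exact: hmor_comp.
  exact: (hbij_comp hm gm).
have h2 : hbij (fun n s => gam (homothety (mkchain (hid_cycle B)) n n s)).
  apply: (@hbij_cancel_r _ _ _ _ _ _ (fun n p => swp (eps n n p)) _
    (fun n p => pre I eps_dual n n (delta P I n n p))) => //.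
  - by move=> n p _; rewrite coinduced_square subrr; exact: boundary0.
  - exact: hmor_comp.
  - exact: (hbij_comp dm pm).
apply: (@hbij_cancel_l _ _ _ _ _ _ _ (@gam _ _ phi I B)
  (fun n s => gam (homothety (mkchain (hid_cycle B)) n n s))) => //.
by move=> n p _; rewrite subrr; exact: boundary0.
Qed.

Context (d : nat) (pP : forall l, fgproj (P l)) (bP : bounded P d).

Lemma dual_bounded : bounded (dual P) d.
Proof.
rewrite -[d]addn0; apply: hom_bounded => // l x l0; apply: sphere0.
by apply/eqP => E; move: l0; rewrite E.
Qed.
Lemma dual_fgproj l : fgproj (dual P l).
Proof.
have [T [deg [x [xi xE]]]] := total_basis_exists pP bP.
apply: (hom_fgproj xE) => i; have [->|i0] := eqVneq i 0; first exact: fgproj_regular.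
by apply: fgproj0 => v; exact: sphere0.
Qed.

(** A chain of equivalences: the homothety of [B], evaluation on [P], then [Hom (dual P)] applied to
    the homothety of [I], to that of [iota], and to its cone. *)
Lemma coinduced_homothety (C : complex R) (iota : chain_map C I) : quasi_iso iota ->
  quasi_iso (homothety (mkchain (hid_cycle B))) <->
  acyclic (Hom (dual P) (cone (homothety iota))).
Proof.
move=> qi; have [T [deg [x [xi xE]]]] := total_basis_exists pP bP.
have bD := bounded_projective dual_fgproj dual_bounded.
split.
  by move=> /coinduced_homothety_delta/(delta_qi xE)/(post_homothety bD KI qi)/post_qi.
by move=> /post_qi/(post_homothety bD KI qi)/(delta_qi xE)/coinduced_homothety_delta.
Qed.

Lemma acyc_hom_endomorphism X n : acyc (Hom (Hom P P) X) n <->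
  acyc (Hom (dual P) (Hom P X)) n.
Proof.
have [T [deg [x [xi xE]]]] := total_basis_exists pP bP.
apply: (@acyc_bij R R (Hom (Hom P P) X) (Hom (dual P) (Hom P X)) (@phi_map R P P X)).
  exact: phi_map_hmor.
by move=> k; exact: phi_map_bij xE _.
Qed.
End CoinducedHomothety.

(** * Independence of the injective resolution and finiteness *)

Section Independence.
Context (R : comNzRingType).

(** K-injectivity yields [f] from [I] to [I'] compatible with the resolutions up to homotopy. Its
    cone is acyclic and K-injective, hence contractible, so composition with [f] is a
    quasi-isomorphism on [Hom X] for an arbitrary [X]. *)
Lemma homothety_independent (X I I' : complex R) (iota : chain_map X I)
    (iota' : chain_map X I') : K_injective I -> K_injective I' ->
  quasi_iso iota -> quasi_iso iota' ->
  quasi_iso (homothety iota) -> quasi_iso (homothety iota').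
Proof.
move=> KI KI' qi qi' qh.
have [h ch bh] := (pre_injective_qi KI' qi 0).2 (iota' : Hom X I' 0) (chain_cycle iota').
pose f : chain_map I I' := mkchain ch.
have E0 n (x : X n) : cycle x -> boundary (iota' n n x - f n n (iota n n x)).
  by move=> cx; have := homotopic_homology bh cx; rewrite hmapBE preE.
have qf : quasi_iso f.
  apply: (@hbij_cancel_r _ _ _ _ _ _ (fun n => iota n n) (fun n => f n n)
    (fun n => iota' n n)) => //; exact: chain_hmor.
have aE : acyclic (Hom (cone f) (cone f)).
  have KC : K_injective (cone f).
    move=> A aA; apply/acyclicE => n; apply/acyc_hom_cone/acyc_cone.
      by apply/acyclicE: n; exact: KI'.
    by apply/acyclicE: (n - 1); exact: KI.
  by apply: KC; apply/cone_qi.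
have aX : acyclic (Hom X (cone f)).
  apply/acyclicE => n y cy.
  have [|k kE] := @boundary_at _ _ _ 1 (hid (cone f)) _ (proj1 (acyclicE _) aE 0 _ (hid_cycle _)) => //.
  have E : diff (Hom X (cone f)) (n + 1) n (hcomp (n + 1) k y) =
      hcomp n (diff (Hom (cone f) (cone f)) 1 0 k) y
        + sg 1 *: hcomp n k (diff (Hom X (cone f)) n (n - 1) y).
    by apply: hcomp_diff; lia.
  by exists (hcomp (n + 1) k y); rewrite E cy hcomp0r scaler0 addr0 kE hcomp1l.
have qp : quasi_iso (post X f) by apply/post_qi.
apply: (@hbij_homotopic_comp _ _ _ _ _ _ (fun n => homothety iota n n)
  (fun n => post X f n n) (fun n => homothety iota' n n)) => //; last 2 first.
- exact: chain_hmor.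
- exact: chain_hmor.
move=> n r _; have [n0|n0] := eqVneq n 0; last first.
  by rewrite [r](sphere0 _ n0) !hmap_x0 subrr; exact: boundary0.
subst n; have -> : homothety iota' 0 0 r - post X f 0 0 (homothety iota 0 0 r) =
    (r : R) *: ((iota' : Hom X I' 0) - pre I' iota 0 0 (h : Hom I I' 0)).
  apply: hmap_eqP => i j x ->; rewrite hmapZE !hmapBE preE.
  rewrite (@postE _ _ _ _ _ _ _ _ _ i) ?addr0 // scalerBr -!hmapZr.
  by rewrite -[homothety iota' 0 0 r i i x]/(iota' i i ((r : R) *: x))
    -[homothety iota 0 0 r i i x]/(iota i i ((r : R) *: x)).
exact: boundaryZ.
Qed.
End Independence.

Lemma sum_enum_val (R : comNzRingType) (M : lmodType R) (T : finType) (F : T -> M) :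
  \sum_(i < #|T|) F (enum_val i) = \sum_t F t.
Proof. by rewrite [RHS](reindex (@enum_val T predT)) //; apply: onW_bij; exact: enum_val_bij. Qed.

Section FiniteHomology.
Context (R : comNzRingType).

(** The long exact sequence in terms of generators: lifts of generators of the kernel on homology in
    degree [n - 1], which is a submodule of a finitely generated module, together with the classes
    that come from [Y]. *)
Lemma cone_fin_gen (nR : noetherian R) (X Y : complex R) (f : chain_map X Y) :
  degreewise_homologically_finite X -> degreewise_homologically_finite Y ->
  degreewise_homologically_finite (cone f).
Proof.
move=> fX fY n; apply/homology_fgP.
have [Ul Ua Uz] : [/\ (exists y : Y n, diff Y n (n - 1) y + f (n - 1) (n - 1) 0 = 0),
   (forall x x' : X (n - 1),
    (exists y : Y n, diff Y n (n - 1) y + f (n - 1) (n - 1) x = 0) ->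
    (exists y : Y n, diff Y n (n - 1) y + f (n - 1) (n - 1) x' = 0) ->
    exists y : Y n, diff Y n (n - 1) y + f (n - 1) (n - 1) (x + x') = 0) &
   (forall a (x : X (n - 1)),
    (exists y : Y n, diff Y n (n - 1) y + f (n - 1) (n - 1) x = 0) ->
    exists y : Y n, diff Y n (n - 1) y + f (n - 1) (n - 1) (a *: x) = 0)].
  split; first by exists 0; rewrite linear0 hmap_x0 addr0.
    move=> x x' [y yE] [y' yE']; exists (y + y').
    by rewrite linearD hmapD addrACA yE yE' addr0.
  by move=> a x [y yE]; exists (a *: y); rewrite linearZ hmapZr -scalerDr yE scaler0.
pose W := @Submodule R (X (n - 1)) _ Ul Ua Uz.
have [U UE] : exists U : submodule (X (n - 1)), forall x, U x <-> cycle x /\ W x.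
  unshelve eexists (@Submodule R (X (n - 1)) (fun x => cycle x /\ W x) _ _ _) => //.
  - by split; [rewrite /cycle linear0 | exact: in_sub0].
  - by move=> x y [c1 w1] [c2 w2]; split; [exact: cycleD | exact: in_subD].
  - by move=> a x [c1 w1]; split; [exact: cycleZ | exact: in_subZ].
have [T [h [hU hE]]] := noetherian_fg_mod (U := U) (B := boundary_sub X (n - 1)) nR
  (fun u Uu => (proj1 (UE u) Uu).1) (proj1 (homology_fgP _ _) (fX (n - 1))).
have [T' [g [cg gE]]] := proj1 (homology_fgP _ _) (fY n).
have /choice[y yE] t : exists y : Y n, diff Y n (n - 1) y + f (n - 1) (n - 1) (h t) = 0.
  by have [_] := proj1 (UE _) (hU t).
pose G (t : T + T') : cone f n := match t with inl t => (y t, h t) | inr t => (g t, 0) end.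
exists (T + T')%type, G; split=> [[t|t]|[v u]].
- rewrite /cycle coneE yE; congr pair.
  have c : cycle (h t) := (proj1 (UE _) (hU t)).1.
  by rewrite c oppr0.
- by rewrite /cycle coneE (cycleE _ (cg t)) hmap_x0 addr0 linear0 oppr0.
rewrite /cycle coneE => cE.
have cu : cycle u by apply: oppr_inj; rewrite oppr0; exact: (congr1 snd cE).
have vu : diff Y n (n - 1) v + f (n - 1) (n - 1) u = 0 := congr1 fst cE.
have [a [u' u'E]] := hE u (proj2 (UE u) (conj cu (ex_intro _ v vu))).
have {u' u'E}[u' u'E] : exists u' : X n, diff X n (n - 1) u' = u - \sum_t a t *: h t.
  by move: u' u'E; rewrite subrK => u'; exists u'.
have cv : cycle (v - \sum_t a t *: y t + f n n u').
  rewrite /cycle linearD linearB chain_mapP u'E hmapB linear_sum hmap_sum addrACA vu add0r.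
  rewrite -opprD -big_split big1 ?oppr0 // => t _ /=.
  by rewrite linearZ hmapZr -scalerDr yE scaler0.
have [b [w wE]] := gE _ cv.
exists (fun t => match t with inl t => a t | inr t => b t end).
exists ((w, - tr (n + 1 - 1) u') : cone f (n + 1)).
have p1 (V : finType) (F : V -> cone f n) : (\sum_t F t).1 = \sum_t (F t).1.
  by elim/big_rec2: _ => // t y1 y2 _ <-.
have p2 (V : finType) (F : V -> cone f n) : (\sum_t F t).2 = \sum_t (F t).2.
  by elim/big_rec2: _ => // t y1 y2 _ <-.
rewrite coneE big_sumType /=; move: (n + 1 - 1) (addrK 1 n) => k e; subst k.
rewrite trE hmapN linearN opprK wE u'E; congr pair.
  rewrite /= !p1 /= [in RHS]opprD addrA [X in X - f n n u']addrAC.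
  by rewrite addrK.
by rewrite /= !p2 /= [X in _ - (_ + X)]big1 ?addr0 // => t _; rewrite scaler0.
Qed.

Lemma homologically_finite_bounded (X : complex R) : homologically_finite X ->
  exists N : nat, forall n : int, (N < `|n|)%N -> acyc X n.
Proof.
move=> [k [g [tg gE]]].
have /choice[s sE] (l : 'I_k) : exists s : seq int, forall n, g l n != 0 -> n \in s.
  have [_ /finite_seqP[s sE]] := tg l; exists s => n gn.
  have : [set n | g l n != 0]%classic n by [].
  by rewrite sE.
exists (\max_l \max_(n <- s l) `|n|)%N => n Nn z cz.
have tz : total_cycle (fun m => tr m z).
  split; first by move=> m; exact: cycle_tr.
  apply: (sub_finite_set _ (finite_set1 n)) => m /= zm.
  by apply: contrapT => mn; move: zm; rewrite tr0 ?eqxx //; exact/eqP.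
have [a aE] := gE _ tz; have := aE n; rewrite trE big1 ?subr0 // => l _.
have -> : g l n = 0; last by rewrite scaler0.
apply/eqP; apply: contraTT Nn => /sE ns; rewrite -leqNgt.
apply: leq_trans (leq_bigmax l).
by rewrite (big_rem n) //= leq_maxl.
Qed.

Lemma bounded_homologically_finite (X : complex R) (N : nat) :
  degreewise_homologically_finite X -> (forall n : int, (N < `|n|)%N -> acyc X n) ->
  homologically_finite X.
Proof.
move=> fX aX; pose dg (i : 'I_N.*2.+1) : int := i%:Z - N%:Z.
have /dep_choice[k kP] : forall n, exists k : nat, exists g : 'I_k -> X n,
    (forall l, cycle (g l)) /\ forall z : X n, cycle z ->
    exists a : 'I_k -> R, boundary (z - \sum_l a l *: g l) by exact: fX.
have /dep_choice[g gP] := kP.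
pose T : finType := {i : 'I_N.*2.+1 & 'I_(k (dg i))}.
pose G (t : T) m : X m := tr m (g (dg (tag t)) (tagged t)).
exists #|T|, (fun i => G (enum_val i)); split=> [i|z [cz _]].
  split=> [m|]; first by apply: cycle_tr; exact: (gP _).1.
  apply: (sub_finite_set _ (finite_set1 (dg (tag (enum_val i))))) => m /= zm.
  by apply: contrapT => mn; move: zm; rewrite /G tr0 ?eqxx //; exact/eqP.
have /dep_choice[a aP] i : exists a : 'I_(k (dg i)) -> R,
    boundary (z (dg i) - \sum_l a l *: g (dg i) l) by exact: (gP _).2.
pose c (t : T) : R := a _ (tagged t).
exists (fun i => c (enum_val i)) => m.
have -> : \sum_(i < #|T|) c (enum_val i) *: G (enum_val i) m = \sum_t c t *: G t m.
  exact: (sum_enum_val (fun t : T => c t *: G t m)).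
rewrite -(sig_big_dep (fun _ => true) (fun _ _ => true)
  (fun i (l : 'I_(k (dg i))) => a i l *: tr m (g (dg i) l))) /=.
have [mN|mN] := ltnP N `|m|.
  rewrite big1 ?subr0; first exact: aX.
  move=> i _; rewrite big1 // => l _; rewrite tr0 ?scaler0 //.
  by apply/eqP => E; move: mN; rewrite E /dg; have := ltn_ord i; lia.
have mi : (`|(m + N%:Z)%R|%N < N.*2.+1)%N by lia.
have mE : dg (Ordinal mi) = m by rewrite /dg /=; lia.
rewrite (bigD1 (Ordinal mi)) //= [X in _ - (_ + X)]big1 ?addr0 => [|i im]; last first.
  rewrite big1 // => l _; rewrite tr0 ?scaler0 //; apply/eqP => e.
  by case/eqP: im; apply: val_inj; move: e mE; rewrite /dg /=; lia.
have := aP (Ordinal mi); move: (a (Ordinal mi)); rewrite mE => a'.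
by congr boundary; congr (_ - _); apply: eq_bigr => l _; rewrite trE.
Qed.
End FiniteHomology.

(** * Partial contractions *)

Section PartialContraction.
Context (R : comNzRingType) (P : complex R) (pP : forall l, fgproj (P l)).

Lemma fgproj_ord (M : lmodType R) : fgproj M ->
  exists (k : nat) (x : 'I_k -> M) (xi : 'I_k -> {linear M -> R^o}),
    forall v, v = \sum_t xi t v *: x t.
Proof.
move=> [T [x [xi xE]]]; exists #|T|, (fun i => x (enum_val i)), (fun i => xi (enum_val i)) => v.
by rewrite [LHS]xE (reindex (@enum_val T predT)) //=; apply: onW_bij; exact: enum_val_bij.
Qed.

(* A homotopy from [s], invertible modulo [a], to a map vanishing above [l]. *)
Definition contracted (a : ideal R) (l : int) : Prop :=
  exists (s r : R) (h : Hom P P 1), a (r * s - 1) /\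
    forall (j : int) (p : P j), l < j -> s *: p = diff (Hom P P) 1 0 h j j p.

Lemma contracted_top a N : (forall l (p : P l), N < l -> p = 0) -> contracted a N.
Proof.
move=> PN; exists 1, 1, 0; split; first by rewrite mulr1 subrr; exact: in_sub0.
by move=> j p Nj; rewrite (PN _ p Nj) scaler0 hmap_x0.
Qed.

Definition functional l (xi : {linear P l -> R^o}) : dual P (- l) :=
  hsingle (esym (subrr l) : 0 = l + - l) (xi : {linear P l -> sphereR R 0}).
Lemma functionalE l xi i j p : @functional l xi i j p = tr j (xi (tr l p) : sphereR R 0).
Proof. by []. Qed.

Lemma dual_eq l (f f' : dual P (- l)) : (forall p, f l 0 p = f' l 0 p) -> f = f'.
Proof.
move=> ff; apply: hmap_eqP => i j p jE; have [il|il] := eqVneq i l; last first.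
  have j0 : j != 0 by apply/eqP => E; case/eqP: il; lia.
  by rewrite [LHS](sphere0 _ j0) [RHS](sphere0 _ j0).
by subst i; have -> : j = 0 by lia.
Qed.

Lemma dual_diffE (u n : int) (f : dual P u) i j (p : P i) : n = u - 1 ->
  diff (dual P) u n f i j p = - (sg u *: f (i - 1) j (diff P i (i - 1) p)).
Proof.
move=> nE; rewrite (@hdE _ _ _ _ _ _ _ (j + 1) (i - 1)) //.
by have -> : diff (sphereR R) (j + 1) j (f i (j + 1) p) = 0 by []; rewrite sub0r.
Qed.

(** The deformed identity [th] vanishes above [l], so its coordinates [g t] in degree [l] are
    cocycles of the dual. For a cocycle [f], [s *: f] and the composite of [f] with [th] differ by a
    coboundary. Since each [g t] has values in [a] up to a coboundary, this writes [g t], modulo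
    coboundaries, as a combination of the [g u] with coefficients in [a]. By Nakayama's lemma some
    [s'] in [1 + a] makes every [s' *: g t] the coboundary of a [rho t], and the [rho t] form the
    homotopy [w] that removes degree [l]. *)
Lemma contract_step (a : ideal R) l : contracted a l ->
  (forall f : dual P (- l), cycle f -> exists b : dual P (- l),
     boundary b /\ forall p : P l, a ((f - b) l 0 p : R)) ->
  contracted a (l - 1).
Proof.
move=> [s [r [h [rs hP]]]] Zl.
pose th : Hom P P 0 := s *: hid P - diff (Hom P P) 1 0 h.
have cth : cycle th.
  by apply: cycleB; [apply: cycleZ; exact: hid_cycle | rewrite /cycle diff_diff].
have thE i p : th i i p = s *: p - diff (Hom P P) 1 0 h i i p.
  by rewrite hmapBE hmapZE hidE.
have th0 j p : l < j -> th j j p = 0 by move=> lj; rewrite thE (hP j p lj) subrr.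
have [k [x [xi xE]]] := fgproj_ord (pP l).
pose g t : dual P (- l) := hcomp (- l) (functional (xi t) : Hom P (sphereR R) (- l)) th.
have gE t p : g t l 0 p = xi t (th l l p).
  rewrite (@hcompE _ _ _ _ _ _ _ _ _ _ _ l) ?add0r ?addr0 //.
  by rewrite functionalE !trE.
have fE (f : dual P (- l)) : f = \sum_t (f l 0 (x t) : R) *: functional (xi t).
  apply: dual_eq => p; rewrite hmap_sumE [in LHS](xE p) hmap_sum; apply: eq_bigr => t _.
  by rewrite hmapZr hmapZE functionalE !trE /GRing.scale /= mulrC.
have gD (f : dual P (- l)) : hcomp (- l) (f : Hom P (sphereR R) (- l)) th =
    \sum_u (f l 0 (x u) : R) *: g u.
  rewrite [in LHS](fE f); apply: dual_eq => p; rewrite hmap_sumE.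
  rewrite (@hcompE _ _ _ _ _ _ _ _ _ _ _ l) ?add0r ?addr0 // hmap_sumE.
  apply: eq_bigr => u _; rewrite !hmapZE; congr (_ *: _).
  by rewrite gE functionalE !trE.
have cg t : cycle (g t).
  apply: hmap_eqP => i j q jE; rewrite dual_diffE //.
  have [j0|j0] := eqVneq j 0; last by rewrite [LHS](sphere0 _ j0) [RHS](sphere0 _ j0).
  move: j0 jE => -> jE; have il : l = i - 1 by lia.
  have -> : g t (i - 1) 0 (diff P i (i - 1) q) = 0; last by rewrite scaler0 oppr0.
  have iE : i = l + 1 by lia.
  clear il; subst i; rewrite /g (@hcompE _ _ _ _ _ _ _ _ _ _ _ (l + 1 - 1)) ?addr0 ?add0r //.
  have -> : th (l + 1 - 1) (l + 1 - 1) (diff P (l + 1) (l + 1 - 1) q) = 0.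
    have /hd_cycle := cth; move=> /(_ (l + 1) (l + 1) (l + 1 - 1) (l + 1 - 1) q).
    rewrite addr0 sg0 scale1r => <- //; rewrite th0 ?linear0 //; lia.
  by rewrite hmap_x0.
have bcomp (f : dual P (- l)) : cycle f ->
    boundary (s *: f - hcomp (- l) (f : Hom P (sphereR R) (- l)) th).
  move=> cf; have E : s *: f - hcomp (- l) (f : Hom P (sphereR R) (- l)) th =
      hcomp (- l) (f : Hom P (sphereR R) (- l)) (diff (Hom P P) 1 0 h).
    rewrite /th hcompDr hcompNr hcompZr hcomp1 opprD opprK addrA subrr add0r //.
  rewrite E -[hcomp _ _ _]scale1r -(sgK _ (- l)) -scalerA; apply: boundaryZ.
  have E2 : diff (dual P) (- l + 1) (- l) (hcomp (- l + 1) (f : Hom P (sphereR R) (- l)) h) =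
     hcomp (- l) (diff (dual P) (- l) (- l - 1) f : Hom P (sphereR R) (- l - 1)) h
     + sg (- l) *: hcomp (- l) (f : Hom P (sphereR R) (- l)) (diff (Hom P P) 1 0 h).
    by apply: hcomp_diff; lia.
  rewrite cf in E2; exists (hcomp (- l + 1) (f : Hom P (sphereR R) (- l)) h).
  by rewrite E2 hcomp0l add0r.
have bth (b : dual P (- l)) : boundary b ->
    boundary (hcomp (- l) (b : Hom P (sphereR R) (- l)) th).
  move=> [m mE]; exists (hcomp (- l + 1) (m : Hom P (sphereR R) (- l + 1)) th).
  have -> : diff (dual P) (- l + 1) (- l) (hcomp (- l + 1) (m : Hom P (sphereR R) (- l + 1)) th) =
     hcomp (- l) (diff (dual P) (- l + 1) (- l) m : Hom P (sphereR R) (- l)) th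
     + sg (- l + 1) *: hcomp (- l) (m : Hom P (sphereR R) (- l + 1)) (diff (Hom P P) 0 (- 1) th).
    by apply: hcomp_diff; lia.
  have -> : diff (Hom P P) 0 (-1) th = 0 by exact: cth.
  by rewrite mE hcomp0r scaler0 addr0.
have [t|s' as' sg'] := @nakayama R (dual P (- l)) a (boundary_sub (dual P) (- l)) k g.
  have [b [bb bE]] := Zl (g t) (cg t).
  (* The first summand compensates for [r * s] being 1 only modulo [a]. *)
  exists (fun u => (1 - r * s) * (u == t)%:R + r * ((g t - b) l 0 (x u) : R)).
    move=> u; apply: in_subD; last exact: idealM.
    by apply: idealMr; rewrite -opprB; exact: in_subN.
  have E : s *: g t - \sum_u ((g t - b) l 0 (x u) : R) *: g u =
     (s *: g t - hcomp (- l) (g t : Hom P (sphereR R) (- l)) th)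
       + hcomp (- l) (b : Hom P (sphereR R) (- l)) th.
    rewrite -(gD (g t - b)).
    have -> : hcomp (- l) ((g t - b : dual P (- l)) : Hom P (sphereR R) (- l)) th =
      hcomp (- l) (g t : Hom P (sphereR R) (- l)) th - hcomp (- l) (b : Hom P (sphereR R) (- l)) th.
      by rewrite hcompDl hcompNl.
    by rewrite opprB addrA addrAC.
  have bE2 : boundary (s *: g t - \sum_u ((g t - b) l 0 (x u) : R) *: g u).
    by rewrite E; apply: boundaryD; [exact: bcomp | exact: bth].
  have -> : g t - \sum_u ((1 - r * s) * (u == t)%:R + r * ((g t - b) l 0 (x u) : R)) *: g u =
     r *: (s *: g t - \sum_u ((g t - b) l 0 (x u) : R) *: g u).
    have -> : \sum_u ((1 - r * s) * (u == t)%:R + r * ((g t - b) l 0 (x u) : R)) *: g u =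
        (1 - r * s) *: g t + r *: \sum_u ((g t - b) l 0 (x u) : R) *: g u.
      rewrite scaler_sumr; under eq_bigr do rewrite scalerDl.
      rewrite big_split /=; congr (_ + _); last by apply: eq_bigr => u _; rewrite scalerA.
      rewrite (bigD1 t) //= eqxx mulr1 big1 ?addr0 // => u /negPf ->.
      by rewrite mulr0 scale0r.
    by rewrite scalerBr scalerBl scale1r scalerA opprD opprB addrA addrCA subrr addr0.
  exact: boundaryZ.
have /choice[rho rhoE] := sg'.
(* The sign of the differential of the dual, chosen so that [w] composed with the differential is
   [s' *: th] in degree [l]. *)
pose kap : R := - sg (- l + 1).
have lin : linear (fun q : P (l - 1) => \sum_t (kap * (rho t (l - 1) 0 q : R)) *: x t).
  move=> c u v; rewrite scaler_sumr -big_split; apply: eq_bigr => t _ /=.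
  rewrite hmapP scalerA -scalerDl; congr (_ *: _).
  by rewrite /GRing.scale /= mulrDr mulrCA.
have e1 : l = l - 1 + 1 by rewrite subrK.
pose w : Hom P P 1 := hsingle e1 (mklin lin).
have wE i j q : w i j q = tr j (mklin lin (tr (l - 1) q)) by [].
exists (s' * s), r, (s' *: h + w); split.
  have -> : r * (s' * s) - 1 = r * s * (s' - 1) + (r * s - 1) by ring.
  by apply: in_subD => //; exact: idealM.
move=> j p lj; rewrite linearD linearZ hmapDE hmapZE.
rewrite [diff (Hom P P) 1 0 w j j p](@hdE _ _ _ _ _ _ _ (j + 1) (j - 1)) //.
rewrite (sgS R 0 : sg 1 = - sg 0) sg0 scaleN1r opprK.
rewrite (wE j) [tr (l - 1) p]tr0; last by apply/eqP; lia.
rewrite !linear0 add0r.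
have [jl|jl] := eqVneq j l; last first.
  rewrite wE [tr (l - 1) _]tr0; last by apply/eqP => E; case/eqP: jl; lia.
  by rewrite !linear0 addr0 -scalerA (hP j p) //; lia.
subst j; have -> : (s' * s) *: p = s' *: th l l p + s' *: diff (Hom P P) 1 0 h l l p.
  by rewrite thE -scalerDr subrK scalerA.
rewrite addrC; congr (_ + _); rewrite wE !trE.
rewrite [th l l p](xE (th l l p)) scaler_sumr.
have -> : mklin lin (diff P l (l - 1) p) =
  \sum_t (kap * (rho t (l - 1) 0 (diff P l (l - 1) p) : R)) *: x t by [].
apply: eq_bigr => t _; rewrite scalerA; congr (_ *: _).
have := congr1 (fun f : dual P (- l) => f l 0 p) (rhoE t).
rewrite dual_diffE ?addrK // hmapZE gE => E; rewrite /kap mulNr.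
by rewrite -[X in s' * X]/(xi t (th l l p) : R); symmetry; exact: E.
Qed.
End PartialContraction.

Lemma maximal_prime (R : comNzRingType) (m : {pred R}) (mm : maximal_ideal m) :
  is_prime (ideal_of mm.1).
Proof.
split=> [m1|a b mab]; first by case: mm.1 => _ /negP.
have [am|am] := boolP (a \in m); first by left.
have [r rm] := maximal_unit mm am; right.
have -> : b = (1 - r * a) * b + r * (a * b) by ring.
apply: (@in_subD _ _ (ideal_of mm.1)); first exact: (idealMr (J := ideal_of mm.1)).
exact: (idealM (J := ideal_of mm.1)).
Qed.

(** * Functionals modulo a maximal ideal on the bottom homology *)

Section Residue.
Context (R : comNzRingType).

(* A functional on [L i] that detects a class of [H_i (L)] modulo [m]. *)
Definition residue (L : complex R) (i : int) (m : ideal R) (y : L i) (lam : L i -> R) :=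
  [/\ forall a x x', m (lam (a *: x + x') - (a * lam x + lam x')),
      forall w : L (i + 1), m (lam (diff L (i + 1) i w)) & ~ m (lam y)].

(** If [m L i] and the boundaries filled [L i], Nakayama's lemma would produce the excluded [s]. Any
    [y] outside their sum can be fed to [linear_mod_prime], since elements outside [m] are
    invertible modulo [m]. *)
Lemma residue_exists (L : complex R) i (m : {pred R}) (mm : maximal_ideal m) :
  fgproj (L i) ->
  ~ (exists2 s, s - 1 \in m & forall z : L i, boundary (s *: z)) ->
  exists y lam, @residue L i (ideal_of mm.1) y lam.
Proof.
move=> pL ns; have [k [x [xi xE]]] := fgproj_ord pL; pose J := ideal_of mm.1.
have [N0 N0E] : exists N0 : submodule (L i), forall z, N0 z <->
    exists c : 'I_k -> R, (forall t, J (c t)) /\ boundary (z - \sum_t c t *: x t).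
  unshelve eexists (@Submodule R (L i) (fun z =>
    exists c : 'I_k -> R, (forall t, J (c t)) /\ boundary (z - \sum_t c t *: x t)) _ _ _) => //.
  - exists (fun _ => 0); split=> [t|]; first exact: (in_sub0 J).
    by rewrite big1 ?subr0 => [|t _]; [exact: boundary0 | rewrite scale0r].
  - move=> u v [c [cJ cb]] [c' [cJ' cb']]; exists (fun t => c t + c' t).
    split=> [t|]; first exact: (in_subD (cJ t) (cJ' t)).
    under eq_bigr do rewrite scalerDl.
    by rewrite big_split /= opprD addrACA; exact: boundaryD.
  - move=> a u [c [cJ cb]]; exists (fun t => a * c t).
    split=> [t|]; first exact: (idealM a (cJ t)).
    under eq_bigr do rewrite -scalerA.
    by rewrite -scaler_sumr -scalerBr; exact: boundaryZ.
have [y ny] : exists y, ~ N0 y.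
  apply: contrapT => h; apply: ns.
  have [t|s sJ sx] := @nakayama R (L i) J (boundary_sub L i) k x.
    have /N0E[c [cJ cb]] : N0 (x t) by apply: contrapT => h'; apply: h; exists (x t).
    by exists c.
  exists s => // z; rewrite (xE z) scaler_sumr; apply: boundary_sum => t.
  by rewrite scalerA mulrC -scalerA; apply: boundaryZ; exact: sx.
have aN0 (a : R) z : J a -> N0 (a *: z).
  move=> Ja; apply/N0E; exists (fun t => a * xi t z); split=> [t|].
    exact: (idealMr _ Ja).
  under eq_bigr do rewrite -scalerA.
  by rewrite -scaler_sumr -(xE z) subrr; exact: boundary0.
have [z|t nt h|lam [l1 l2 l3]] := @linear_mod_prime R (L i) J (maximal_prime mm) N0 k x y aN0.
- by exists (fun t => xi t z); rewrite -(xE z) subrr; exact: in_sub0.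
- have [r rm] : exists r, 1 - r * t \in m by apply: (maximal_unit mm); apply/negP.
  apply: ny; rewrite -[y]scale1r -(subrK (r * t) 1) scalerDl.
  by apply: in_subD; [exact: aN0 | rewrite -scalerA; exact: in_subZ].
exists y, lam; split=> // w; apply: l2; apply/N0E; exists (fun _ => 0).
split=> [t|]; first exact: (in_sub0 J).
by rewrite big1 ?subr0 => [|t _]; [exists w | rewrite scale0r].
Qed.

(** The map that sends [v] to [f v *: y] is a cycle of [Hom P L], as [L] vanishes below [i]; being a
    boundary, it equals a boundary in [L] plus a term that depends on [d v]. Applying [lam] removes
    the former, and dividing by [lam y] modulo [m] exhibits [f] as a coboundary modulo [m]. *)
Lemma residue_coboundary (P L : complex R) (m : {pred R}) (mm : maximal_ideal m)
    (i l : int) y lam : (forall l, fgproj (P l)) ->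
  (forall (j : int) (x : L j), j < i -> x = 0) -> acyc (Hom P L) (i - l) ->
  @residue L i (ideal_of mm.1) y lam -> forall f : dual P (- l), cycle f ->
  exists b : dual P (- l), boundary b /\ forall p : P l, ideal_of mm.1 ((f - b) l 0 p : R).
Proof.
set J := ideal_of mm.1 => pP L0 aL [lamL lamB lamy] f cf.
have lin : linear (fun v : P l => (f l 0 v : R) *: y).
  by move=> a u v; rewrite hmapP scalerDl -scalerA.
have e : i = l + (i - l) by lia.
pose g : Hom P L (i - l) := hsingle e (mklin lin).
have gE a b v : g a b v = tr b ((f l 0 (tr l v) : R) *: y) by [].
have cg : cycle g.
  apply: hmap_eqP => a b v bE; rewrite (@hdE _ _ _ _ _ _ _ (b + 1) (a - 1)) // hmap0E.
  have -> : diff L (b + 1) b (g a (b + 1) v) = 0.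
    have [bi|bi] := ltP b i; first exact: (L0 _ _ bi).
    by rewrite gE tr0 ?linear0 //; apply/eqP; lia.
  rewrite sub0r gE; have [al|al] := eqVneq (a - 1) l; last first.
    by rewrite [tr l _]tr0 1?eq_sym // hmap_x0 scale0r linear0 scaler0 oppr0.
  have aE : a = l + 1 by lia.
  clear al; subst a.
  have -> : f l 0 (tr l (diff P (l + 1) (l + 1 - 1) v)) = 0.
    rewrite tr_diff ?addrK //.
    have := congr1 (fun h : dual P (- l - 1) => h (l + 1) 0 v) cf.
    rewrite dual_diffE // hmap0E.
    move: (l + 1 - 1) (addrK 1 l) => q qE; subst q => /eqP; rewrite oppr_eq0 => /eqP E.
    by rewrite -[LHS](scale1r) -(sgK R (- l)) -scalerA E scaler0.
  by rewrite scale0r linear0 scaler0 oppr0.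
have [w wE] := aL g cg.
pose kap : R := - sg (i - l + 1).
have fE v : (f l 0 v : R) *: y =
    diff L (i + 1) i (w l (i + 1) v) + kap *: w (l - 1) i (diff P l (l - 1) v).
  have := congr1 (fun h : Hom P L (i - l) => h l i v) wE.
  by rewrite (@hdE _ _ _ _ _ _ _ (i + 1) (l - 1)) ?addrK // gE !trE scaleNr => ->.
have [r rm] : exists r, J (1 - r * lam y) by apply: (maximal_unit mm); apply/negP.
pose mu0 (q : P (l - 1)) : R := r * lam (kap *: w (l - 1) i q).
have [k [x [xi xE]]] := fgproj_ord (pP (l - 1)).
(* [mu0] is additive only modulo [m]; its values on a dual basis define a genuine functional
   congruent to it. *)
have lin2 : linear (fun q : P (l - 1) => \sum_t (xi t q : R) * mu0 (x t) : R^o).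
  move=> a u v; rewrite scaler_sumr -big_split; apply: eq_bigr => t _ /=.
  by rewrite linearP mulrDl /GRing.scale /= -mulrA.
have lam0 : J (lam 0).
  have := lamL 1 0 0; rewrite scaler0 addr0 mul1r opprD addrA subrr sub0r => h.
  by rewrite -[lam 0]opprK; exact: (in_subN J).
have muE q : J (\sum_t (xi t q : R) * mu0 (x t) - mu0 q).
  have -> : mu0 q = r * lam (\sum_t (xi t q : R) *: (kap *: w (l - 1) i (x t))).
    rewrite /mu0 [in LHS](xE q) hmap_sum scaler_sumr; congr (_ * lam _).
    by apply: eq_bigr => t _; rewrite hmapZr !scalerA mulrC.
  elim/big_rec2: _ => [|t y1 y2 _ IH].
    by rewrite sub0r; apply: (in_subN J); exact: (idealM r lam0).
  have h := lamL (xi t q) (kap *: w (l - 1) i (x t)) y1.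
  have := in_subB J IH (idealM r h); congr (J _).
  by rewrite /mu0; ring.
have e1 : 0 = l - 1 + (- l + 1) by lia.
pose M : dual P (- l + 1) := hsingle e1 (mklin lin2 : {linear P (l - 1) -> sphereR R 0}).
have ME q : M (l - 1) 0 q = \sum_t (xi t q : R) * mu0 (x t).
  by rewrite -[LHS]/(tr 0 ((mklin lin2 : {linear P (l - 1) -> sphereR R 0}) (tr (l - 1) q))) !trE.
exists (diff (dual P) (- l + 1) (- l) ((- sg (- l + 1) : R) *: M)).
split=> [|p]; first by exists ((- sg (- l + 1) : R) *: M).
have -> : (f - diff (dual P) (- l + 1) (- l) ((- sg (- l + 1) : R) *: M)) l 0 p =
    (f l 0 p : R) - \sum_t (xi t (diff P l (l - 1) p) : R) * mu0 (x t).
  rewrite hmapBE dual_diffE ?addrK // hmapZE scalerA mulrN sgK scaleN1r opprK.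
  by rewrite ME.
set q := diff P l (l - 1) p.
have h1 := muE q.
have h2 : J (lam ((f l 0 p : R) *: y) - (f l 0 p : R) * lam y).
  have := in_subD (lamL (f l 0 p) y 0) lam0; rewrite addr0; congr (J _).
  by ring.
have h3 : J (lam ((f l 0 p : R) *: y) - lam (kap *: w (l - 1) i q)).
  rewrite fE; have := in_subD (lamL 1 (diff L (i + 1) i (w l (i + 1) p)) (kap *: w (l - 1) i q)) (lamB (w l (i + 1) p)).
  by rewrite scale1r; congr (J _); ring.
have h4 := idealM (f l 0 p : R) rm.
have := in_subB J (in_subD h4 (idealM r (in_subB J h3 h2))) h1.
congr (J _); rewrite /mu0.
have -> (a b c d e' : R) : a * (1 - r * b) + r * (c - d - (c - a * b)) - (e' - r * d) = a - e' by ring.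
by [].
Qed.
End Residue.

(** * Infima, suprema and the bounds *)

(** A nonempty set of integers that is bounded below attains its infimum; this turns the extended
    values [hinf] and [proj_dim] into integers. *)
Lemma infimum_int (A : int -> Prop) (n0 lo : int) : A n0 ->
  (forall n, A n -> lo <= n) -> exists m : int, [/\ A m, forall n, A n -> m <= n &
    infimum +oo%E [set n%:E | n in A]%classic = m%:E].
Proof.
move=> An0 loA; have ex : exists k : nat, `[< A (lo + k%:Z) >].
  exists `|(n0 - lo)%R|%N; apply/asboolP.
  by have -> : lo + `|(n0 - lo)%R|%N%:Z = n0 by have := loA _ An0; lia.
case: (ex_minnP ex) => k /asboolP Ak kmin; exists (lo + k%:Z).
have mA n : A n -> lo + k%:Z <= n.
  move=> An; have ln := loA _ An.
  suff : (k <= `|(n - lo)%R|)%N by lia.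
  by apply: kmin; apply/asboolP; have -> : lo + `|(n - lo)%R|%N%:Z = n by lia.
split=> //; rewrite /infimum ifF; last first.
  apply/negbTE/set0P; exists (lo + k%:Z)%:E; by exists (lo + k%:Z).
have mI : infimums [set n%:E | n in A]%classic (lo + k%:Z)%:E.
  split; first by move=> _ [n An <-]; rewrite lee_fin; exact: mA.
  by move=> y; apply; exists (lo + k%:Z).
by apply: xget_unique => // y yI; exact: is_subset1_infimums yI mI.
Qed.

Lemma supremum_int (A : int -> Prop) (n0 hi : int) : A n0 ->
  (forall n, A n -> n <= hi) -> exists m : int, [/\ A m, forall n, A n -> n <= m &
    supremum -oo%E [set n%:E | n in A]%classic = m%:E].
Proof.
move=> An0 hiA; have ex : exists k : nat, `[< A (hi - k%:Z) >].
  exists `|(hi - n0)%R|%N; apply/asboolP.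
  by have -> : hi - `|(hi - n0)%R|%N%:Z = n0 by have := hiA _ An0; lia.
case: (ex_minnP ex) => k /asboolP Ak kmin; exists (hi - k%:Z).
have mA n : A n -> n <= hi - k%:Z.
  move=> An; have ln := hiA _ An.
  suff : (k <= `|(hi - n)%R|)%N by lia.
  by apply: kmin; apply/asboolP; have -> : hi - `|(hi - n)%R|%N%:Z = n by lia.
split=> //; rewrite /supremum ifF; last first.
  apply/negbTE/set0P; exists (hi - k%:Z)%:E; by exists (hi - k%:Z).
have mI : supremums [set n%:E | n in A]%classic (hi - k%:Z)%:E.
  split; first by move=> _ [n An <-]; rewrite lee_fin; exact: mA.
  by move=> y; apply; exists (hi - k%:Z).
by apply: xget_unique => // y yI; exact: is_subset1_supremums yI mI.
Qed.

Lemma homology_range (R : comNzRingType) (X : complex R) (N : nat) n0 :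
  homology_nonzero X n0 -> (forall n : int, (N < `|n|)%N -> acyc X n) ->
  exists i s : int, [/\ homology_nonzero X i, homology_nonzero X s,
    forall n, homology_nonzero X n -> i <= n <= s, hinf X = i%:E & hsup X = s%:E].
Proof.
move=> h0 aX.
have bX n : homology_nonzero X n -> - N%:Z <= n <= N%:Z.
  move=> hn; have [Nn|nN] := ltnP N `|n|; last by lia.
  by have /acycP := aX _ Nn.
have [n hn|i [hi iP iE]] := infimum_int (lo := - N%:Z) h0; first by case/andP: (bX _ hn).
have [n hn|s [hs sP sE]] := supremum_int (hi := N%:Z) h0; first by case/andP: (bX _ hn).
by exists i, s; split=> // n hn; rewrite iP ?sP.
Qed.

Lemma hid_qi (R : comNzRingType) (X : complex R) :
  quasi_iso (mkchain (hid_cycle X)).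
Proof.
have E n (x : X n) : mkchain (hid_cycle X) n n x = x by exact: hidE.
move=> n; split=> [x _|y cy]; first by rewrite E.
by exists y => //; rewrite E subrr; exact: boundary0.
Qed.

Lemma homothety_nonzero (R : comNzRingType) (X I : complex R) (iota : chain_map X I) :
  K_injective I -> quasi_iso (homothety iota) -> exists n, homology_nonzero X n.
Proof.
move=> KI qh; apply: contrapT => nX.
have aX : acyclic X by move=> n hn; apply: nX; exists n.
have aH := proj1 (acyclicE _) (KI X aX) 0.
have /sphere_boundary/eqP : boundary (1 : sphereR R 0).
  apply: (qh 0).1; first exact: sphere_cycle.
  by apply: aH; apply: (hmor_cycle (chain_hmor (homothety iota))); exact: sphere_cycle.
by rewrite (oner_eq0 R).
Qed.

Section Resolution.
Context (R S : comNzRingType) (phi : {rmorphism R -> S}).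
Local Notation SR := (restrict phi S^o : lmodType R).
Context (P : complex R) (eps : chain_map P (sphere SR)) (N : nat).
Hypotheses (pP : forall l, fgproj (P l)) (P0 : forall l (x : P l), l < 0 -> x = 0)
  (PN : forall l (x : P l), N%:Z < l -> x = 0) (qe : quasi_iso eps).

Lemma contracted_iter (a : ideal R) lo : (forall l : int, lo < l -> l <= N%:Z ->
    forall f : dual P (- l), cycle f -> exists b : dual P (- l),
      boundary b /\ forall p : P l, a ((f - b) l 0 p : R)) ->
  lo <= N%:Z -> contracted P a lo.
Proof.
move=> st loN; have : forall d : nat, d%:Z <= N%:Z - lo -> contracted P a (N%:Z - d%:Z).
  elim=> [|d IH] dN; first by rewrite subr0; exact: contracted_top.
  have -> : N%:Z - d.+1%:Z = N%:Z - d%:Z - 1 by lia.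
  by apply: contract_step => //; [apply: IH; lia | apply: st; lia].
move=> /(_ `|(N%:Z - lo)%R|%N); have -> : N%:Z - `|(N%:Z - lo)%R|%N%:Z = lo by lia.
by apply; lia.
Qed.

Lemma exact_step (a : ideal R) l : acyc (dual P) (- l) -> forall f : dual P (- l),
  cycle f -> exists b : dual P (- l),
    boundary b /\ forall p : P l, a ((f - b) l 0 p : R).
Proof.
by move=> ad f cf; exists f; split=> [|p]; [exact: ad | rewrite subrr; exact: (in_sub0 a)].
Qed.

Lemma contracted_bottom (a : ideal R) : contracted P a (-1) -> exists s r, a (r * s - 1) /\ phi s = 0.
Proof.
move=> [s [r [h [rs hP]]]]; exists s, r; split=> //.
have [e0 e0E] := resolution_unit qe.
have sE : eps 0 0 (s *: e0) = phi s by rewrite hmapZr e0E -[LHS]/(phi s * 1) mulr1.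
rewrite -sE (hP 0 e0) // (@hdE _ _ _ _ _ _ _ 1 (-1)) //.
rewrite (P0 (diff P 0 (-1) e0)) // hmap_x0 scaler0 subr0.
by rewrite -(@chain_mapP _ _ _ eps 1 0).
Qed.

(** If the dual were exact, the identity of [P] could be contracted down to the bottom over the zero
    ideal, and a unit of [R] would be killed by [phi], although [S] is nonzero. *)
Lemma dual_nonzero : exists n, homology_nonzero (dual P) n.
Proof.
apply: contrapT => nd.
have [|s [r [/eqP]]] := @contracted_bottom (zero_submodule R^o).
  apply: contracted_iter; last by lia.
  by move=> l _ _; apply: exact_step; apply/acycP => h; apply: nd; exists (- l).
rewrite subr_eq0 => /eqP rs s0; have := rmorph1 phi; rewrite -rs rmorphM s0 mulr0.
by move/eqP; rewrite eq_sym oner_eq0.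
Qed.

(** The [s] for which [s] times the identity of [P N] factors through the top differential form an
    ideal. If it were proper, it would lie in a maximal ideal [m], but one contraction step at [m]
    produces such an [s] that is invertible modulo [m]. *)
Lemma split_top (L : complex R) i : (forall l, fgproj (L l)) ->
  (forall (j : int) (x : L j), j < i -> x = 0) -> acyc (Hom P L) (i - N%:Z) ->
  noetherian R ->
  (forall m : {pred R}, maximal_ideal m ->
    ~ (exists2 s, s - 1 \in m & forall z : L i, boundary (s *: z))) ->
  exists rho : {linear P (N%:Z - 1) -> P N%:Z},
    forall p : P N%:Z, rho (diff P N%:Z (N%:Z - 1) p) = p.
Proof.
move=> pL L0 aL nR kill.
pose Q (s : R) := exists rho : {linear P (N%:Z - 1) -> P N%:Z},
    forall p : P N%:Z, rho (diff P N%:Z (N%:Z - 1) p) = s *: p.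
have [W WE] : exists W : ideal R, forall s, W s <-> Q s.
  unshelve eexists (@Submodule R R^o Q _ _ _) => //.
  - by exists \0 => p; rewrite scale0r.
  - move=> s s' [u uE] [u' uE']; exists (u \+ u') => p.
    by rewrite /= uE uE' scalerDl.
  - move=> c s [u uE]; exists (c \*: u) => p.
    by rewrite /= uE scalerA.
have [W1|nW1] := pselect (W 1).
  by have /WE[u uE] := W1; exists u => p; rewrite uE scale1r.
have [m mm Wm] := proper_sub_maximal nR nW1.
have [y [lam res]] := residue_exists mm (pL i) (kill m mm).
have [s [r [h [rs hP]]]] : contracted P (ideal_of mm.1) (N%:Z - 1).
  apply: contract_step => //; first exact: contracted_top.
  exact: (residue_coboundary pP L0 aL res).
have sm : s \in m.
  apply: Wm; apply/WE.
  have lin : linear (fun q => h (N%:Z - 1) N%:Z q) by exact: hmapP.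
  exists (mklin lin) => p; rewrite (hP N%:Z p); last by lia.
  rewrite (@hdE _ _ _ _ _ _ _ (N%:Z + 1) (N%:Z - 1)) //.
  rewrite (PN (h N%:Z (N%:Z + 1) p)); last by lia.
  by rewrite linear0 sub0r (sgS R 0 : sg 1 = - sg 0) sg0 scaleN1r opprK.
exfalso; case: mm.1 => _ /negP m1 mc; apply: m1.
have rs' : r * s - 1 \in m by exact: rs.
have := mc (-1) _ _ rs' (mc r _ 0 sm _); rewrite addr0 mulN1r opprB subrK; apply.
by case: mm.1.
Qed.
End Resolution.

(** As [s] kills the bottom homology, [s *: f] agrees in degree [i] with the differential of a
    homotopy, and exactness of [C] above [i] extends it: [s *: f] is null-homotopic. Hence the
    homothety by [s] is a boundary, and injectivity of the homothety morphism on homology gives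
    [s = 0]. *)
Lemma homothety_faithful (R : comNzRingType) (C I L : complex R) (iota : chain_map C I)
    (f : chain_map L C) (i : int) (s : R) : K_injective I ->
  quasi_iso (homothety iota) -> quasi_iso f -> (forall l, fgproj (L l)) ->
  (forall (j : int) (x : L j), j < i -> x = 0) -> (forall j, i < j -> acyc C j) ->
  (forall z : L i, boundary (s *: z)) -> s = 0.
Proof.
move=> KI qh qf pL L0 aC sz.
have bL : bounded_below_projective L.
  by split; [exists i | move=> l; exact: fgproj_projective].
have [k [x [xi xE]]] := fgproj_ord (pL i).
have /choice[c cE] t : exists c : C (i + 1), diff C (i + 1) i c = s *: f i i (x t).
  by rewrite -hmapZr; exact: (hmor_boundary (chain_hmor f)).
have lin : linear (fun z : L i => \sum_t (xi t z : R) *: c t).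
  move=> a u v; rewrite scaler_sumr -big_split; apply: eq_bigr => t _ /=.
  by rewrite linearP scalerDl scalerA.
pose w : Hom L C 1 := hsingle (erefl (i + 1)) (mklin lin).
have wE a b z : w a b z = tr b (mklin lin (tr i z)) by [].
pose g : Hom L C 0 := s *: (f : Hom L C 0) - diff (Hom L C) 1 0 w.
have bg : boundary g.
  apply: (hom_tail_boundary (t := i + 1)) => //.
  - by apply: cycleB; [apply: cycleZ; exact: chain_cycle | rewrite /cycle diff_diff].
  - move=> a b z ai; have [ai'|ia] := ltP a i; first by rewrite (L0 _ z ai') hmap_x0.
    have ae : a = i by lia.
    clear ai ia; subst a; have [bi|bi] := eqVneq b i; last by rewrite hmap_shape ?addr0.
    subst b; rewrite hmapBE hmapZE (@hdE _ _ _ _ _ _ _ (i + 1) (i - 1)) //.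
    rewrite (L0 _ (diff L i (i - 1) z)) ?hmap_x0 ?scaler0 ?subr0; last by lia.
    rewrite wE !trE; have -> : mklin lin z = \sum_t (xi t z : R) *: c t by [].
    rewrite linear_sum [in f i i z](xE z) hmap_sum scaler_sumr -sumrB big1 // => t _.
    by rewrite linearZ /= cE hmapZr !scalerA mulrC subrr.
  by move=> l il; right; rewrite addr0; apply: aC; lia.
have bf : boundary (s *: (f : Hom L C 0)).
  rewrite -[_ *: _](subrK (diff (Hom L C) 1 0 w)); apply: boundaryD => //.
  exact: boundaryI.
have := hmor_boundary (chain_hmor (post L iota)) bf.
have -> : post L iota 0 0 (s *: (f : Hom L C 0)) =
    pre I f 0 0 (homothety iota 0 0 (s : sphereR R 0)).
  apply: hmap_eqP => a b z ->; rewrite (@postE _ _ _ _ _ _ _ _ _ a) ?addr0 // preE.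
  by rewrite hmapZE -[RHS]/(iota a a (s *: f a a z)).
have ch : cycle (homothety iota 0 0 (s : sphereR R 0)).
  by apply: (hmor_cycle (chain_hmor (homothety iota))); exact: sphere_cycle.
move=> /((pre_injective_qi KI qf 0).1 _ ch) /((qh 0).1 _ (sphere_cycle _)).
by move/sphere_boundary.
Qed.

Section Transfer.
Context (R S : comNzRingType) (phi : {rmorphism R -> S}) (nR : noetherian R).
Local Notation SR := (restrict phi S^o : lmodType R).

(** [N] is least among resolutions by finitely generated projectives, which is what
    [shorten_resolution] will contradict. It is compared with [proj_dim] only through homology, in
    [coinduced_bounds]. *)
Lemma minimal_resolution : fin_gen (restrict phi S^o) ->
  flat_dim (restrict phi S^o) \is a fin_num ->
  exists N : nat, fg_resolution SR N /\ forall n : nat, (n < N)%N -> ~ fg_resolution SR n.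
Proof.
move=> fS fd; have [n hn] : exists n, has_resolution (@flat R) SR n.
  apply: contrapT => h; move: fd; rewrite /flat_dim.
  have -> : [set n%:E | n in has_resolution (@flat R) (restrict phi S^o)]%classic = set0.
    by apply/seteqP; split=> // x [n hn _]; apply: h; exists n.
  by rewrite /infimum eqxx fin_numE eqxx andbF.
have [N0 hN0] := finite_resolution nR fS hn.
have ex : exists N : nat, `[< fg_resolution SR N >] by exists N0; apply/asboolP.
case: (ex_minnP ex) => N /asboolP hN Nmin; exists N; split=> // k kN hk.
have := Nmin k; rewrite leqNgt kN => /(_ _)/negP; apply=> //.
exact/asboolP.
Qed.

Lemma kernel_in_maximal : mSpec_sub_image phi -> forall a : R, phi a = 0 ->
  forall m : {pred R}, maximal_ideal m -> a \in m.
Proof.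
move=> ms a a0 m mm; have [q [[q0 _ _] _] mq] := ms m mm.
by rewrite mq inE /= a0.
Qed.

Context (I : complex R) (KI : K_injective I) (C : complex R) (iota : chain_map C I)
  (qi : quasi_iso iota).
Local Notation B := (hom_complex phi (sphere (S^o : lmodType S)) I).

(** Any projective resolution of [S] computes [B], so the estimate can be taken along one whose
    length is the projective dimension. *)
Lemma coinduced_spread (F : complex R) (e : chain_map F (sphere SR)) (k n : int) :
  (forall l, projective (F l)) ->
  (forall l : int, (l < 0) || (k < l) -> forall x : F l, x = 0) -> quasi_iso e ->
  homology_nonzero B n -> exists l : int, 0 <= l <= k /\ homology_nonzero C (l + n).
Proof.
move=> pF F0 qe hn; apply: contrapT => h.
have bF : bounded_below_projective F.
  by split=> //; exists 0 => l x l0; apply: F0; rewrite l0.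
suff : acyc B n by move/acycP; apply.
apply/(acyc_coinduced KI n bF qe qi); apply: acyc_hom => // l.
have [lk|lk] := boolP (0 <= l <= k); last first.
  by left; apply: F0; move: lk; rewrite negb_and -!ltNge.
by right; apply/acycP => hl; apply: h; exists l.
Qed.

Lemma semidualizing_homothety (X J : complex R) (kappa : chain_map X J) :
  K_injective J -> quasi_iso kappa -> semidualizing X -> quasi_iso (homothety kappa).
Proof.
move=> KJ qk [_ [I' [iota' [[KI' qi'] qh]]]].
exact: (homothety_independent KI' KJ qi' qk qh).
Qed.
End Transfer.

Lemma annihilator_maximal (R : comNzRingType) (nR : noetherian R) (L : complex R) i :
  (forall x : L i, cycle x) -> homology_nonzero L i ->
  exists2 m : {pred R}, maximal_ideal m &
    ~ (exists2 s, s - 1 \in m & forall z : L i, boundary (s *: z)).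
Proof.
move=> cL [z0 _ nz0].
have [A AE] : exists A : ideal R, forall s, A s <-> forall z : L i, boundary (s *: z).
  unshelve eexists (@Submodule R R^o (fun s => forall z : L i, boundary (s *: z)) _ _ _) => //.
  - by move=> z; rewrite scale0r; exact: boundary0.
  - by move=> s s' hs hs' z; rewrite scalerDl; exact: boundaryD.
  - by move=> c s hs z; rewrite -scalerA; exact: boundaryZ.
have [|m mm Am] := @proper_sub_maximal R nR A.
  by move=> /AE/(_ z0); rewrite scale1r.
exists m => // -[s sm /AE/Am sm']; case: mm.1 => m0 /negP m1 mc; apply: m1.
by have := mc (-1) _ _ sm sm'; rewrite mulN1r opprB subrK.
Qed.

(** * Ascent: from [C] to [B], which represents RHom (S, C) *)

Section FirstHalf.
Context (R S : comNzRingType) (phi : {rmorphism R -> S}).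
Context (nR : noetherian R) (C : complex R) (fC : degreewise_homologically_finite C).
Context (I : complex R) (iota : chain_map C I) (KI : K_injective I) (qi : quasi_iso iota).
Local Notation SR := (restrict phi S^o : lmodType R).
Local Notation B := (hom_complex phi (sphere (S^o : lmodType S)) I).
Context (P : complex R) (eps : chain_map P (sphere SR)) (N : nat).
Hypotheses (pP : forall l, fgproj (P l)) (P0 : forall l (x : P l), l < 0 -> x = 0)
  (PN : forall l (x : P l), N%:Z < l -> x = 0) (qe : quasi_iso eps).
Hypothesis Nmin : forall n : nat, (n < N)%N -> ~ fg_resolution SR n.
Hypothesis sC : semidualizing C.

Fact resolution_bounded : bounded P N.
Proof.
move=> l x ld; have [l0|l0] := ltP l 0; first exact: P0.
by apply: PN; lia.
Qed.
Fact resolution_projective : bounded_below_projective P.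
Proof. exact: bounded_projective pP resolution_bounded. Qed.

Lemma coinduced_semidualizing : semidualizing B.
Proof.
have qh := semidualizing_homothety KI qi sC.
have [[NC aC] bP] := (homologically_finite_bounded sC.1, resolution_projective).
split; last first.
  exists B, (mkchain (hid_cycle B)); split; last first.
    apply/(coinduced_homothety KI qe pP resolution_bounded qi).
    apply/acyclicE => n; apply: acyc_hom.
      exact: bounded_projective (dual_fgproj pP resolution_bounded) (dual_bounded resolution_bounded).
    by move=> l; right; move: (l + n); apply/acyclicE; apply/cone_qi.
  by split; [exact: coinduced_K_injective | exact: hid_qi].
apply: (bounded_homologically_finite (N := (NC + N)%N)).
  move=> n; apply: (homology_fin_gen_coinduced KI bP qe qi).
  apply: (hom_fg nR (T := N%:Z)) => //; first by exists 0.
  by move=> l lN; left=> x; exact: PN.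
move=> n nN; apply/(acyc_coinduced KI n bP qe qi); apply: acyc_hom => // l.
have [ld|ld] := leP `|l| N%:Z; last by left=> x; exact: resolution_bounded.
by right; apply: aC; lia.
Qed.

Lemma coinduced_bounds :
  [/\ (hinf C - proj_dim (restrict phi S^o) <= hinf B)%E,
      (hinf B <= hsup C)%E &
      (local_ring R \/ amp C = 0%E) ->
      (hinf C - proj_dim (restrict phi S^o))%E = hinf B].
Proof.
have qh := semidualizing_homothety KI qi sC.
have [NC aC] := homologically_finite_bounded sC.1.
have [nC hC] := homothety_nonzero KI qh.
have [i [t [hi ht iP iE tE]]] := homology_range hC aC.
have sB := coinduced_semidualizing.
have KB := coinduced_K_injective (phi := phi) KI.
have [nB hB] := homothety_nonzero KB
  (semidualizing_homothety KB (hid_qi B) sB).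
have [NB aB] := homologically_finite_bounded sB.1.
have [b [tb [hb _ bP bE _]]] := homology_range hB aB.
have resN : has_resolution (@projective R) SR N.
  exists P, eps; split=> // [l|l /orP[l0|lN] x]; first exact: fgproj_projective.
  - exact: P0.
  - exact: PN.
(* A resolution of length [n] has [0 <= n]: since [B] has homology, [coinduced_spread] produces a
   degree between 0 and [n]. So the projective dimension is an integer [p]. *)
have [n [F [e [pF F0 qF]]]|p [[F [e [pF F0 qF]]] pmin pE]] :=
    @infimum_int (has_resolution (@projective R) SR) N 0 resN.
  have [l [l01 _]] := coinduced_spread KI qi pF F0 qF hb; lia.
have pdE : proj_dim (restrict phi S^o) = p%:E by exact: pE.
have ip : i - p <= b.
  have [l [l01 hl]] := coinduced_spread KI qi pF F0 qF hb.
  by have := iP _ hl; lia.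
split; rewrite ?iE ?tE bE ?pdE -?EFinB ?lee_fin //.
  have [l [l01 hl]] := coinduced_spread KI qi pF F0 qF hb.
  by have := iP _ hl; lia.
move=> hyp; congr EFin; apply/eqP; rewrite eq_le ip /=.
(* This gives [b <= i - N <= i - p]. If the homology vanished there, [split_top] would split the top
   differential of [P] and contradict the minimality of [N]. *)
suff hN : homology_nonzero B (i - N%:Z).
  by have := bP _ hN; have := pmin _ resN; lia.
apply: contrapT => /acycP/(acyc_coinduced KI _ resolution_projective qe qi) aPC.
have [L [f [pL L0 qf]]] : exists (L : complex R) (f : chain_map L C),
    [/\ forall l, fgproj (L l), forall (l : int) (x : L l), l < i -> x = 0 & quasi_iso f].
  apply: free_resolution => // j ji; apply/acycP => hj.
  by have := iP _ hj; lia.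
have aPL : acyc (Hom P L) (i - N%:Z).
  exact/(hbij_acyc (chain_hmor (post P f)) (post_projective_qi resolution_projective qf)).
have cL (x : L i) : cycle x by rewrite /cycle; apply: L0; lia.
have hL : homology_nonzero L i.
  by apply: contrapT => /acycP/(hbij_acyc (chain_hmor f) qf)/acycP.
have [] := @split_top R P N pP PN L i pL L0 aPL nR.
  move=> m mm [s sm sz]; case: (mm.1) => m0 /negP m1 mc.
  have msN (c : R) : c \in m -> s \in m -> False.
    move=> _ sm'; apply: m1; have := mc (-1) _ _ sm sm'.
    by rewrite mulN1r opprB subrK.
  (* Each hypothesis excludes an [s] in [1 + m] that kills the bottom homology: over a local ring
     [s] is a unit, and for amplitude 0 [homothety_faithful] gives [s = 0]. *)
  case: hyp => [[m' mm' um]|aC0].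
    have [r rs] : exists r, r * s = 1.
      apply: (unit_of_maximal nR) => m2 mm2; apply/negP => sm2.
      by apply: (msN 0) => //; rewrite (um _ mm) -(um _ mm2).
    case: hL => z _; apply; rewrite -[z]scale1r -rs -scalerA.
    exact: boundaryZ.
  have ti : t = i.
    move: aC0; rewrite /amp iE tE -EFinB => -[].
    by move=> /eqP; rewrite subr_eq0 => /eqP.
  have s0 : s = 0.
    apply: (homothety_faithful KI qh qf pL L0 _ sz) => j ij.
    by apply/acycP => hj; have := iP _ hj; lia.
  by apply: (msN 0) => //; rewrite s0.
(* For [N = 0] the splitting passes through [P (-1)], which is zero; then [P 0] is zero, and so is
   [S]. *)
move=> rho rhoE; have [N0|N0] := posnP N.
  have [e0 e0E] := resolution_unit qe.
  have : (1 : S) = 0.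
    rewrite -e0E; have -> : e0 = 0; last by rewrite hmap_x0.
    have P00 (z : P N%:Z) : z = 0.
      by rewrite -(rhoE z) (P0 (diff P N%:Z (N%:Z - 1) z)) ?linear0 //; lia.
    by move: P00; rewrite N0; apply.
  by move/eqP; rewrite oner_eq0.
have N1 : (1 : int) <= N%:Z by lia.
have := shorten_resolution N1 pP P0 PN qe rhoE.
have -> : N%:Z - 1 = N.-1%:Z by lia.
by apply: Nmin; lia.
Qed.
End FirstHalf.

(** * Descent: from [B] to [C] *)

Section SecondHalf.
Context (R S : comNzRingType) (phi : {rmorphism R -> S}).
Context (nR : noetherian R) (phi_finite : fin_gen (restrict phi S^o)).
Context (C : complex R) (fC : degreewise_homologically_finite C).
Context (I : complex R) (iota : chain_map C I) (KI : K_injective I) (qi : quasi_iso iota).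
Context (J : complex R) (kappa : chain_map (sphereR R) J) (KJ : K_injective J)
  (qk : quasi_iso kappa).
Local Notation SR := (restrict phi S^o : lmodType R).
Local Notation B := (hom_complex phi (sphere (S^o : lmodType S)) I).
Local Notation D := (hom_complex phi (sphere (S^o : lmodType S)) J).
Context (P : complex R) (eps : chain_map P (sphere SR)) (N : nat).
Hypotheses (pP : forall l, fgproj (P l)) (P0 : forall l (x : P l), l < 0 -> x = 0)
  (PN : forall l (x : P l), N%:Z < l -> x = 0) (qe : quasi_iso eps).
Hypotheses (sB : semidualizing B) (ms : mSpec_sub_image phi).
Let bdP := resolution_bounded P0 PN.
Let bP := resolution_projective pP P0 PN.
Let qhB : quasi_iso (homothety (mkchain (hid_cycle B))) :=
  semidualizing_homothety (coinduced_K_injective KI) (hid_qi B) sB.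

Lemma descent_window : exists w : nat, forall X, degreewise_homologically_finite X ->
  forall n, win (Hom (Hom P P) X) n w -> acyc X n.
Proof.
apply: (acyc_hom_endomorphism_window nR phi_finite pP P0 bdP qe).
exact: kernel_in_maximal ms.
Qed.

(** The window for [X = C]: [Hom (Hom P P) C] is [Hom (dual P) (Hom P C)], and [Hom P C] has the
    homology of [B], which is bounded; so the window around any remote degree is acyclic. *)
Lemma descent_bounded : exists NC : nat, forall n : int, (NC < `|n|)%N -> acyc C n.
Proof.
have [NB aB] := homologically_finite_bounded sB.1.
have [w wP] := descent_window; exists (NB + N + w)%N => n nN; apply: wP => // m m1 m2.
apply/(acyc_hom_endomorphism pP bdP).
have h : win (Hom (dual P) (Hom P C)) m 0.
  apply: (win_hom (d := N)); [exact: dual_fgproj pP bdP | exact: dual_bounded bdP |].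
  move=> l l1 l2; apply/(acyc_coinduced KI l bP qe qi); apply: aB; lia.
by apply: h; lia.
Qed.

(** As [C] is bounded, a free resolution of it shows that [Hom C I] has finitely generated homology,
    so the window applies to the cone [X] of the homothety. The hypothesis on [B] makes
    [Hom (dual P) X] acyclic; applying [Hom P] and exchanging arguments gives the acyclicity of
    [Hom (dual P) (Hom P X)]. *)
Lemma descent_homothety : quasi_iso (homothety iota).
Proof.
have [NC aC] := descent_bounded; have [w wP] := descent_window.
have [L [f [pL L0 qf]]] : exists (L : complex R) (f : chain_map L C),
    [/\ forall l, fgproj (L l), forall (l : int) (x : L l), l < - NC%:Z -> x = 0 & quasi_iso f].
  by apply: free_resolution => // j ji; apply: aC; lia.
have bL : bounded_below_projective L.
  by split; [exists (- NC%:Z) | move=> l; exact: fgproj_projective].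
have fX : degreewise_homologically_finite (cone (homothety iota)).
  apply: (cone_fin_gen nR) => n.
    apply: sphere_fg; exists 1%N, (fun _ => 1) => x; exists (fun _ => x).
    by rewrite big_ord1 /GRing.scale /= mulr1.
  apply/(qi_homology_fin_gen n (pre_injective_qi KI qf)).
  apply/(qi_homology_fin_gen n (post_projective_qi bL qi)).
  apply: (hom_fg nR (T := NC%:Z + `|n|%N%:Z)) => //; first by exists (- NC%:Z).
  by move=> l lT; right; apply: aC; lia.
have aD := proj1 (acyclicE _) (proj1 (coinduced_homothety KI qe pP bdP qi) qhB).
apply/cone_qi/acyclicE => n; apply: wP => // m m1 m2.
apply/(acyc_hom_endomorphism pP bdP); apply: acyc_swap; apply: acyc_hom => // l.
by right; exact: aD.
Qed.

Lemma descent_semidualizing : semidualizing C.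
Proof.
have [NC aC] := descent_bounded; split; first exact: bounded_homologically_finite aC.
by exists I, iota; split; [split | exact: descent_homothety].
Qed.

Lemma descent_bounds :
  (hinf B <= hinf C + hsup D)%E /\ (amp D = 0%E -> hinf B = (hinf C + hsup D)%E).
Proof.
have [NC aC] := descent_bounded.
have [nC hC] := homothety_nonzero KI descent_homothety.
have [i [tc [hi _ iP iE _]]] := homology_range hC aC.
have [NB aB] := homologically_finite_bounded sB.1.
have [nB hB] := homothety_nonzero (coinduced_K_injective KI) qhB.
have [b [tb [hb _ bE' bE _]]] := homology_range hB aB.
have DE n : acyc D n <-> acyc (dual P) n by exact: (acyc_coinduced KJ n bP qe qk).
have [nD hD] : exists n, homology_nonzero D n.
  have [n hn] := dual_nonzero pP P0 PN qe; exists n.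
  by apply: contrapT => /acycP/DE/acycP.
have aDN (n : int) : (N < `|n|)%N -> acyc D n.
  move=> nN; apply/DE => x _; have -> : x = 0 by apply: (dual_bounded bdP); lia.
  exact: boundary0.
have [g [t [hg ht tP gE tE]]] := homology_range hD aDN.
have [L [f [pL L0 qf]]] : exists (L : complex R) (f : chain_map L C),
    [/\ forall l, fgproj (L l), forall (l : int) (x : L l), l < i -> x = 0 & quasi_iso f].
  apply: free_resolution => // j ji; apply/acycP => hj.
  by have := iP _ hj; lia.
have BL n : acyc B n <-> acyc (Hom P L) n.
  apply: iff_trans (acyc_coinduced KI n bP qe qi) _; apply: iff_sym.
  exact: (hbij_acyc (chain_hmor (post P f)) (post_projective_qi bP qf)).
have cL (x : L i) : cycle x by rewrite /cycle; apply: L0; lia.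
have hL : homology_nonzero L i.
  by apply: contrapT => /acycP/(hbij_acyc (chain_hmor f) qf)/acycP.
have acD n : ~~ (g <= n <= t) -> acyc (dual P) n.
  by move=> gn; apply/DE/acycP => hn; move/negP: gn; apply; exact: tP.
have bit : b <= i + t.
  (* If [i + t < b], every degree [l] of [P] can be contracted at a maximal ideal [m] that sees the
     bottom homology of [C]: for [- l > t] the dual is exact, and for [- l <= t] the degree [i - l]
     lies below [b], where [Hom P L] has no homology. *)
  rewrite leNgt; apply/negP => itb.
  have [m mm nm] := annihilator_maximal nR cL hL.
  have [y [lam res]] := residue_exists mm (pL i) nm.
  have [|s [r [rs s0]]] := @contracted_bottom _ _ _ _ _ P0 qe (ideal_of mm.1).
    apply: (contracted_iter pP PN); last by lia.
    move=> l _ _; have [lt|lt] := ltP t (- l).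
      by apply: exact_step; apply: acD; lia.
    apply: (residue_coboundary pP L0 _ res); apply/BL/acycP => hn.
    by have := bE' _ hn; lia.
  (* The contraction ends with an [s] killed by [phi] and invertible modulo [m], whereas the kernel
     of [phi] lies in [m]. *)
  have sm := kernel_in_maximal ms s0 mm.
  case: (mm.1) => m0 /negP m1 mc; apply: m1.
  have rs' : r * s - 1 \in m by exact: rs.
  have := mc (-1) _ _ rs' (mc r _ 0 sm m0).
  by rewrite addr0 mulN1r opprB subrK.
rewrite bE iE tE; split; first by rewrite -EFinD lee_fin.
move=> aD0; have gt : g = t.
  move: aD0; rewrite /amp gE tE -EFinB => -[].
  by move=> /eqP; rewrite subr_eq0 => /eqP.
subst g; rewrite -EFinD; congr EFin; apply/eqP; rewrite eq_le bit /=.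
rewrite leNgt; apply/negP => bit'; suff : acyc B b by move/acycP; apply.
(* The dual has homology in degree [t] only, so even over the zero ideal the identity of [P]
   contracts in all degrees above [- t]. *)
have [s [r [h [/eqP]]]] : contracted P (zero_submodule R^o) (- t).
  have [tn|tn] := leP (- t) N%:Z.
    apply: (contracted_iter pP PN) => // l l1 l2.
    by apply: exact_step; apply: acD; lia.
  have := contracted_top (P := P) (zero_submodule R^o) (N := - t); apply=> l p lt.
  by apply: PN; lia.
rewrite subr_eq0 => /eqP rs hP; apply/BL => u cu.
(* In a degree [j <= - t] both sides land in degree [j + b], which is less than [i], and [L]
   vanishes there; above [- t] the contraction applies. *)
have E : s *: u = hcomp b (u : Hom P L b) (diff (Hom P P) 1 0 h).
  apply: hmap_eqP => j k p kE; rewrite hmapZE (@hcompE _ _ _ _ _ _ _ _ _ _ _ j) ?addr0 ?add0r //.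
  have [tj|jt] := ltP (- t) j; first by rewrite -hmapZr (hP j p).
  by rewrite [LHS]L0 ?[RHS]L0 //; lia.
rewrite -[u]scale1r -rs -scalerA E; apply: boundaryZ.
have E2 : diff (Hom P L) (b + 1) b (hcomp (b + 1) (u : Hom P L b) h) =
    hcomp b (diff (Hom P L) b (b - 1) u) h
      + sg b *: hcomp b (u : Hom P L b) (diff (Hom P P) 1 0 h).
  by apply: hcomp_diff; lia.
rewrite cu hcomp0l add0r in E2.
rewrite -[hcomp _ _ _]scale1r -(sgK R b) -scalerA -E2; apply: boundaryZ.
by exists (hcomp (b + 1) (u : Hom P L b) h).
Qed.
End SecondHalf.

Theorem theorem5p5 (R S : comNzRingType) (phi : {rmorphism R -> S})
  (noethR : noetherian R) (noethS : noetherian S)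
  (phi_finite : fin_gen (restrict phi S^o))
  (fdS : flat_dim (restrict phi S^o) \is a fin_num)
  (C : complex R) (C_finite : degreewise_homologically_finite C)
  (I : complex R) (iota : chain_map C I)
  (resI : injective_resolution iota)
  (J : complex R) (kappa : chain_map (sphere R^o) J)
  (resJ : injective_resolution kappa) :
  let RHomSC := hom_complex phi (sphere S^o) I in
  let RHomSR := hom_complex phi (sphere S^o) J in
  (semidualizing C ->
     [/\ semidualizing RHomSC,
         (hinf C - proj_dim (restrict phi S^o) <= hinf RHomSC)%E,
         (hinf RHomSC <= hsup C)%E &
         (local_ring R \/ amp C = 0%E) ->
         (hinf C - proj_dim (restrict phi S^o))%E = hinf RHomSC])
  /\
  (semidualizing RHomSC -> mSpec_sub_image phi ->
     [/\ semidualizing C,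
         (hinf RHomSC <= hinf C + hsup RHomSR)%E &
         amp RHomSR = 0%E ->
         hinf RHomSC = (hinf C + hsup RHomSR)%E]).
Proof.
case: resI => KI qi; case: resJ => KJ qk.
have [N [[P [eps [pP P0 PN qe]]] Nmin]] := minimal_resolution noethR phi_finite fdS.
split=> [sC | sB ms].
  have [b1 b2 b3] := coinduced_bounds noethR C_finite KI qi pP P0 PN qe Nmin sC.
  by split=> //; exact: (coinduced_semidualizing noethR C_finite KI qi pP P0 PN qe sC).
have [b1 b2] :=
  descent_bounds noethR phi_finite C_finite KI qi KJ qk pP P0 PN qe sB ms.
split=> //.
exact: (descent_semidualizing noethR phi_finite C_finite KI qi pP P0 PN qe sB ms).
Qed.
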